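(* The Hopf algebra $\mathcal{D}$ is a universal Hopf algebra in the category of Leibnitz–Hopf algebras with an antipode satisfying the formula $\chi(H_i)=(-1)^iH_i$. That is, $\mathcal{D}$, with the generators $d_1,d_2,\dots$, is a Leibnitz–Hopf algebra over $\mathbb Z$ whose antipode satisfies $\chi(d_i)=(-1)^id_i$, and for any Leibnitz–Hopf algebra $\mathcal{H}$ over $\mathbb Z$ whose antipode satisfies $\chi(H_i)=(-1)^iH_i$ on its fixed generators $H_i$, there exists a unique Hopf algebra homomorphism $\mathcal{D}\to\mathcal{H}$.
   Context: A combinatorial polytope is a combinatorial equivalence class of convex polytopes. The ring of polytopes $\mathcal{P}$ is, as an abelian group, free on all combinatorial convex polytopes; multiplication is induced by the direct product $P\times Q$, and the unit is the point. For $k\geqslant 0$ the linear operator $d_k:\mathcal{P}\to\mathcal{P}$ sends an $n$-dimensional polytope $P^n$ to the sum of all its $(n-k)$-dimensional (non-empty) faces (so $d_0=\mathrm{id}$, and $d_kP^n=0$ for $k>n$). $\mathcal{D}$ is the subring of $\mathrm{Hom}_{\mathbb Z}(\mathcal{P},\mathcal{P})$ (multiplication is composition of operators) generated by $d_k$, $k\geqslant 1$; it is a graded Hopf algebra over $\mathbb Z$ with $\deg d_k=k$ and comultiplication $\Delta d_k=\sum_{i+j=k}d_i\otimes d_j$. A Leibnitz–Hopf algebra over a commutative associative ring $R$ with unity is an associative Hopf algebra $\mathcal{H}$ over $R$ with a fixed sequence of a finite or countable number of multiplicative generators $H_i$, $i=1,2,\dots$, satisfying the comultiplication formula $\Delta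 H_n=\sum_{i+j=n}H_i\otimes H_j$, $H_0=1$. A universal Leibnitz–Hopf algebra over $R$ is a Leibnitz–Hopf algebra $\mathcal{A}$ with the universal property: for any Leibnitz–Hopf algebra $\mathcal{H}$ over $R$ there exists a unique Hopf algebra homomorphism $\mathcal{A}\to\mathcal{H}$. Here ''universal'' is meant in this sense, within the Leibnitz–Hopf algebras over $\mathbb Z$ whose antipode $\chi$ satisfies the stated formula.
   Formalization: Homomorphisms are required to send d_i to H_i, and uniqueness is among these (otherwise d_i ↦ 0 is a second Hopf endomorphism of D); a finite sequence of generators counts as H_i = 0 beyond its end, with the comultiplication formula imposed for all n. *)

(* Defs.v *)
From HB Require Import structures.
From mathcomp Require Import all_boot all_order all_algebra generic_quotient.
From mathcomp Require Import freeg.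
From mathcomp Require Import boolp classical_sets functions cardinality fsbigop.
From mathcomp Require Import reals interval_inference convex.

Set Implicit Arguments.
Unset Strict Implicit.
Unset Printing Implicit Defensive.

Import Order.TTheory GRing.Theory Num.Theory.

Local Open Scope classical_set_scope.
Local Open Scope ring_scope.
Local Open Scope quotient_scope.

Section Tensor.
Variables A B : zmodType.

Definition biadditive (M : zmodType) (f : A -> B -> M) : Prop :=
  (forall b, zmod_morphism (f^~ b)) /\ (forall a, zmod_morphism (f a)).

Definition tsum (M : zmodType) (f : A -> B -> M) (s : seq (A * B)) : M :=
  \sum_(p <- s) f p.1 p.2.

(* Formal sums of pairs are identified when no biadditive map into an abelian
   group separates them, that is, when they agree in the universal one. The
   minus sign of a formal difference is absorbed by [- (a, b) ~ (- a, b)]. *)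
Definition tequiv (s t : seq (A * B)) : bool :=
  `[< forall (M : zmodType) (f : A -> B -> M), biadditive f ->
        tsum f s = tsum f t >].

Lemma tequiv_refl : reflexive tequiv.
Proof. by move=> s; apply/asboolP. Qed.

Lemma tequiv_sym : symmetric tequiv.
Proof.
move=> s t; apply/idP/idP => /asboolP h; apply/asboolP => M f bf;
  by rewrite h.
Qed.

Lemma tequiv_trans : transitive tequiv.
Proof.
move=> s t u /asboolP h1 /asboolP h2; apply/asboolP => M f bf.
by rewrite h1 // h2.
Qed.

Canonical tequiv_rel := EquivRel tequiv tequiv_refl tequiv_sym tequiv_trans.

Definition tensor : Type := {eq_quot tequiv}.
HB.instance Definition _ := Choice.on tensor.
HB.instance Definition _ := EqQuotient.on tensor.

Definition tens (a : A) (b : B) : tensor := \pi_tensor [:: (a, b)].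

(* The additive map [A (x) B -> M] induced by [f]; only meaningful when [f] is
   biadditive. *)
Definition tlift (M : zmodType) (f : A -> B -> M) (x : tensor) : M :=
  tsum f (repr x).

Lemma tlift_pi (M : zmodType) (f : A -> B -> M) s :
  biadditive f -> tlift f (\pi_tensor s) = tsum f s.
Proof.
move=> bf; rewrite /tlift.
have /eqmodP/asboolP -> // : repr (\pi_tensor s) = s %[mod tensor].
by rewrite reprK.
Qed.

Lemma tlift_ext (x y : tensor) :
  (forall (M : zmodType) (f : A -> B -> M), biadditive f ->
     tlift f x = tlift f y) -> x = y.
Proof.
move=> h; rewrite -[x]reprK -[y]reprK; apply/eqmodP/asboolP => M f bf.
by have := h M f bf; rewrite /tlift.
Qed.

Definition tzero : tensor := \pi_tensor [::].
Definition tadd (x y : tensor) : tensor := \pi_tensor (repr x ++ repr y).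
Definition topp (x : tensor) : tensor :=
  \pi_tensor [seq (- p.1, p.2) | p <- repr x].

Lemma tlift0 (M : zmodType) (f : A -> B -> M) : biadditive f ->
  tlift f tzero = 0.
Proof. by move=> bf; rewrite tlift_pi // /tsum big_nil. Qed.

Lemma tliftD (M : zmodType) (f : A -> B -> M) x y : biadditive f ->
  tlift f (tadd x y) = tlift f x + tlift f y.
Proof. by move=> bf; rewrite tlift_pi // /tsum big_cat. Qed.

Lemma biadditive0l (M : zmodType) (f : A -> B -> M) b : biadditive f ->
  f 0 b = 0.
Proof. by move=> [fl _]; rewrite -[in LHS](subrr 0) fl subrr. Qed.

Lemma biadditiveNl (M : zmodType) (f : A -> B -> M) a b : biadditive f ->
  f (- a) b = - f a b.
Proof.
by move=> bf; have [fl _] := bf; rewrite -[- a]sub0r fl biadditive0l // sub0r.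
Qed.

Lemma tliftN (M : zmodType) (f : A -> B -> M) x : biadditive f ->
  tlift f (topp x) = - tlift f x.
Proof.
move=> bf; rewrite tlift_pi // /tlift /tsum big_map -sumrN.
by apply: eq_bigr => p _; exact: biadditiveNl.
Qed.

Lemma taddA : associative tadd.
Proof.
move=> x y z; apply: tlift_ext => M f bf; rewrite !tliftD //. by rewrite addrA.
Qed.
Lemma taddC : commutative tadd.
Proof. by move=> x y; apply: tlift_ext => M f bf; rewrite !tliftD // addrC. Qed.
Lemma tadd0 : left_id tzero tadd.
Proof.
by move=> x; apply: tlift_ext => M f bf; rewrite tliftD // tlift0 // add0r.
Qed.
Lemma taddN : left_inverse tzero topp tadd.
Proof.
by move=> x; apply: tlift_ext => M f bf; rewrite tliftD // tliftN // tlift0 // addNr.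
Qed.

HB.instance Definition _ := GRing.isZmodule.Build tensor taddA taddC tadd0 taddN.

Lemma tlift_tens (M : zmodType) (f : A -> B -> M) a b : biadditive f ->
  tlift f (tens a b) = f a b.
Proof. by move=> bf; rewrite tlift_pi // /tsum big_seq1. Qed.

Lemma tlift_is_additive (M : zmodType) (f : A -> B -> M) : biadditive f ->
  zmod_morphism (tlift f).
Proof. by move=> bf x y; rewrite tliftD // tliftN. Qed.

Lemma biadditive_tens : biadditive tens.
Proof.
by split=> c x y; apply: tlift_ext => M f bf;
  rewrite (tlift_is_additive bf) !tlift_tens //; case: bf => fl fr;
  rewrite ?fl ?fr.
Qed.

Lemma tensor_ind (P : tensor -> Prop) :
  P 0 -> (forall a b, P (tens a b)) -> (forall x y, P x -> P y -> P (x + y)) ->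
  forall x, P x.
Proof.
move=> P0 P1 PD x; rewrite -[x]reprK; elim: (repr x) => [//|[a b] s IH].
suff -> : \pi_tensor ((a, b) :: s) = tens a b + \pi_tensor s by exact: PD.
apply: tlift_ext => M f bf; rewrite tliftD // tlift_tens // !tlift_pi //.
by rewrite /tsum big_cons.
Qed.

End Tensor.

Arguments tens {A B} a b.
(* [x ⊗ y] is a pure tensor; the group itself is [tensor A B]. *)
Notation "x ⊗ y" := (tens x y) (at level 40, left associativity) : ring_scope.

Section TensorMaps.

Definition tmap (A B A' B' : zmodType) (f : A -> A') (g : B -> B') :
    tensor A B -> tensor A' B' :=
  tlift (fun a b => f a ⊗ g b).

Definition tassoc (A B C : zmodType) :
    tensor (tensor A B) C -> tensor A (tensor B C) :=
  tlift (fun x c => tlift (fun a b => a ⊗ (b ⊗ c)) x).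

Definition tunitl (A : zmodType) : tensor int A -> A :=
  tlift (fun n a => a *~ n).

Definition tunitr (A : zmodType) : tensor A int -> A :=
  tlift (fun a n => a *~ n).

Definition tmult (A : pzRingType) : tensor A A -> A :=
  tlift (fun a b => a * b).

Lemma tmapE (A B A' B' : zmodType) (f : {additive A -> A'})
    (g : {additive B -> B'}) a b : tmap f g (a ⊗ b) = f a ⊗ g b.
Proof.
apply: tlift_tens; have [hl hr] := biadditive_tens A' B'.
by split=> c x y; rewrite raddfB ?hl ?hr.
Qed.

Lemma biadditive_tens3 (A B C : zmodType) (c : C) :
  biadditive (fun (a : A) (b : B) => a ⊗ (b ⊗ c)).
Proof.
have [hl hr] := biadditive_tens A (tensor B C).
have [kl kr] := biadditive_tens B C.
by split=> d x y; rewrite ?kl ?hl ?hr.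
Qed.

Lemma tassocE (A B C : zmodType) (a : A) (b : B) (c : C) :
  tassoc ((a ⊗ b) ⊗ c) = a ⊗ (b ⊗ c).
Proof.
rewrite /tassoc tlift_tens; first by rewrite tlift_tens //; exact: biadditive_tens3.
have [hl hr] := biadditive_tens A (tensor B C).
have [kl kr] := biadditive_tens B C.
split=> [d|x c1 c2]; first exact/tlift_is_additive/biadditive_tens3.
have bi c' := @biadditive_tens3 A B C c'.
elim/tensor_ind: x => [|a1 b1|x y IHx IHy].
- by rewrite !(tlift0 (bi _)) subrr.
- by rewrite !(tlift_tens _ _ (bi _)) kr hr.
- by rewrite !(tliftD _ _ (bi _)) IHx IHy opprD addrACA.
Qed.

Lemma tunitlE (A : zmodType) n (a : A) : tunitl (n ⊗ a) = a *~ n.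
Proof.
by apply: tlift_tens; split=> c x y; rewrite /= ?mulrzBr ?mulrzBl.
Qed.

Lemma tunitrE (A : zmodType) n (a : A) : tunitr (a ⊗ n) = a *~ n.
Proof.
by apply: tlift_tens; split=> c x y; rewrite /= ?mulrzBr ?mulrzBl.
Qed.

Lemma tmultE (A : pzRingType) (a b : A) : tmult (a ⊗ b) = a * b.
Proof. by apply: tlift_tens; split=> c x y; rewrite /= ?mulrBl ?mulrBr. Qed.

End TensorMaps.

Section TensorRing.
Variables A B : pzRingType.
Implicit Types x y z : tensor A B.

Definition tone : tensor A B := 1 ⊗ 1.

Definition tmul x y : tensor A B :=
  tlift (fun a b => tlift (fun a' b' => (a * a') ⊗ (b * b')) y) x.

Let tmul_inner (a : A) (b : B) :
  biadditive (fun a' b' => (a * a') ⊗ (b * b')).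
Proof.
have [hl hr] := biadditive_tens A B.
by split=> c x y; rewrite mulrBr ?hl ?hr.
Qed.

Let tmul_outer y :
  biadditive (fun a b => tlift (fun a' b' => (a * a') ⊗ (b * b')) y).
Proof.
have [hl hr] := biadditive_tens A B.
split=> c u v.
  elim/tensor_ind: y => [|a b|y z IHy IHz].
  - by rewrite !(tlift0 (tmul_inner _ _)) subrr.
  - by rewrite !(tlift_tens _ _ (tmul_inner _ _)) mulrBl hl.
  - by rewrite !(tliftD _ _ (tmul_inner _ _)) IHy IHz opprD addrACA.
elim/tensor_ind: y => [|a b|y z IHy IHz].
- by rewrite !(tlift0 (tmul_inner _ _)) subrr.
- by rewrite !(tlift_tens _ _ (tmul_inner _ _)) mulrBl hr.
- by rewrite !(tliftD _ _ (tmul_inner _ _)) IHy IHz opprD addrACA.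
Qed.

Lemma tmul_tens a b a' b' : tmul (a ⊗ b) (a' ⊗ b') = (a * a') ⊗ (b * b').
Proof. by rewrite /tmul tlift_tens // tlift_tens. Qed.

Lemma tmulDl : left_distributive tmul +%R.
Proof. by move=> x y z; exact: tliftD. Qed.

Lemma tmulDr : right_distributive tmul +%R.
Proof.
move=> x y z; elim/tensor_ind: x => [|a b|x x' IH IH'].
- by rewrite /tmul !tlift0 // addr0.
- by rewrite /tmul !tlift_tens // tliftD.
- by rewrite !tmulDl IH IH' addrACA.
Qed.

Let tmul0l x : tmul 0 x = 0. Proof. exact: tlift0. Qed.
Let tmul0r x : tmul x 0 = 0.
Proof. by apply: (addIr (tmul x 0)); rewrite -tmulDr !add0r. Qed.

Lemma tmulA : associative tmul.
Proof.
move=> x y z; elim/tensor_ind: x => [|a b|x x' IH IH'].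
- by rewrite !tmul0l.
- elim/tensor_ind: y => [|a' b'|y y' IH IH'].
  + by rewrite tmul0l !tmul0r tmul0l.
  + elim/tensor_ind: z => [|a'' b''|z z' IH IH'].
    * by rewrite !tmul0r.
    * by rewrite !tmul_tens !mulrA.
    * by rewrite !tmulDr IH IH'.
  + by rewrite !(tmulDl, tmulDr) IH IH'.
- by rewrite !tmulDl IH IH'.
Qed.

Lemma tmul1l : left_id tone tmul.
Proof.
elim/tensor_ind => [|a b|x y IHx IHy]; first exact: tmul0r.
- by rewrite tmul_tens !mul1r.
- by rewrite tmulDr IHx IHy.
Qed.

Lemma tmul1r : right_id tone tmul.
Proof.
elim/tensor_ind => [|a b|x y IHx IHy]; first exact: tmul0l.
- by rewrite tmul_tens !mulr1.
- by rewrite tmulDl IHx IHy.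
Qed.

HB.instance Definition _ := GRing.Zmodule_isPzRing.Build (tensor A B)
  tmulA tmul1l tmul1r tmulDl tmulDr.

Lemma tensM (a a' : A) (b b' : B) :
  (a ⊗ b) * (a' ⊗ b') = (a * a') ⊗ (b * b').
Proof. exact: tmul_tens. Qed.

End TensorRing.

Section GeneratedSubring.
Variables (A : pzRingType) (G : set A).

Definition subring_generated : set A :=
  smallest (fun S : set A => subring_closed (mem S)) G.

Definition in_subring_generated : {pred A} := mem subring_generated.

Lemma in_subring_generatedP : subring_closed in_subring_generated.
Proof.
split=> [|x y|x y]; rewrite !inE.
- by move=> S /= [[S1 _ _] _]; rewrite inE in S1.
- move=> hx hy S /= hS; have := hx _ hS; have := hy _ hS.
  case: hS => -[_ SB _] _ Sy Sx.
  by have := SB x y; rewrite !inE; apply.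
- move=> hx hy S /= hS; have := hx _ hS; have := hy _ hS.
  case: hS => -[_ _ SM] _ Sy Sx.
  by have := SM x y; rewrite !inE; apply.
Qed.

HB.instance Definition _ :=
  GRing.isSubringClosed.Build A in_subring_generated in_subring_generatedP.

Record gen_subring : Type := GenSubring {
  gen_subring_val : A;
  gen_subring_valP : gen_subring_val \in in_subring_generated }.

HB.instance Definition _ := [isSub for gen_subring_val].
HB.instance Definition _ := [Choice of gen_subring by <:].
HB.instance Definition _ :=
  GRing.SubChoice_isSubPzRing.Build A in_subring_generated gen_subring
    in_subring_generatedP.

End GeneratedSubring.

Definition endo (U : zmodType) : Type := {additive U -> U}.

Section Endo.
Variable U : zmodType.
Implicit Types f g h : endo U.

HB.instance Definition _ := gen_eqMixin (endo U).
HB.instance Definition _ := gen_choiceMixin (endo U).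

Lemma endo_ext f g : f =1 g -> f = g.
Proof.
case: f g => f [[hf]] [g [[hg]]] /= /funext efg.
move: efg hf hg => -> hf hg; congr (GRing.Additive.Pack _ ).
by rewrite (Prop_irrelevance hf hg).
Qed.

Definition endo_zero : endo U := \0.
Definition endo_opp f : endo U := \- f.
Definition endo_add f g : endo U := f \+ g.
Definition endo_one : endo U := idfun.
Definition endo_mul f g : endo U := f \o g.

Lemma endo_addA : associative endo_add.
Proof. by move=> f g h; apply: endo_ext => x /=; rewrite addrA. Qed.
Lemma endo_addC : commutative endo_add.
Proof. by move=> f g; apply: endo_ext => x /=; rewrite addrC. Qed.
Lemma endo_add0 : left_id endo_zero endo_add.
Proof. by move=> f; apply: endo_ext => x /=; rewrite add0r. Qed.
Lemma endo_addN : left_inverse endo_zero endo_opp endo_add.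
Proof. by move=> f; apply: endo_ext => x /=; rewrite addNr. Qed.
Lemma endo_mulA : associative endo_mul.
Proof. by move=> f g h; apply: endo_ext. Qed.
Lemma endo_mul1l : left_id endo_one endo_mul.
Proof. by move=> f; apply: endo_ext. Qed.
Lemma endo_mul1r : right_id endo_one endo_mul.
Proof. by move=> f; apply: endo_ext. Qed.
Lemma endo_mulDl : left_distributive endo_mul endo_add.
Proof. by move=> f g h; apply: endo_ext. Qed.
Lemma endo_mulDr : right_distributive endo_mul endo_add.
Proof. by move=> f g h; apply: endo_ext => x /=; rewrite raddfD. Qed.

HB.instance Definition _ :=
  GRing.isZmodule.Build (endo U) endo_addA endo_addC endo_add0 endo_addN.
HB.instance Definition _ := GRing.Zmodule_isPzRing.Build (endo U)
  endo_mulA endo_mul1l endo_mul1r endo_mulDl endo_mulDr.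

End Endo.


Section Polytopes.
Local Open Scope convex_scope.
Variable R : realType.

Section FixedDimension.
Variable n : nat.
Implicit Types P F : set 'rV[R]_n.

Definition conv_hull (S : set 'rV[R]_n) : set 'rV[R]_n :=
  smallest (@convex_set R 'rV[R]_n) S.

Definition is_polytope P : Prop :=
  P !=set0 /\ exists s : seq 'rV[R]_n, P = conv_hull [set` s].

(* Faces are cut out by valid inequalities; this includes [P] itself
   ([c = 0], [b = 0]) and the empty face ([c = 0], [b = 1]). *)
Definition is_face P F : Prop :=
  exists (c : 'cV[R]_n) (b : R),
    (forall x, P x -> (x *m c) 0 0 <= b) /\
    F = P `&` [set x | (x *m c) 0 0 = b].

Definition affine_frame P k (x : 'rV[R]_n) (A : 'M[R]_(k, n)) : Prop :=
  [/\ P x, forall i, P (x + row i A) & row_free A].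

(* The largest [k] such that [P] contains [k + 1] affinely independent points;
   the value [0] at [P = set0] is never used. *)
Definition affine_dim P : nat :=
  \max_(k < n.+1 | `[< exists x (A : 'M[R]_(k, n)), affine_frame P x A >]) k.

Record polytope : Type := Polytope {
  polytope_set :> set 'rV[R]_n;
  polytopeP : is_polytope polytope_set }.

HB.instance Definition _ := gen_eqMixin polytope.
HB.instance Definition _ := gen_choiceMixin polytope.

Lemma polytope_inj (P Q : polytope) :
  polytope_set P = polytope_set Q -> P = Q.
Proof.
case: P Q => P hP [Q hQ] /= ePQ; move: ePQ hP hQ => -> hP hQ.
by rewrite (Prop_irrelevance hP hQ).
Qed.

Lemma conv_hull_convex S : @convex_set R 'rV[R]_n (conv_hull S).
Proof.
move=> x y l; rewrite !inE => hx hy C hC; have := hx _ hC; have := hy _ hC.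
case: hC => cC _ Cy Cx.
by have := cC x y l; rewrite !inE; apply.
Qed.

Lemma mulmx_conv (c : 'cV[R]_n) (l : {i01 R}) (x y : convex_lmodType 'rV[R]_n) :
  ((x <| l |> y : 'rV[R]_n) *m c) 0 0 =
  l%:num * ((x : 'rV[R]_n) *m c) 0 0 +
  (1 - l%:num) * ((y : 'rV[R]_n) *m c) 0 0.
Proof. by rewrite /conv /= mulmxDl -!scalemxAl !mxE. Qed.


Lemma face_conv_hull (s : seq 'rV[R]_n) F :
  is_face (conv_hull [set` s]) F ->
  exists m : (size s).-tuple bool, F = conv_hull [set` mask m s].
Proof.
move=> [c [b [hb ->]]]; pose a (x : 'rV[R]_n) := (x *m c) 0 0 == b.
exists (map_tuple a (in_tuple s)); rewrite /= -filter_mask; set s' := filter a s.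
have s'b : conv_hull [set` s'] `<=` [set x | (x *m c) 0 0 = b].
  move=> x; apply; split=> [y z l|y /=].
    rewrite !inE /= => hy hz; rewrite mulmx_conv hy hz -mulrDl.
    by rewrite addrC subrK mul1r.
  by rewrite mem_filter => /andP[/eqP].
have s'P : conv_hull [set` s'] `<=` conv_hull [set` s].
  apply: smallest_sub; first exact: conv_hull_convex.
  move=> x /=; rewrite mem_filter => /andP[_ xs].
  exact: (@sub_gen_smallest _ _ [set` s]).
apply/seteqP; split=> x; last by move=> hx; split; [exact: s'P|exact: s'b].
move=> [Px /= xb].
pose Z : set 'rV[R]_n := [set x | conv_hull [set` s] x /\
  ((x *m c) 0 0 < b \/ conv_hull [set` s'] x)].
suff /(_ x Px) [_ [|//]] : conv_hull [set` s] `<=` Z by rewrite xb ltxx.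
apply: smallest_sub => [|y /= ys].
  apply/convex_setW => y z; rewrite !inE => -[Py hy] [Pz hz] l l0 l1.
  rewrite inE; split.
    have := @conv_hull_convex [set` s] y z l; rewrite !inE; exact.
  have hle u : (u *m c) 0 0 < b \/ conv_hull [set` s'] u -> (u *m c) 0 0 <= b.
    by case=> [/ltW//|/s'b /= ->].
  have l1' : 0 < 1 - l%:num by rewrite subr_gt0.
  have eb : b = l%:num * b + (1 - l%:num) * b.
    by rewrite -mulrDl addrC subrK mul1r.
  case: hy => [hy|hy].
    left; rewrite mulmx_conv [ltRHS]eb ltr_leD //.
      by rewrite ltr_pM2l.
    by rewrite ler_pM2l // hle.
  case: hz => [hz|hz].
    left; rewrite mulmx_conv [ltRHS]eb ler_ltD //.
      by rewrite ler_pM2l // hle //; right.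
    by rewrite ltr_pM2l.
  right; have := @conv_hull_convex [set` s'] y z l; rewrite !inE; exact.
have Py : conv_hull [set` s] y by exact: (@sub_gen_smallest _ _ [set` s]).
split=> //; have := hb _ Py; rewrite le_eqVlt => /orP[yb|]; last by left.
by right; apply: (@sub_gen_smallest _ _ [set` s']); rewrite /= mem_filter ys andbT.
Qed.

Lemma nonempty_face_polytope P F :
  is_polytope P -> is_face P F -> F !=set0 -> is_polytope F.
Proof.
move=> [_ [s ->]] /face_conv_hull[m ->] F0; split=> //.
by exists (mask m s).
Qed.

Lemma finite_faces P : is_polytope P -> finite_set [set F | is_face P F].
Proof.
move=> [_ [s ->]].
apply: (@sub_finite_set _ _
  [set conv_hull [set` mask m s] | m in [set: (size s).-tuple bool]]).
  by move=> F /face_conv_hull[m ->]; exists m.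
exact/finite_image/finite_finset.
Qed.

Lemma affine_frame_le P k (x : 'rV[R]_n) (A : 'M[R]_(k, n)) :
  affine_frame P x A -> (k <= affine_dim P)%N.
Proof.
move=> hA; have kn : (k < n.+1)%N.
  by case: hA => _ _ /eqP <-; rewrite ltnS rank_leq_col.
apply: (@leq_bigmax_cond _ _ (fun k : 'I_n.+1 => nat_of_ord k) (Ordinal kn)).
by apply/asboolP; exists x, A.
Qed.

Lemma affine_frame_ex P : P !=set0 ->
  exists x (A : 'M[R]_(affine_dim P, n)), affine_frame P x A.
Proof.
move=> [x0 Px0]; rewrite /affine_dim.
elim/big_ind: _ => [|k l hk hl|k /asboolP //].
  exists x0, 0; split=> //; first by case.
  by rewrite /row_free mxrank0.
by rewrite /maxn; case: ifP.
Qed.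

Lemma face_full_dim P F : is_face P F -> F !=set0 ->
  affine_dim F = affine_dim P -> F = P.
Proof.
move=> [c [b [hb eF]]] F0 dF; apply/seteqP; split; rewrite eF; first by move=> x [].
move=> p Pp; split=> //=; apply/eqP; apply: contraT => pb.
have FE y : F y -> P y /\ (y *m c) 0 0 = b by rewrite eF => -[].
have [x [A [Fx FA fA]]] := affine_frame_ex F0.
have cx : (x *m c) 0 0 = b by case: (FE _ Fx).
have cA : A *m c = 0.
  apply/matrixP => i j; rewrite ord1 [RHS]mxE.
  have [_] := FE _ (FA i); rewrite mulmxDl mxE cx.
  move/(canRL (addKr _)); rewrite addNr -row_mul mxE => <-; by rewrite !mxE.
have vA : ~~ (p - x <= A)%MS.
  apply/negP => /submxP[D hD]; move: pb => /eqP; apply.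
  have : (p - x) *m c = 0 by rewrite hD -mulmxA cA mulmx0.
  by rewrite mulmxBl => /eqP; rewrite subr_eq0 => /eqP ->.
have : affine_frame P x (col_mx A (p - x)).
  split.
  - by case: (FE _ Fx).
  - move=> i; case: (split_ordP i) => j ->.
      by rewrite rowKu; case: (FE _ (FA j)).
    by rewrite rowKd row_id addrC subrK.
  - have : (\rank A < \rank (col_mx A (p - x)))%N.
      rewrite -addsmxE; apply: rank_ltmx; rewrite ltmxE addsmxSl /=.
      by apply: contra vA; apply: submx_trans; exact: addsmxSr.
    rewrite (eqP fA) /row_free eqn_leq rank_leq_row /= => h.
    by apply: leq_trans h; rewrite addn1.
by move/affine_frame_le; rewrite -dF addn1 ltnn.
Qed.





End FixedDimension.

Record any_polytope : Type := AnyPolytope {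
  ambient_dim : nat;
  any_polytope_body : polytope ambient_dim }.

HB.instance Definition _ := gen_eqMixin any_polytope.
HB.instance Definition _ := gen_choiceMixin any_polytope.

(* An isomorphism of face lattices. *)
Definition comb_equiv (P Q : any_polytope) : bool :=
  let: AnyPolytope n P := P in let: AnyPolytope m Q := Q in
  `[< exists f : set 'rV[R]_n -> set 'rV[R]_m,
        set_bij [set F | is_face P F] [set G | is_face Q G] f /\
        forall F G, is_face P F -> is_face P G ->
          (f F `<=` f G <-> F `<=` G) >].

Lemma comb_equiv_refl : reflexive comb_equiv.
Proof.
move=> [n P] /=; apply/asboolP; exists id; split=> //.
by split=> [F|F G|F] //=; exists F.
Qed.

Lemma comb_equiv_sym : symmetric comb_equiv.
Proof.
suff imp P Q : comb_equiv P Q -> comb_equiv Q P.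
  by move=> P Q; apply/idP/idP; exact: imp.
case: P Q => n P [m Q] /asboolP[f [[fPQ finj fsurj] fmono]]; apply/asboolP.
have /choice[g gP] G : exists F, is_face Q G -> is_face P F /\ f F = G.
  have [QG|nQG] := pselect (is_face Q G); last by exists set0.
  by have [F /= PF fF] := fsurj _ QG; exists F.
exists g; split; last first.
  move=> F G /gP[PF {2}<-] /gP[PG {2}<-].
  exact: iff_sym (fmono _ _ PF PG).
split.
- by move=> G /gP[].
- move=> F G; rewrite !inE => /gP[_ {2}<-] /gP[_ {2}<-] ->//.
- move=> F PF; exists (f F); first exact: fPQ.
  have [PgF fgF] := gP _ (fPQ _ PF).
  by apply: finj; rewrite ?inE.
Qed.

Lemma comb_equiv_trans : transitive comb_equiv.
Proof.
move=> [m Q] [n P] [l S] /asboolP[f [fbij fmono]] /asboolP[g [gbij gmono]].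
apply/asboolP; exists (g \o f); split; first exact: set_bij_comp fbij gbij.
have [fPQ _ _] := fbij.
move=> F G PF PG; apply: iff_trans (fmono _ _ PF PG).
by apply: gmono; exact: fPQ.
Qed.

Canonical comb_equiv_rel :=
  EquivRel comb_equiv comb_equiv_refl comb_equiv_sym comb_equiv_trans.

Definition comb_polytope : Type := {eq_quot comb_equiv}.
HB.instance Definition _ := Choice.on comb_polytope.
HB.instance Definition _ := EqQuotient.on comb_polytope.

(* The additive group of the ring of polytopes; the product of polytopes plays
   no role in its ring of endomorphisms. *)
Definition polytope_group : Type := {freeg comb_polytope / int}.
HB.instance Definition _ := GRing.Lmodule.on polytope_group.

Definition comb_class n (P : polytope n) : polytope_group :=
  << \pi_comb_polytope (AnyPolytope P) >>.

(* The elements of [polytope n] are nonempty, so that the empty face does not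
   contribute; by [nonempty_face_polytope] every other face is counted, and by
   [finite_faces] the sum is over a finite set. *)
Definition face_sum (k n : nat) (P : polytope n) : polytope_group :=
  \sum_(Q \in [set Q : polytope n | is_face P Q /\
                 (affine_dim Q + k = affine_dim P)%N]) comb_class Q.

(* Dimensions of faces are determined by the face lattice, so the chosen
   representative of [C] does not matter. *)
Definition face_op_fun (k : nat) : polytope_group -> polytope_group :=
  fglift (fun C : comb_polytope => face_sum k (any_polytope_body (repr C))).

Lemma face_op_fun_additive k : zmod_morphism (face_op_fun k).
Proof. exact: lift_is_additive. Qed.

HB.instance Definition _ k := GRing.isZmodMorphism.Build
  polytope_group polytope_group (face_op_fun k) (face_op_fun_additive k).

Definition face_op (k : nat) : endo polytope_group := face_op_fun k.

Lemma face_sum0 n (P : polytope n) : face_sum 0 P = comb_class P.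
Proof.
rewrite /face_sum; set A := [set _ | _].
have -> : A = [set P]; last by rewrite fsbig_set1.
apply/seteqP; split=> Q; rewrite /A /= addn0.
  move=> -[hQ dQ]; apply: polytope_inj.
  apply: face_full_dim hQ _ dQ.
  by have [] := polytopeP Q.
move=> ->; split=> //; exists 0, 0; split.
  by move=> x _; rewrite mulmx0 mxE.
by apply/seteqP; split=> x /=; [rewrite mulmx0 mxE|case].
Qed.

Lemma face_op0 : face_op 0 = 1.
Proof.
apply: endo_ext => x /=; rewrite -[x in LHS]freeg_sumE raddf_sum /=.
rewrite -[RHS]freeg_sumE; apply: eq_bigr => C _.
rewrite /face_op_fun liftU face_sum0 /comb_class.
have -> : AnyPolytope (any_polytope_body (repr C)) = repr C by case: (repr C).
rewrite reprK; apply/eqP/freeg_eqP => D.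
by rewrite coeffZ !coeffU mul1r.
Qed.

(* The multiplication of [endo] is composition. *)
Definition face_alg : Type :=
  gen_subring [set face_op k | k in [set k | (0 < k)%N]].
HB.instance Definition _ := GRing.PzRing.on face_alg.

Lemma face_op_in k :
  face_op k \in in_subring_generated [set face_op k | k in [set k | (0 < k)%N]].
Proof.
case: k => [|k]; first by rewrite face_op0; exact: rpred1.
by rewrite inE; apply: sub_gen_smallest; exists k.+1.
Qed.

Definition face_gen (k : nat) : face_alg := GenSubring (face_op_in k).

End Polytopes.

Section HopfAlgebras.

(* Hopf algebras over the integers: a ring is the same as an associative unital
   algebra over the integers. *)
Record hopf (A : pzRingType) : Type := Hopf {
  comul : {rmorphism A -> tensor A A};
  counit : {rmorphism A -> int};
  antipode : {additive A -> A};
  coassoc : forall x,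
    tassoc (tmap comul idfun (comul x)) = tmap idfun comul (comul x);
  counit_l : forall x, tunitl (tmap counit idfun (comul x)) = x;
  counit_r : forall x, tunitr (tmap idfun counit (comul x)) = x;
  antipode_l : forall x, tmult (tmap antipode idfun (comul x)) = (counit x)%:~R;
  antipode_r : forall x, tmult (tmap idfun antipode (comul x)) = (counit x)%:~R
}.

(* [h i] is the generator H_i for [0 < i], and H_0 = 1. A finite sequence of
   generators is one that vanishes from some index on. *)
Definition leibniz_hopf (A : pzRingType) (hA : hopf A) (h : nat -> A) : Prop :=
  [/\ h 0%N = 1,
      forall n, comul hA (h n) = \sum_(i < n.+1) h i ⊗ h (n - i)%N
    & subring_generated [set h i | i in [set i | (0 < i)%N]] = setT].

Definition sign_antipode (A : pzRingType) (hA : hopf A) (h : nat -> A) : Prop :=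
  forall i, antipode hA (h i) = (-1) ^+ i * h i.

Definition hopf_morphism (A B : pzRingType) (hA : hopf A) (hB : hopf B)
    (f : {rmorphism A -> B}) : Prop :=
  [/\ forall x, comul hB (f x) = tmap f f (comul hA x),
      forall x, counit hB (f x) = counit hA x
    & forall x, antipode hB (f x) = f (antipode hA x)].

End HopfAlgebras.

(* Main.v *)
Require Import Defs.
From HB Require Import structures.
From mathcomp Require Import all_boot all_order all_algebra generic_quotient.
From mathcomp Require Import finmap freeg.
From mathcomp Require Import boolp classical_sets functions cardinality fsbigop.
From mathcomp Require Import reals interval_inference convex.
From mathcomp Require Import lra zify.

(** Sending [H_0, H_1, ...] to a family with [H_0 = 1] extends to a ring morphism
    from the ring of face operators as soon as the family satisfies Euler's
    relations [sum_(i <= n) (-1)^i H_i H_(n-i) = 0], [n > 0]. Since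
    [chi(H_i) = (-1)^i H_i], the antipode axiom says exactly that the generators
    of [H] satisfy them. The operators [d_k] satisfy them by Euler's formula in
    the intervals [[F, P]] of face lattices, and the point is that they satisfy
    no others (Bayer-Billera).

    Euler's formula: the faces of [P] containing [F] correspond to the strata of
    the cone of linear functionals that attain their maximum on [F]; the signed
    count of strata is additive under cutting by hyperplanes, which reduces it to
    the trivial case of one weak inequality.

    Independence: modulo Euler's relations, a homogeneous formal sum of words of
    degree [n > 1] is [x = sum_(a >= 2) d_a x_a]. Let [D] be the derivation
    [d_k |-> d_(k-1)], and let [eta_P(d_a u)] be the number of flags of [P] counted
    by [u], where [dim P = n - 1]. Prisms and pyramids give
    [eta_(pyr P) = eta_P o D] and [eta_(prism P) = eta_P o (2 D - r)], where [r]
    lowers the index of the first letter. If [eta] kills [x], then by induction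
    [D x_a = 0] for all [a] and [sum_a d_(a-1) x_a = 0]; applying [D] repeatedly
    to the latter gives [x_a = 0], starting from the largest [a].

    The comultiplication, the counit and the antipode are then obtained from the
    presentation, and compatibility with antipodes is automatic because
    convolution inverses are unique. *)

Set Implicit Arguments.
Unset Strict Implicit.
Unset Printing Implicit Defensive.

Import Order.TTheory GRing.Theory Num.Theory.

Local Open Scope classical_set_scope.
Local Open Scope ring_scope.
Local Open Scope quotient_scope.

(** * Formal sums of words in the operators *)

(** Euler's relations are imposed semantically: [euler_null] means vanishing under every family that
    satisfies them. No quotient ring is built, and the morphism to a given family is well defined
    once every formal sum that acts as zero on polytopes is [euler_null]; all the geometry goes into
    this statement, [face_op_faithful]. Products are compositions, so the last letter of a word acts
    first and the first letter is the final step of a flag, down to its smallest face. Hence flags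
    are counted by recursion on the right end of a word, while the functional [eta_P] removes the
    letter at the left end. That functional is accessible because, in degree [dim P + 1], it is the
    flag number of the pyramid minus half that of the prism: the apex is the only asymmetry between
    the two. Division by 2 is harmless since the integers are torsion-free. The antipode reverses
    products, so it is obtained as a ring morphism to the opposite ring. *)

Section FreeLift.
Variable K : choiceType.
Implicit Types x y : {freeg K / int}.

Lemma freeg_ind (P : {freeg K / int} -> Prop) :
  (forall w, P << w >>) -> (forall x y, P x -> P y -> P (x - y)) ->
  P 0 -> forall x, P x.
Proof.
move=> PU PB P0 x.
have PN y : P y -> P (- y) by rewrite -[- y]sub0r; apply: PB.
have PD y z : P y -> P z -> P (y + z).
  by move=> Py Pz; rewrite -[z]opprK; apply: PB => //; exact: PN.
rewrite -(freeg_sumE x); elim/big_ind: _ => // w _.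
rewrite -[coeff w x]intz -freegU_mulz.
have PM n : P (<< w >> *+ n) by elim: n => [|n IH]; rewrite ?mulrS //; exact: PD.
by case: (coeff w x) => n; rewrite ?NegzE ?mulrNz -pmulrn //; apply: PN.
Qed.

(** [zmodule M] views an abelian group as a module over the integers, which is what [fglift]
    expects. *)
Definition freeg_lift (M : zmodType) (f : K -> M) : {freeg K / int} -> M :=
  @fglift int (zmodule M) K f.

Lemma freeg_lift_is_additive (M : zmodType) (f : K -> M) :
  zmod_morphism (freeg_lift f).
Proof. exact: (@lift_is_additive int K (zmodule M) f). Qed.

HB.instance Definition _ (M : zmodType) (f : K -> M) :=
  GRing.isZmodMorphism.Build {freeg K / int} M (freeg_lift f)
    (freeg_lift_is_additive f).

Lemma freeg_liftU (M : zmodType) (f : K -> M) w : freeg_lift f << w >> = f w.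
Proof. by rewrite /freeg_lift liftU scale1r. Qed.

Lemma freeg_ext (M : zmodType) (f g : {additive {freeg K / int} -> M}) :
  (forall w, f << w >> = g << w >>) -> f =1 g.
Proof.
move=> fg; apply: freeg_ind => [//|x y fx fy|]; last by rewrite !raddf0.
by rewrite !raddfB fx fy.
Qed.

End FreeLift.

Notation fsum := {freeg (seq nat) / int}.

Section FormalWords.
Implicit Types (w u : seq nat) (x y : fsum).

(* The letter [k] stands for the generator of index [k.+1], so that words are
   arbitrary sequences. *)
Definition ev (B : pzRingType) (h : nat -> B) : fsum -> B :=
  freeg_lift (fun w => \prod_(k <- w) h k.+1).
HB.instance Definition _ (B : pzRingType) (h : nat -> B) :=
  GRing.Additive.on (ev h).

Definition euler_family (B : pzRingType) (h : nat -> B) : Prop :=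
  h 0%N = 1 /\
  forall n, (0 < n)%N -> \sum_(i < n.+1) (-1) ^+ i * h i * h (n - i)%N = 0.

Definition euler_null x : Prop :=
  forall (B : pzRingType) (h : nat -> B), euler_family h -> ev h x = 0.

Definition wcons (k : nat) w : seq nat := if k is j.+1 then j :: w else w.

Definition lmulw (k : nat) : fsum -> fsum :=
  freeg_lift (fun w => << wcons k w >> : fsum).
HB.instance Definition _ (k : nat) := GRing.Additive.on (lmulw k).

(* The derivation that maps each generator to the preceding one. *)
Fixpoint wder w : fsum :=
  if w is k :: u then << wcons k u >> + lmulw k.+1 (wder u) else 0.
Definition der : fsum -> fsum := freeg_lift wder.
HB.instance Definition _ := GRing.Additive.on der.

(* The operation by which prisms differ from pyramids, see [apex_count_prism]. *)
Definition wpeel w : fsum :=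
  match w with
  | [::] => 0
  | 0 :: u => << u >> *+ 2
  | k.+1 :: u => << k :: u >>
  end.
Definition peel : fsum -> fsum := freeg_lift wpeel.
HB.instance Definition _ := GRing.Additive.on peel.

(** The degree of a word: the letter [k] stands for [d_(k+1)], hence the summand [size w]. *)
Definition weight w : nat := (sumn w + size w)%N.

Definition wpart (n : nat) : fsum -> fsum :=
  freeg_lift (fun w => if weight w == n then << w >> else 0 : fsum).
HB.instance Definition _ (n : nat) := GRing.Additive.on (wpart n).

Definition fmul x y : fsum :=
  freeg_lift (fun u => freeg_lift (fun v => << u ++ v >> : fsum) y) x.

Lemma lmulwU k w : lmulw k << w >> = << wcons k w >>.
Proof. exact: freeg_liftU. Qed.
Lemma derU w : der << w >> = wder w.
Proof. exact: freeg_liftU. Qed.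
Lemma peelU w : peel << w >> = wpeel w.
Proof. exact: freeg_liftU. Qed.
Lemma wpartU n w : wpart n << w >> = if weight w == n then << w >> else 0.
Proof. exact: freeg_liftU. Qed.
Lemma evU (B : pzRingType) (h : nat -> B) w :
  ev h << w >> = \prod_(k <- w) h k.+1.
Proof. exact: freeg_liftU. Qed.

Lemma lmulw0 x : lmulw 0 x = x.
Proof. by move: x; apply: (@freeg_ext _ _ (lmulw 0) idfun) => w /=; rewrite lmulwU. Qed.

Lemma ev_lmulw (B : pzRingType) (h : nat -> B) k x : h 0%N = 1 ->
  ev h (lmulw k x) = h k * ev h x.
Proof.
move=> h0; elim/freeg_ind: x => [w|x y ex ey|].
- by rewrite lmulwU !evU; case: k => [|k]; rewrite ?h0 ?mul1r ?big_cons.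
- by rewrite !raddfB /= ex ey mulrBr.
- by rewrite !raddf0 mulr0.
Qed.

Lemma ev_fmul (B : pzRingType) (h : nat -> B) x y :
  ev h (fmul x y) = ev h x * ev h y.
Proof.
rewrite /fmul; elim/freeg_ind: x => [u|x x' ex ex'|].
- rewrite freeg_liftU; elim/freeg_ind: y => [v|y y' ey ey'|].
  + by rewrite freeg_liftU !evU big_cat.
  + by rewrite !raddfB /= ey ey' mulrBr.
  + by rewrite !raddf0 mulr0.
- by rewrite !raddfB /= ex ex' mulrBl.
- by rewrite !raddf0 mul0r.
Qed.

Lemma der_lmulw k x : der (lmulw k.+1 x) = lmulw k x + lmulw k.+1 (der x).
Proof.
elim/freeg_ind: x => [w|x y ex ey|].
- by rewrite !lmulwU !derU.
- by rewrite !raddfB /= ex ey opprD addrACA.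
- by rewrite !raddf0 addr0.
Qed.

Lemma peel_lmulw k x : peel (lmulw k.+2 x) = lmulw k.+1 x.
Proof.
by move: x; apply: (@freeg_ext _ _ (peel \o lmulw k.+2) (lmulw k.+1)) => w /=;
  rewrite !lmulwU !peelU.
Qed.

Lemma wpartB n x y : wpart n (x - y) = wpart n x - wpart n y.
Proof. exact: raddfB. Qed.

Lemma wpart_id n m x : wpart n (wpart m x) = if n == m then wpart m x else 0.
Proof.
elim/freeg_ind: x => [w|x y ex ey|].
- rewrite !wpartU; case: ifP => [/eqP <-|]; last by rewrite raddf0; case: ifP.
  by rewrite wpartU eq_sym; case: eqP.
- by rewrite !raddfB /= ex ey; case: ifP; rewrite ?subr0.
- by rewrite !raddf0; case: ifP.
Qed.

Lemma weight_wcons k w : weight (wcons k w) = (k + weight w)%N.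
Proof. by case: k => [|k] //=; rewrite /weight /= addnS -addnA !addSn. Qed.

Lemma weight_cons k w : weight (k :: w) = (k.+1 + weight w)%N.
Proof. exact: (weight_wcons k.+1). Qed.

Lemma wpart_lmulw n k x : wpart (k + n) (lmulw k x) = lmulw k (wpart n x).
Proof.
elim/freeg_ind: x => [w|x y ex ey|].
- rewrite lmulwU !wpartU weight_wcons eqn_add2l.
  by case: ifP; rewrite ?lmulwU ?raddf0.
- by rewrite !raddfB /= ex ey.
- by rewrite !raddf0.
Qed.

Lemma wpart_lmulw_lt n k x : (n < k)%N -> wpart n (lmulw k x) = 0.
Proof.
move=> nk; elim/freeg_ind: x => [w|x y ex ey|].
- rewrite lmulwU wpartU weight_wcons; case: ifP => // /eqP e.
  by move: nk; rewrite -e ltnNge leq_addr.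
- by rewrite !raddfB /= ex ey subr0.
- by rewrite !raddf0.
Qed.

Lemma wpart_der n x : wpart n (der x) = der (wpart n.+1 x).
Proof.
elim/freeg_ind: x => [w|x y ex ey|]; last first.
- by rewrite !raddf0.
- by rewrite !raddfB /= ex ey.
rewrite derU wpartU.
suff -> : wpart n (wder w) = if weight w == n.+1 then wder w else 0.
  by case: ifP; rewrite ?derU ?raddf0.
elim: w n => [|k u IH] n; first by rewrite /= raddf0.
rewrite /= raddfD /= wpartU weight_wcons weight_cons addSn eqSS.
have [nk|kn] := ltnP n k.
  rewrite wpart_lmulw_lt ?ltnS ?(ltnW nk) // addr0.
  by case: eqP => // e; move: nk; rewrite -e ltnNge leq_addr.
move: kn; rewrite leq_eqVlt => /orP[/eqP <-|kn].
  rewrite wpart_lmulw_lt // -[X in _ == X]addn0 eqn_add2l addr0; case: ifP => //.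
  by case: u {IH} => [|j u] /=; rewrite ?raddf0 ?addr0 // weight_cons.
rewrite -(subnKC kn) wpart_lmulw IH addSnnS eqn_add2l.
by case: ifP => // _; rewrite raddf0 addr0.
Qed.

Lemma wpart_peel n x : wpart n (peel x) = peel (wpart n.+1 x).
Proof.
elim/freeg_ind: x => [w|x y ex ey|].
- rewrite peelU wpartU; case: w => [|[|k] u] /=; rewrite ?raddf0.
  + by rewrite /weight /= ?raddf0.
  + rewrite raddfMn /= wpartU weight_cons add1n eqSS.
    by case: ifP; rewrite ?peelU // raddf0 mul0rn.
  + rewrite wpartU !weight_cons addSn eqSS.
    by case: ifP; rewrite ?peelU // raddf0.
- by rewrite !raddfB /= ex ey.
- by rewrite !raddf0.
Qed.

Lemma wpart0 x : exists c : int, wpart 0 x = << [::] >> *~ c.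
Proof.
elim/freeg_ind: x => [w|x y [c ex] [d ey]|].
- by rewrite wpartU; case: w => [|k u]; [exists 1|exists 0; rewrite weight_cons].
- by exists (c - d); rewrite wpartB ex ey mulrzBr.
- by exists 0; rewrite raddf0.
Qed.

Lemma wpart1 x : exists c : int, wpart 1 x = << [:: 0%N] >> *~ c.
Proof.
elim/freeg_ind: x => [w|x y [c ex] [d ey]|].
- rewrite wpartU; case: w => [|[|k] u]; [by exists 0| |by exists 0; rewrite weight_cons].
  by case: u => [|k u]; [exists 1|exists 0; rewrite !weight_cons].
- by exists (c - d); rewrite wpartB ex ey mulrzBr.
- by exists 0; rewrite raddf0.
Qed.

Lemma der_hom0 x : der (wpart 0 x) = 0.
Proof. by have [c ->] := wpart0 x; rewrite raddfMz /= derU mul0rz. Qed.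

Lemma sum_hom x : exists N, x = \sum_(n < N) wpart n x.
Proof.
(* Allowing every larger bound makes the claim stable under differences, where two bounds have to be
   aligned. *)
suff [N hN] : exists N, forall M, (N <= M)%N -> x = \sum_(n < M) wpart n x.
  by exists N; apply: hN.
elim/freeg_ind: x => [w|x y [N ex] [N' ey]|].
- exists (weight w).+1 => M wM; rewrite (bigD1 (Ordinal wM)) //= wpartU eqxx.
  rewrite big1 ?addr0 // => i /eqP wi; rewrite wpartU; case: eqP => // e.
  by case: wi; apply: val_inj.
- exists (maxn N N') => M; rewrite geq_max => /andP[NM N'M].
  rewrite {1}(ex M NM) {1}(ey M N'M) -sumrB; apply: eq_bigr => n _.
  by rewrite wpartB.
- by exists 0%N => M _; rewrite big1 // => i _; rewrite raddf0.
Qed.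

Definition wrcons w (k : nat) : seq nat := if k is j.+1 then rcons w j else w.

Definition rmulw (k : nat) : fsum -> fsum :=
  freeg_lift (fun w => << wrcons w k >> : fsum).
HB.instance Definition _ (k : nat) := GRing.Additive.on (rmulw k).

Lemma rmulwU k w : rmulw k << w >> = << wrcons w k >>.
Proof. exact: freeg_liftU. Qed.

Lemma ev_rmulw (B : pzRingType) (h : nat -> B) k x : h 0%N = 1 ->
  ev h (rmulw k x) = ev h x * h k.
Proof.
move=> h0; elim/freeg_ind: x => [w|x y ex ey|].
- rewrite rmulwU !evU; case: k => [|k] /=; rewrite ?h0 ?mulr1 //.
  by rewrite -cats1 big_cat big_seq1.
- by rewrite !raddfB /= ex ey mulrBl.
- by rewrite !raddf0 mul0r.
Qed.

Lemma lmulw_rmulw j k x : lmulw j.+1 (rmulw k x) = rmulw k (lmulw j.+1 x).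
Proof.
elim/freeg_ind: x => [w|x y ex ey|].
- by rewrite rmulwU !lmulwU rmulwU; case: k.
- by rewrite !raddfB /= ex ey.
- by rewrite !raddf0.
Qed.

Lemma wder_rcons w k :
  wder (rcons w k) = rmulw k.+1 (wder w) + rmulw k << w >>.
Proof.
elim: w => [|j w IH] /=.
  by rewrite !raddf0 add0r addr0 rmulwU; case: k.
rewrite IH !raddfD /= !lmulw_rmulw addrA; congr (_ + _ + _).
  by rewrite rmulwU; case: j.
by rewrite lmulwU.
Qed.

Lemma weight_rcons w k : weight (rcons w k) = (weight w + k.+1)%N.
Proof. by rewrite /weight sumn_rcons size_rcons addnS addnS addnAC. Qed.

End FormalWords.

(* The derivation [der] is the [e]-part of evaluation at [h k + h (k - 1) e] in the
   dual numbers [a + b e], [e ^+ 2 = 0]; hence it preserves [euler_null]. *)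
Section DualNumbers.
Variable B : pzRingType.

Definition dual : Type := (B * B)%type.
HB.instance Definition _ := GRing.Zmodule.on dual.

Definition dual_one : dual := (1, 0).
Definition dual_mul (x y : dual) : dual := (x.1 * y.1, x.1 * y.2 + x.2 * y.1).

Lemma dual_mulA : associative dual_mul.
Proof.
move=> x y z; congr pair => /=; rewrite ?mulrA //.
by rewrite mulrDr mulrDl !mulrA addrA.
Qed.
Lemma dual_mul1l : left_id dual_one dual_mul.
Proof. by move=> [a b]; congr pair => /=; rewrite !mul1r ?mul0r ?addr0. Qed.
Lemma dual_mul1r : right_id dual_one dual_mul.
Proof. by move=> [a b]; congr pair => /=; rewrite !mulr1 ?mulr0 ?add0r. Qed.
Lemma dual_mulDl : left_distributive dual_mul +%R.
Proof.
by move=> x y z; congr pair => /=; rewrite !mulrDl // addrACA.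
Qed.
Lemma dual_mulDr : right_distributive dual_mul +%R.
Proof.
by move=> x y z; congr pair => /=; rewrite !mulrDr // addrACA.
Qed.

HB.instance Definition _ := GRing.Zmodule_isPzRing.Build dual
  dual_mulA dual_mul1l dual_mul1r dual_mulDl dual_mulDr.

Lemma dual_mulE (x y : dual) : x * y = (x.1 * y.1, x.1 * y.2 + x.2 * y.1).
Proof. by []. Qed.

End DualNumbers.

(** * Closure properties of the Euler relations and elimination of a leading [d_1] *)

Section NullIdeal.
Implicit Types (w u : seq nat) (x y : fsum).

Lemma null0 : euler_null 0.
Proof. by move=> B h _; rewrite raddf0. Qed.
Lemma nullB x y : euler_null x -> euler_null y -> euler_null (x - y).
Proof. by move=> nx ny B h hh; rewrite raddfB /= nx // ny // subr0. Qed.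
Lemma nullN x : euler_null x -> euler_null (- x).
Proof. by rewrite -[- x]sub0r; apply: nullB; exact: null0. Qed.
Lemma nullD x y : euler_null x -> euler_null y -> euler_null (x + y).
Proof. by move=> nx ny; rewrite -[y]opprK; apply: nullB => //; exact: nullN. Qed.
Lemma null_sum (I : finType) (P : pred I) (F : I -> fsum) :
  (forall i, P i -> euler_null (F i)) -> euler_null (\sum_(i | P i) F i).
Proof. by move=> nF; elim/big_ind: _ => //; [exact: null0|exact: nullD]. Qed.
Lemma null_lmulw k x : euler_null x -> euler_null (lmulw k x).
Proof. by move=> nx B h hh; rewrite ev_lmulw ?nx ?mulr0 //; case: hh. Qed.

Definition dual_family (B : pzRingType) (h : nat -> B) (k : nat) : dual B :=
  (h k, if k is j.+1 then h j else 0).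

(** The second components cancel in pairs: after a shift of the index, the terms that lower the left
    factor are the negatives of those that lower the right one. *)
Lemma dual_familyP (B : pzRingType) (h : nat -> B) :
  euler_family h -> euler_family (dual_family h).
Proof.
move=> [h0 hh]; split=> [|n n0]; first by rewrite /dual_family h0.
have sgn i (x : dual B) : (-1) ^+ i * x = ((-1) ^+ i * x.1, (-1) ^+ i * x.2).
  have -> : (-1) ^+ i = ((-1) ^+ i, 0) :> dual B.
    elim: i => // i IH; rewrite !exprS IH dual_mulE /=.
    by rewrite oppr0 mulr0 mul0r addr0.
  by rewrite dual_mulE /= mul0r addr0.
pose f i := (-1) ^+ i * h i * h (n - i)%N.
pose g i := (-1) ^+ i * h i * (dual_family h (n - i)).2.
pose g' i := (-1) ^+ i * (dual_family h i).2 * h (n - i)%N.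
rewrite (eq_bigr (fun i : 'I_n.+1 => (f i, g i + g' i) : dual B)); last first.
  by move=> i _; rewrite sgn dual_mulE.
rewrite [LHS]surjective_pairing.
rewrite (big_morph fst (id1 := 0) (op1 := +%R)) //.
rewrite (big_morph snd (id1 := 0) (op1 := +%R)) //=.
congr pair; first exact: hh.
case: n n0 @f @g @g' => // n _ f g g'.
rewrite big_split /= [X in X + _]big_ord_recr [X in _ + X]big_ord_recl /=.
rewrite /g /g' /= subnn mulr0 addr0 mulr0 mul0r add0r -big_split /=.
have le_in (i : 'I_n.+1) : (i <= n)%N by rewrite -ltnS.
rewrite big1 // => i _; rewrite /bump /= add1n subSS subSn //=.
by rewrite exprS mulN1r !mulNr subrr.
Qed.

Lemma ev_dual (B : pzRingType) (h : nat -> B) x : h 0%N = 1 ->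
  ev (dual_family h) x = (ev h x, ev h (der x)).
Proof.
move=> h0; elim/freeg_ind: x => [w|x y ex ey|].
- rewrite derU !evU; elim: w => [|k w IH].
    by rewrite !big_nil /= raddf0.
  rewrite !big_cons IH dual_mulE /= raddfD /= ev_lmulw // addrC.
  by rewrite -lmulwU ev_lmulw // evU.
- by rewrite !raddfB /= ex ey.
- by rewrite !raddf0.
Qed.

Lemma null_der x : euler_null x -> euler_null (der x).
Proof.
move=> nx B h hh; have [h0 _] := hh.
by have := nx _ _ (dual_familyP hh); rewrite ev_dual // => -[].
Qed.

(* The degree [b.+2] relation expresses [d_1 d_(b+1)] through words that do not
   start with [d_1]. *)
Lemma null_swap b x :
  euler_null (lmulw 1 (lmulw b.+1 x) - lmulw b.+2 x -
        \sum_(a < b.+1) (lmulw a.+2 (lmulw (b - a)%N x)) *~ (-1) ^+ a).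
Proof.
move=> B h [h0 hh]; rewrite !raddfB raddf_sum /= !ev_lmulw //.
rewrite (eq_bigr (fun a : 'I_b.+1 => (-1) ^+ a * h a.+2 * h (b - a)%N * ev h x));
  last first.
  move=> a _; rewrite raddfMz /= !ev_lmulw // -mulrzl rmorphXn /= rmorphN1.
  by rewrite !mulrA.
have := hh b.+2 isT; rewrite big_ord_recl big_ord_recl /= => e.
have {}e := congr1 (fun z => - (z * ev h x)) e.
rewrite mul0r oppr0 in e; rewrite -[RHS]e /= !mulrDl mulr_suml h0.
rewrite /bump /= !subn0 subSS subn0 expr0 !mul1r expr1 mulN1r !mulNr.
rewrite !opprD opprK mulrA addrA [- _ + _]addrC; congr (_ - _).
by apply: eq_bigr => a _; rewrite !add1n !subSS exprS exprS !mulN1r opprK.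
Qed.

(** In degree at least two a leading [d_1] is followed by another letter, so [null_swap] trades it
    for larger letters. The word [d_1] alone cannot be rewritten, whence [0 < n]. *)
Lemma null_reduce n x : (0 < n)%N ->
  exists X : nat -> fsum,
    (forall a, wpart (n - a.+1) (X a) = X a) /\
    euler_null (wpart n.+1 x - \sum_(a < n) lmulw a.+2 (X a)).
Proof.
move=> n0; elim/freeg_ind: x => [w|x y [X [hX nX]] [Y [hY nY]]|].
- have zero : exists X : nat -> fsum,
    (forall a, wpart (n - a.+1) (X a) = X a) /\
    euler_null (0 - \sum_(a < n) lmulw a.+2 (X a)).
    exists (fun=> 0); split=> [a|]; first by rewrite raddf0.
    by rewrite big1 ?subrr; [exact: null0|move=> i _; rewrite raddf0].
  rewrite wpartU; case: eqP => // e.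
  case: w e => [|[|k] u]; first by case.
    case: u => [|b v]; first by case=> e; rewrite -e in n0.
    rewrite !weight_cons => -[e].
    (* These are the coefficients that [null_swap] gives for [d_1 d_(b+1) v]: the first summand
       comes from its alternating sum, the second from the isolated term [d_(b+2) v]. *)
    exists (fun a => (if (a <= b)%N then lmulw (b - a) << v >> *~ (-1) ^+ a else 0) +
       (if a == b then << v >> else 0)); split=> [a|].
      rewrite raddfD /=; congr (_ + _).
        case: leqP => ab; last by rewrite raddf0.
        rewrite raddfMz /=.
        have -> : (n - a.+1 = b - a + weight v)%N.
          by rewrite -e addSn subSS addnBAC.
        by rewrite wpart_lmulw wpartU eqxx.
      case: eqP => [->|]; last by rewrite raddf0.
      by rewrite -e addSn subSS addKn wpartU eqxx.
    have bn : (b.+1 <= n)%N by rewrite -e leq_addr.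
    set s := (X in _ - X).
    have -> : s = lmulw b.+2 << v >> +
        \sum_(a < b.+1) (lmulw a.+2 (lmulw (b - a)%N << v >>)) *~ (-1) ^+ a.
      rewrite /s (eq_bigr (fun a : 'I_n => lmulw a.+2 (if (a <= b)%N then
        lmulw (b - a) << v >> *~ (-1) ^+ a else 0) + lmulw a.+2
        (if nat_of_ord a == b then << v >> else 0))); last first.
        by move=> a _; rewrite raddfD.
      rewrite big_split /= addrC; congr (_ + _).
        rewrite (bigD1 (Ordinal bn)) //= eqxx big1 ?addr0 // => a /eqP ab.
        by case: eqP => [e'|]; rewrite ?raddf0 //; case: ab; apply: val_inj.
      rewrite (big_ord_widen _ (fun a => lmulw a.+2 (lmulw (b - a) << v >>)
        *~ (-1) ^+ a) bn) [RHS]big_mkcond /=; apply: eq_bigr => a _; rewrite ltnS.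
      by case: ifP; rewrite ?raddf0 // raddfMz.
    have := null_swap b << v >>; rewrite !lmulwU /=.
    by rewrite -addrA -opprD.
  rewrite weight_cons addSn => -[e].
  have kn : (k < n)%N by rewrite -e leq_addr.
  exists (fun a => if a == k then << u >> else 0); split=> [a|].
    case: eqP => [->|_]; last by rewrite raddf0.
    by rewrite -e addKn wpartU eqxx.
  rewrite (bigD1 (Ordinal kn)) //= eqxx lmulwU big1 ?addr0 ?subrr; first exact: null0.
  move=> a /eqP ak; case: eqP => [e'|]; rewrite ?raddf0 //.
  by case: ak; apply: val_inj.
- exists (fun a => X a - Y a); split=> [a|]; first by rewrite wpartB hX hY.
  rewrite (eq_bigr (fun a : 'I_n => lmulw a.+2 (X a) - lmulw a.+2 (Y a))).
    by rewrite wpartB sumrB opprD addrACA -opprD; apply: nullB.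
  by move=> a _; rewrite raddfB.
- exists (fun=> 0); split=> [a|]; first by rewrite raddf0.
  by rewrite raddf0 big1 ?subrr; [exact: null0|move=> i _; rewrite raddf0].
Qed.

End NullIdeal.

(* [N n] plays the role of the formal sums of degree [n.+1] that are annihilated
   by the flag numbers of all polytopes of dimension [n]. *)
Section Independence.
Variable N : nat -> fsum -> Prop.
Hypothesis NB : forall n x y, N n x -> N n y -> N n (x - y).
Hypothesis N_null : forall n x, wpart n.+1 x = x -> euler_null x -> N n x.
Hypothesis N_der : forall n x, wpart n.+2 x = x -> N n.+1 x -> N n (der x).
Hypothesis N_peel : forall n x, wpart n.+2 x = x -> N n.+1 x -> N n (peel x).
Hypothesis N0 : forall x, wpart 1 x = x -> N 0 x -> euler_null x.

Let lift_sum n (X : nat -> fsum) := \sum_(a < n) lmulw a.+2 (X a).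

Let wpart_lift_sum n X : (forall a, wpart (n - a.+1) (X a) = X a) ->
  wpart n.+1 (lift_sum n X) = lift_sum n X.
Proof.
move=> hX; rewrite /lift_sum raddf_sum /=; apply: eq_bigr => a _.
have -> : n.+1 = (a.+2 + (n - a.+1))%N by rewrite addSn subnKC.
by rewrite wpart_lmulw hX.
Qed.

(** The two premises are the induction hypothesis. The second is about each coefficient separately,
    which is stronger than nullity of the sum; it is what turns a relation between derivatives into
    [der (X a)] being null for every [a]. *)
Let N_trans n X : (forall x, wpart n.+1 x = x -> N n x -> euler_null x) ->
  (forall X : nat -> fsum, (forall a, wpart (n - a.+1) (X a) = X a) ->
     N n (lift_sum n X) -> forall a, (a < n)%N -> euler_null (X a)) ->
  (forall a, wpart (n.+1 - a.+1) (X a) = X a) ->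
  N n.+1 (lift_sum n.+1 X) -> forall a, (a < n.+1)%N -> euler_null (X a).
Proof.
move=> null_n lift_n hX NX; set S := lift_sum n.+1 X in NX.
have hS : wpart n.+2 S = S by exact: wpart_lift_sum.
have RS : peel S = \sum_(a < n.+1) lmulw a.+1 (X a).
  by rewrite /S /lift_sum raddf_sum; apply: eq_bigr => a _; rewrite /= peel_lmulw.
have DS : der S = peel S + lift_sum n.+1 (fun a => der (X a)).
  rewrite RS /S /lift_sum raddf_sum -big_split; apply: eq_bigr => a _ /=.
  by rewrite der_lmulw.
(* The difference [der S - peel S] is again a [lift_sum], with coefficients [der (X a)]. The
   coefficient with [a = n] has degree 0, so its derivative vanishes and the sum fits the induction
   hypothesis. *)
have dX a : euler_null (der (X a)).
  have [an|na] := ltnP a n; last first.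
    rewrite -hX (_ : n.+1 - a.+1 = 0)%N ?der_hom0; first exact: null0.
    by apply/eqP; rewrite subn_eq0 ltnS.
  move: a an; apply: lift_n => [a|].
    have [an|na] := ltnP a n.
      by rewrite wpart_der -subSn // hX.
    rewrite -[X a]hX (_ : n.+1 - a.+1 = 0)%N ?der_hom0 ?raddf0 //.
    by apply/eqP; rewrite subn_eq0 ltnS.
  have -> : lift_sum n (fun a => der (X a)) = der S - peel S.
    rewrite DS addrC addKr /lift_sum big_ord_recr /=.
    by rewrite -(hX n) subnn der_hom0 raddf0 addr0.
  by apply: NB; [exact: N_der|exact: N_peel].
have nRS : euler_null (peel S) by apply: null_n; [rewrite wpart_peel hS|exact: N_peel].
(* Up to terms that contain some [der (X a)], this is [der] applied [j + 1] times to [peel S], each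
   time lowering the first letter. The summand [a = j] is [X j] itself, as [lmulw 0] is the
   identity; one more derivation makes it null. *)
pose T j := \sum_(a < n.+1 | (j <= a)%N) lmulw (a - j) (X a).
have nT j : euler_null (T j).
  elim: j => [|j IH].
    have -> : T 0%N = der (peel S) -
        \sum_(a < n.+1) lmulw a.+1 (der (X a)).
      rewrite RS raddf_sum -sumrB; apply: eq_bigr => a _ /=.
      by rewrite der_lmulw subn0 addrK.
    apply: nullB; first exact: null_der.
    by apply: null_sum => a _; exact: null_lmulw.
  have -> : T j.+1 = der (T j) -
      \sum_(a < n.+1 | (j <= a)%N) lmulw (a - j) (der (X a)).
    rewrite /T raddf_sum -sumrB big_mkcond [RHS]big_mkcond /=.
    apply: eq_bigr => a _; case: (ltngtP j a) => // [ja|<-].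
      by rewrite -(subnSK ja) der_lmulw addrK.
    by rewrite subnn !lmulw0 subrr.
  apply: nullB; first exact: null_der.
  by apply: null_sum => a _; exact: null_lmulw.
(* Downward induction on [a]: apart from [X a], the sum [T a] involves larger indices only. *)
suff top m a : (a < n.+1)%N -> (n - a < m)%N -> euler_null (X a).
  by move=> a an; apply: (top (n - a).+1).
elim: m a => // m IH a an; rewrite ltnS => nam.
have := nT a; rewrite /T (bigD1 (Ordinal an)) //= subnn lmulw0.
set r := \sum_(i < _ | _) _; have nr : euler_null r.
  apply: null_sum => i /andP[ai /eqP ia]; apply/null_lmulw/IH => //.
  have {ia} ai' : (a < i)%N.
    by rewrite ltn_neqAle ai andbT; apply/eqP => e; apply: ia; apply: val_inj.
  by apply: leq_trans nam; rewrite ltn_sub2l // (leq_trans ai') // -ltnS.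
by move=> nr'; rewrite -(addrK r (X a)); apply: nullB.
Qed.

(** Both claims advance together: [N_trans] uses both to prove the second in the next degree, and
    [null_reduce] then deduces the first, an arbitrary sum differing from a [lift_sum] by a null
    one. *)
Let N_lift n : (forall x, wpart n.+1 x = x -> N n x -> euler_null x) /\
  (forall X : nat -> fsum, (forall a, wpart (n - a.+1) (X a) = X a) ->
     N n (lift_sum n X) -> forall a, (a < n)%N -> euler_null (X a)).
Proof.
elim: n => [|n [IH1 IH2]]; first by split.
have L X := @N_trans n X IH1 IH2; split=> // x hx Nx.
have [X [hX nX]] := null_reduce x (ltn0Sn n).
rewrite hx -/(lift_sum _ _) in nX.
have hS := wpart_lift_sum hX.
have nS : N n.+1 (lift_sum n.+1 X).
  rewrite -(subKr x (lift_sum _ _)); apply: NB => //; apply: N_null => //.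
  by rewrite wpartB hx hS.
rewrite -(subrK (lift_sum n.+1 X) x); apply: nullD => //.
by apply: null_sum => a _; apply/null_lmulw/L.
Qed.

Lemma annihilator_null n x : wpart n.+1 x = x -> N n x -> euler_null x.
Proof. by have [h _] := N_lift n; exact: h. Qed.

End Independence.

(** * Faces and affine dimension *)

Section Faces.
Variables (R : realType) (n : nat).
Implicit Types (P F G : set 'rV[R]_n) (s : seq 'rV[R]_n) (c : 'cV[R]_n).
Implicit Types (u v w x y : 'rV[R]_n).

Local Notation "x '`' c" := ((x *m c) 0 0) (at level 36).

Lemma pairD c c' (x : 'rV[R]_n) : x ` (c + c') = x ` c + x ` c'.
Proof. by rewrite mulmxDr mxE. Qed.
Lemma pairZ (t : R) c (x : 'rV[R]_n) : x ` (t *: c) = t * x ` c.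
Proof. by rewrite -scalemxAr mxE. Qed.
Lemma pairN c (x : 'rV[R]_n) : x ` (- c) = - (x ` c).
Proof. by rewrite mulmxN mxE. Qed.
Lemma pairDl c (x y : 'rV[R]_n) : (x + y) ` c = x ` c + y ` c.
Proof. by rewrite mulmxDl mxE. Qed.
Lemma pairZl (t : R) c (x : 'rV[R]_n) : (t *: x) ` c = t * x ` c.
Proof. by rewrite -scalemxAl mxE. Qed.
Lemma pairBl c (x y : 'rV[R]_n) : (x - y) ` c = x ` c - y ` c.
Proof. by rewrite mulmxBl mxE [X in _ + X]mxE. Qed.

Lemma face_refl P : is_face P P.
Proof.
exists 0, 0; split=> [x _|]; first by rewrite mulmx0 mxE.
by apply/seteqP; split=> [x Px|x []//]; split=> //=; rewrite mulmx0 mxE.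
Qed.

Lemma face_set0 P : is_face P set0.
Proof.
exists 0, 1; split=> [x _|]; first by rewrite mulmx0 mxE.
apply/seteqP; split=> // x [_ /=]; rewrite mulmx0 mxE => /esym/eqP.
by rewrite oner_eq0.
Qed.

Lemma face_sub P F : is_face P F -> F `<=` P.
Proof. by move=> [c [b [_ ->]]] x []. Qed.

Lemma face_inherit P F G :
  is_face P G -> G `<=` F -> F `<=` P -> is_face F G.
Proof.
move=> [c [b [hb eG]]] GF FP; exists c, b; split=> [x /FP /hb //|].
apply/seteqP; split=> x.
  by move=> Gx; split; [exact: GF|move: Gx; rewrite eG => -[]].
by move=> [/FP Px xb]; rewrite eG.
Qed.

Lemma conv_hull_mem s v : v \in s -> conv_hull [set` s] v.
Proof. by move=> vs; exact: (@sub_gen_smallest _ _ [set` s]). Qed.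

Lemma conv_hull_min s P : convex_set (P : set 'rV[R]_n) ->
  (forall v, v \in s -> P v) -> conv_hull [set` s] `<=` P.
Proof. by move=> cP sP; apply: smallest_sub. Qed.

Lemma conv_hullS s s' : {subset s <= s'} ->
  conv_hull [set` s] `<=` conv_hull [set` s'].
Proof.
move=> ss'; apply: conv_hull_min; first exact: conv_hull_convex.
by move=> v /ss'; exact: conv_hull_mem.
Qed.

Lemma conv_hull_ind s (p : 'rV[R]_n -> Prop) :
  (forall (l : R) x y, 0 <= l -> l <= 1 -> p x -> p y ->
     p (l *: x + (1 - l) *: y)) ->
  (forall v, v \in s -> p v) -> forall x, conv_hull [set` s] x -> p x.
Proof.
move=> pc ps; apply: (@conv_hull_min s [set x | p x]) => // x y l.
by rewrite !inE /= => px py; apply: pc.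
Qed.

Lemma conv_hull_conv s (l : R) x y : 0 <= l -> l <= 1 ->
  conv_hull [set` s] x -> conv_hull [set` s] y ->
  conv_hull [set` s] (l *: x + (1 - l) *: y).
Proof.
move=> l0 l1 sx sy.
by have := @conv_hull_convex _ _ [set` s] x y (Itv01 l0 l1); rewrite !inE; exact.
Qed.

Lemma conv_hull_le s c b : (forall v, v \in s -> v ` c <= b) ->
  forall x, conv_hull [set` s] x -> x ` c <= b.
Proof.
move=> sb; apply: conv_hull_ind => // l x y l0 l1 xb yb.
rewrite pairDl !pairZl [leRHS](_ : b = l * b + (1 - l) * b); last by lra.
by apply: lerD; apply: ler_wpM2l; rewrite ?subr_ge0 ?xb ?yb.
Qed.

Lemma conv_hull_eq s c b : (forall v, v \in s -> v ` c = b) ->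
  forall x, conv_hull [set` s] x -> x ` c = b.
Proof.
move=> sb x sx; apply/le_anti/andP; split.
  by apply: conv_hull_le sx => v /sb ->.
rewrite -lerN2 -pairN; apply: conv_hull_le sx => v /sb <-.
by rewrite pairN.
Qed.

Lemma conv_hull_neq0 s : conv_hull [set` s] !=set0 -> exists v, v \in s.
Proof.
move=> [x sx]; apply: contrapT => hs.
have /(_ x sx) // : conv_hull [set` s] `<=` set0.
by apply: conv_hull_min => [y z l|v vs]; [rewrite inE|apply: hs; exists v].
Qed.

Lemma gens_face s c b : (forall v, v \in s -> v ` c <= b) ->
  conv_hull [set` s] `&` [set x | x ` c = b] =
  conv_hull [set` [seq v <- s | v ` c == b]].
Proof.
move=> sb; set F := LHS.
have fF : is_face (conv_hull [set` s]) F.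
  by exists c, b; split=> //; exact: conv_hull_le.
have [m Fm] := face_conv_hull fF.
apply/seteqP; split=> x.
  rewrite Fm; apply: conv_hullS => v vm.
  have : F v by rewrite Fm; exact: conv_hull_mem.
  by rewrite mem_filter (mem_mask vm) andbT => -[_ /eqP].
move=> sx; split.
  by apply: conv_hullS sx => v; rewrite mem_filter => /andP[].
by apply: conv_hull_eq sx => v; rewrite mem_filter => /andP[/eqP].
Qed.

(** Lets a strict inequality for [f] absorb an arbitrary perturbation [g], uniformly on a finite
    set. *)
Lemma large_multiple (T : eqType) (s : seq T) (f g : T -> R) :
  exists2 M, 0 <= M & forall a, a \in s -> f a < 0 -> M * f a + g a < 0.
Proof.
elim: s => [|v s [M M0 IH]]; first by exists 0.
(* The quotient is what [v] requires. If [f v = 0], it is 0 by the convention on division, and [v]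
   imposes no condition. *)
exists (M + `|g v| / `|f v| + 1) => [|u].
  by rewrite !addr_ge0 // divr_ge0.
rewrite inE => /orP[/eqP-> fv|us fu]; last first.
  apply: le_lt_trans (IH u us fu); rewrite lerD2r ler_nM2r // -addrA lerDl.
  by rewrite addr_ge0 // divr_ge0.
rewrite !mulrDl mul1r (ltr0_norm fv) invrN mulrN mulNr divfK ?lt_eqF //.
have := ler_norm (g v); have : M * f v <= 0 by rewrite mulr_ge0_le0 // ltW.
lra.
Qed.

(** Lexicographic optimisation: maximise [c] first, then [c'] among its maximisers. On finitely many
    generators [M *: c + c'] with [M] large does both at once. *)
Lemma face_trans P F G :
  is_polytope P -> is_face P F -> is_face F G -> is_face P G.
Proof.
move=> [_ [s ->]] [c [b [hb eF]]] [c' [b' [hb' eG]]].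
have sb v : v \in s -> v ` c <= b by move=> vs; apply: hb; exact: conv_hull_mem.
have [M M0 hM] := large_multiple s (fun v => v ` c - b) (fun v => v ` c' - b').
have fE v : v ` (M *: c + c') - (M * b + b') = M * (v ` c - b) + (v ` c' - b').
  by rewrite pairD pairZ; lra.
have Fs v (vs : v \in s) (vb : v ` c = b) : F v.
  by rewrite eF; split=> //; exact: conv_hull_mem.
have sM v : v \in s -> v ` (M *: c + c') <= M * b + b'.
  move=> vs; rewrite -subr_le0 fE.
  have := sb v vs; rewrite le_eqVlt => /orP[/eqP vb|vb].
    by rewrite vb subrr mulr0 add0r subr_le0; apply: hb'; exact: Fs.
  by apply/ltW/hM => //; rewrite subr_lt0.
exists (M *: c + c'), (M * b + b'); split; first exact: conv_hull_le.
apply/seteqP; split=> x.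
  rewrite eG eF => -[[sx /= xb]] xb'; split=> //=.
  by rewrite pairD pairZ xb xb'.
rewrite gens_face // => hx.
have hs v : v \in [seq v <- s | v ` (M *: c + c') == M * b + b'] ->
    [/\ v \in s, v ` c = b & v ` c' = b'].
  rewrite mem_filter -subr_eq0 fE => /andP[/eqP e vs].
  have := sb v vs; rewrite le_eqVlt => /orP[/eqP vb|vb].
    split=> //; apply/eqP; rewrite -subr_eq0 -e vb; apply/eqP; lra.
  by have := hM v vs; rewrite subr_lt0 => /(_ vb); rewrite e ltxx.
rewrite eG eF; split; last by apply: conv_hull_eq hx => v /hs[].
split; last by apply: conv_hull_eq hx => v /hs[].
by apply: conv_hullS hx => v /hs[].
Qed.

Lemma frame_spans P x (A : 'M[R]_(affine_dim P, n)) :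
  affine_frame P x A -> forall y, P y -> (y - x <= A)%MS.
Proof.
move=> [Px PA fA] y Py; apply: contraT => vA.
suff /affine_frame_le : affine_frame P x (col_mx A (y - x)) by rewrite addn1 ltnn.
split=> // [i|].
  case: (split_ordP i) => j ->; first by rewrite rowKu.
  by rewrite rowKd row_id addrC subrK.
have : (\rank A < \rank (col_mx A (y - x)))%N.
  rewrite -addsmxE; apply: rank_ltmx; rewrite ltmxE addsmxSl /=.
  by apply: contra vA; apply: submx_trans; exact: addsmxSr.
rewrite (eqP fA) /row_free eqn_leq rank_leq_row /= => h.
by apply: leq_trans h; rewrite addn1.
Qed.

Lemma affine_dim_ub P x0 k (M : 'M[R]_(k, n)) :
  P x0 -> (forall y, P y -> (y - x0 <= M)%MS) -> (affine_dim P <= \rank M)%N.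
Proof.
move=> Px0 PM; have P0 : P !=set0 by exists x0.
have [x [A [Px PA fA]]] := affine_frame_ex P0.
rewrite -[leqLHS](eqP fA); apply/mxrankS/row_subP => i.
have -> : row i A = (x + row i A - x0) - (x - x0).
  by rewrite opprB addrA subrK addrC addKr.
by apply: addmx_sub; [exact: PM|rewrite eqmx_opp; exact: PM].
Qed.

Lemma affine_dimE P x0 k (M : 'M[R]_(k, n)) : P x0 ->
  (forall y, P y -> (y - x0 <= M)%MS) ->
  (forall m (N : 'M[R]_(m, n)), (forall y, P y -> (y - x0 <= N)%MS) ->
     (M <= N)%MS) ->
  affine_dim P = \rank M.
Proof.
move=> Px0 PM Mmin; have P0 : P !=set0 by exists x0.
have [x [A fr]] := affine_frame_ex P0; have [Px PA fA] := fr.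
apply/eqP; rewrite eqn_leq; apply/andP; split; last first.
  rewrite -[leqRHS](eqP fA); apply/mxrankS/Mmin => y Py.
  rewrite -[y](subrK x) -addrA; apply: addmx_sub; first exact: (frame_spans fr).
  by rewrite -opprB eqmx_opp; exact: (frame_spans fr).
exact: affine_dim_ub Px0 PM.
Qed.

Lemma affine_dim_le F P : F !=set0 -> F `<=` P -> (affine_dim F <= affine_dim P)%N.
Proof.
move=> /affine_frame_ex[x [A [Fx FA fA]]] FP.
by apply: (@affine_frame_le _ _ _ _ x A); split=> // [|i]; exact: FP.
Qed.

Lemma face_dim_lt P F : is_face P F -> F !=set0 -> F <> P ->
  (affine_dim F < affine_dim P)%N.
Proof.
move=> PF F0 nFP; rewrite ltn_neqAle affine_dim_le ?andbT //.
  by apply/eqP => e; apply: nFP; exact: face_full_dim PF F0 e.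
exact: face_sub.
Qed.

Definition rowspan s : 'M[R]_n := foldr (fun v M => (v + M)%MS) 0 s.

Lemma rowspan_mem s v : v \in s -> (v <= rowspan s)%MS.
Proof.
elim: s => //= u s IH; rewrite inE => /orP[/eqP->|/IH h]; first exact: addsmxSl.
exact: submx_trans h (addsmxSr _ _).
Qed.

Lemma rowspan_sub s m (N : 'M[R]_(m, n)) :
  (forall v, v \in s -> (v <= N)%MS) -> (rowspan s <= N)%MS.
Proof.
elim: s => [|v s IH] h /=; first exact: sub0mx.
rewrite addsmx_sub h ?mem_head //=; apply: IH => u us.
by apply: h; rewrite inE us orbT.
Qed.

Lemma affine_dim_conv s v0 : v0 \in s ->
  affine_dim (conv_hull [set` s]) = \rank (rowspan [seq v - v0 | v <- s]).
Proof.
move=> v0s; apply: (@affine_dimE _ v0); first exact: conv_hull_mem.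
  apply: conv_hull_ind => [l x y l0 l1 hx hy|v vs].
    have -> : l *: x + (1 - l) *: y - v0 = l *: (x - v0) + (1 - l) *: (y - v0).
      by rewrite !scalerBr addrACA -opprD -scalerDl [l + _]addrC subrK scale1r.
    by apply: addmx_sub; exact: scalemx_sub.
  by apply: rowspan_mem; apply/mapP; exists v.
move=> m N hN; apply: rowspan_sub => w /mapP[v vs ->].
by apply: hN; exact: conv_hull_mem.
Qed.

(** A ratio test: [t] is the least of the quotients [- f a / g a] with [0 < g a], the first moment
    at which moving from [f] in the direction [g] makes such a constraint tight. *)
Lemma tilt (T : eqType) (s : seq T) (f g : T -> R) :
  (forall a, a \in s -> f a <= 0) -> (exists2 a, a \in s & 0 < g a) ->
  exists2 t, 0 <= t & (forall a, a \in s -> f a + t * g a <= 0) /\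
    exists a, [/\ a \in s, 0 < g a & f a + t * g a = 0].
Proof.
elim: s => [_ [] //|v s IH] fs hg.
have fv : f v <= 0 by apply: fs; rewrite mem_head.
have fs' (u : T) : u \in s -> f u <= 0 by move=> us; apply: fs; rewrite inE us orbT.
have [hg'|hg'] := pselect (exists2 a, a \in s & 0 < g a); last first.
  have gv : 0 < g v.
    case: hg => u; rewrite inE => /orP[/eqP->//|us gu]; case: hg'; by exists u.
  exists (- f v / g v); first by rewrite divr_ge0 ?oppr_ge0 // ltW.
  split; last by exists v; rewrite mem_head divfK ?gt_eqF // subrr.
  move=> u; rewrite inE => /orP[/eqP->|us].
    by rewrite divfK ?gt_eqF // subrr.
  have gu : g u <= 0 by rewrite leNgt; apply/negP => h; apply: hg'; exists u.
  have : - f v / g v * g u <= 0.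
    by rewrite mulr_ge0_le0 // divr_ge0 ?oppr_ge0 // ltW.
  by have := fs' u us; lra.
have [t t0 [st [u [us gu eu]]]] := IH fs' hg'.
have [hv|hv] := leP (f v + t * g v) 0.
  exists t => //; split; last by exists u; rewrite inE us orbT.
  by move=> w; rewrite inE => /orP[/eqP->//|]; exact: st.
have gv : 0 < g v.
  rewrite ltNge; apply/negP => h; have : t * g v <= 0 by rewrite mulr_ge0_le0.
  by lra.
exists (- f v / g v); first by rewrite divr_ge0 ?oppr_ge0 // ltW.
have tt : - f v / g v <= t by rewrite ler_pdivrMr //; lra.
have t'0 : 0 <= - f v / g v by rewrite divr_ge0 ?oppr_ge0 // ltW.
split; last by exists v; rewrite mem_head divfK ?gt_eqF // subrr.
move=> w; rewrite inE => /orP[/eqP->|ws]; first by rewrite divfK ?gt_eqF // subrr.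
have [gw|gw] := leP (g w) 0.
  by have := fs' w ws; have := mulr_ge0_le0 t'0 gw; lra.
by apply: le_trans (st w ws); rewrite lerD2l ler_pM2r.
Qed.

Lemma max_attained (T : eqType) (s : seq T) (g : T -> R) a0 : a0 \in s ->
  exists2 a, a \in s & forall a', a' \in s -> g a' <= g a.
Proof.
elim: s a0 => // a s IH a0 _; case: s IH => [|a1 s] IH.
  by exists a; rewrite ?mem_head // => a'; rewrite inE => /eqP->.
have [b bs hb] := IH a1 (mem_head _ _).
have [ab|ba] := leP (g a) (g b).
  exists b; first by rewrite inE bs orbT.
  by move=> a'; rewrite inE => /orP[/eqP->//|]; exact: hb.
exists a; first exact: mem_head.
move=> a'; rewrite inE => /orP[/eqP->//|/hb h].
exact: le_trans h (ltW ba).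
Qed.

Lemma not_sub_functional m (N : 'M[R]_(m, n)) (w : 'rV[R]_n) : ~~ (w <= N)%MS ->
  exists2 c : 'cV[R]_n, N *m c = 0 & w ` c != 0.
Proof.
rewrite submxE => /eqP h.
have [j hj] : exists j, (w *m cokermx N) 0 j != 0.
  apply: contrapT => hn; apply: h; apply/matrixP => i j; rewrite ord1 [RHS]mxE.
  by apply/eqP; apply: contraT => hj; case: hn; exists j.
exists (cokermx N *m delta_mx j 0); first by rewrite mulmxA mulmx_coker mul0mx.
by rewrite mulmxA -colE mxE.
Qed.

(** The supporting hyperplane is rotated about [F] until it meets a new generator. Codimension at
    least two leaves room for a rotation that also fixes the value at a generator [u] off [F]; the
    inequality at [u] stays strict, which keeps the new face proper. *)
Lemma face_enlarge P F : is_polytope P -> is_face P F -> F !=set0 -> F <> P ->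
  ((affine_dim F).+1 < affine_dim P)%N ->
  exists F', [/\ is_face P F', F' !=set0, F' <> P &
    (affine_dim F < affine_dim F')%N].
Proof.
move=> pP fF F0 nFP dF; have [c [b [hb eF]]] := fF; have [_ [s eP]] := pP.
have sb v : v \in s -> v ` c <= b.
  by move=> vs; apply: hb; rewrite eP; exact: conv_hull_mem.
set s' := [seq v <- s | v ` c == b].
have eFs : F = conv_hull [set` s'] by rewrite eF eP gens_face.
have [v0 v0s'] : exists v, v \in s' by apply: conv_hull_neq0; rewrite -eFs.
have := v0s'; rewrite mem_filter => /andP[/eqP v0b v0s].
have [u us ub] : exists2 u, u \in s & u ` c < b.
  apply: contrapT => hn; apply: nFP; rewrite eFs eP; congr conv_hull.
  apply/seteqP; split=> v /=; rewrite mem_filter; first by case/andP.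
  move=> vs.
  rewrite vs andbT eq_le sb //= leNgt; apply/negP => vb; apply: hn; by exists v.
set MF := rowspan [seq v - v0 | v <- s'].
set MP := rowspan [seq v - v0 | v <- s].
have dimF : affine_dim F = \rank MF by rewrite eFs (affine_dim_conv v0s').
have dimP : affine_dim P = \rank MP by rewrite eP (affine_dim_conv v0s).
(* One extra vector raises the rank by at most one, so the directions of [F] together with [u - v0]
   do not span those of [P]. *)
have [v vs hv] : exists2 v, v \in s & ~~ (v - v0 <= MF + (u - v0))%MS.
  apply: contrapT => hn.
  have : (MP <= MF + (u - v0))%MS.
    apply: rowspan_sub => w /mapP[v vs ->]; apply: contraT => hv.
    by case: hn; exists v.
  move/mxrankS; rewrite -dimP leqNgt => /negP; apply.
  apply: leq_ltn_trans (mxrank_adds_leqif _ _) _.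
  apply: leq_ltn_trans dF; rewrite dimF -[(\rank MF).+1]addn1 leq_add2l.
  exact: rank_leq_row.
have [c1 hc1 hvc1] := not_sub_functional hv.
have [c2 hc2 hvc2] :
    exists2 c2 : 'cV[R]_n, (MF + (u - v0))%MS *m c2 = 0 & 0 < (v - v0) ` c2.
  move: hvc1; rewrite neq_lt => /orP[h|h]; last by exists c1.
  by exists (- c1); rewrite ?mulmxN ?hc1 ?oppr0 // mxE oppr_gt0.
have kill w : (w <= MF + (u - v0))%MS -> w ` c2 = 0.
  by move=> /submxP[D ->]; rewrite -mulmxA hc2 mulmx0 mxE.
have [t t0 [st [v' [v's v'g v'0]]]] := @tilt _ s (fun v => v ` c - b)
  (fun v => (v - v0) ` c2) (fun v vs => ltac:(by rewrite subr_le0; exact: sb))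
  (ex_intro2 _ _ v vs hvc2).
pose c' := c + t *: c2; pose b' := b + t * v0 ` c2.
have fE w : w ` c' - b' = w ` c - b + t * (w - v0) ` c2.
  by rewrite /c' /b' pairD pairZ pairBl; lra.
have sb' w : w \in s -> w ` c' <= b' by move=> ws; rewrite -subr_le0 fE; exact: st.
exists (P `&` [set x | x ` c' = b']).
have fF' : is_face P (P `&` [set x | x ` c' = b']).
  by exists c', b'; split=> // x; rewrite eP; exact: conv_hull_le.
have FF' : F `<=` P `&` [set x | x ` c' = b'].
  move=> x Fx; split; first exact: (face_sub fF).
  move: Fx; rewrite eFs; apply: conv_hull_eq => w ws'.
  apply/eqP; rewrite -subr_eq0 fE kill ?mulr0 ?addr0 ?subr_eq0.
    by move: ws'; rewrite mem_filter => /andP[].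
  apply: submx_trans (addsmxSl _ _); apply: rowspan_mem.
  by apply/mapP; exists w.
split=> //.
- by case: F0 => x Fx; exists x; exact: FF'.
- move=> e; have : (P `&` [set x | x ` c' = b']) u.
    by rewrite e eP; exact: conv_hull_mem.
  case=> _ /= /eqP; rewrite -subr_eq0 fE kill ?addsmxSr // mulr0 addr0 subr_eq0.
  by rewrite lt_eqF.
- apply: face_dim_lt => //; first exact: face_inherit fF FF' (@subIsetl _ _ _).
  move=> e; have : F v'.
    rewrite e; split=> /=; first by rewrite eP; exact: conv_hull_mem.
    by apply/eqP; rewrite -subr_eq0 fE v'0.
  rewrite eF => -[_ /= v'b]; move: v'g; rewrite kill ?ltxx //.
  apply: submx_trans (addsmxSl _ _); apply: rowspan_mem.
  by apply/mapP; exists v' => //; rewrite mem_filter v'b eqxx.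
Qed.

Lemma proper_face P : is_polytope P -> (0 < affine_dim P)%N ->
  exists F, [/\ is_face P F, F !=set0 & F <> P].
Proof.
move=> [P0 [s eP]] dP.
have [v0 v0s] : exists v, v \in s by apply: conv_hull_neq0; rewrite -eP.
have [v vs vv0] : exists2 v, v \in s & v != v0.
  apply: contrapT => hn; move: dP; rewrite eP (affine_dim_conv v0s).
  rewrite (_ : rowspan _ = 0) ?mxrank0 //.
  apply/eqP; rewrite -submx0; apply: rowspan_sub => w /mapP[v vs ->].
  rewrite submx0 subr_eq0; apply: contraT => h; case: hn; by exists v.
have [c _ hc] : exists2 c : 'cV[R]_n, (0 : 'M[R]_n) *m c = 0 & (v - v0) ` c != 0.
  by apply: not_sub_functional; rewrite submx0 subr_eq0.
have [u us hu] := max_attained (fun v => v ` c) v0s.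
exists (P `&` [set x | x ` c = u ` c]); split.
- by exists c, (u ` c); split=> // x; rewrite eP; exact: conv_hull_le.
- by exists u; split=> //; rewrite eP; exact: conv_hull_mem.
move=> e; have eqc w : w \in s -> w ` c = u ` c.
  move=> ws; have Pw : P w by rewrite eP; exact: conv_hull_mem.
  by have [] : (P `&` [set x | x ` c = u ` c]) w by rewrite e.
by move: hc; rewrite pairBl !eqc // subrr eqxx.
Qed.

Lemma facet_exists P d : is_polytope P -> affine_dim P = d.+1 ->
  exists F, [/\ is_face P F, F !=set0 & affine_dim F = d].
Proof.
move=> pP dP.
(* After [m] enlargements of a proper face the dimension is at least [m], unless it has already
   reached [d], where [face_enlarge] stops. *)
have step m : exists F, [/\ is_face P F, F !=set0, F <> P &
    (minn m d <= affine_dim F)%N].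
  elim: m => [|m [F [fF F0 nFP mF]]].
    by have [|F [fF F0 nFP]] := proper_face pP; [rewrite dP|exists F; rewrite min0n].
  have [dF|] := ltnP (affine_dim F).+1 (affine_dim P).
    have [F' [fF' F'0 nF'P lt]] := face_enlarge pP fF F0 nFP dF.
    by exists F'; split=> //; lia.
  rewrite dP ltnS => dF; exists F; split=> //.
  by apply: leq_trans (geq_minr _ _) dF.
have [F [fF F0 nFP dF]] := step d; exists F; split=> //.
apply/eqP; rewrite eqn_leq; apply/andP; split; last by rewrite minnn in dF.
by rewrite -ltnS -dP; exact: face_dim_lt.
Qed.

End Faces.

(** * Euler's relation for systems of linear inequalities *)

Section Strata.
Variables (R : realType) (n : nat).
Implicit Types (s Z A W : seq 'rV[R]_n) (c : 'cV[R]_n) (u v w x y : 'rV[R]_n).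
Local Notation "x '`' c" := ((x *m c) 0 0) (at level 36).

Definition feasible Z A : Prop :=
  exists c, (forall z, z \in Z -> z ` c = 0) /\ (forall a, a \in A -> a ` c < 0).

(* The Euler characteristic, up to a global sign, of the relatively open cone
   [c = 0] on [Z], [c < 0] on [A]; [strata_sum] adds those of the strata of the
   cone on which moreover [c <= 0] on [W]. *)
Definition stratum_sign Z A : int :=
  if `[< feasible Z A >] then (-1) ^+ \rank (rowspan Z) else 0.

Fixpoint strata_sum Z A W : int :=
  if W is w :: W' then strata_sum (w :: Z) A W' + strata_sum Z (w :: A) W'
  else stratum_sign Z A.

Lemma rowspan_le Z Z' : {subset Z <= Z'} -> (rowspan Z <= rowspan Z')%MS.
Proof. by move=> ZZ'; apply: rowspan_sub => v /ZZ'; exact: rowspan_mem. Qed.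

Lemma stratum_sign_ext Z Z' A A' : Z =i Z' -> A =i A' ->
  stratum_sign Z A = stratum_sign Z' A'.
Proof.
move=> eZ eA; rewrite /stratum_sign.
have -> : feasible Z A = feasible Z' A'.
  apply/propext; split=> -[c [cZ cA]]; exists c; split=> v.
  - by rewrite -eZ; exact: cZ.
  - by rewrite -eA; exact: cA.
  - by rewrite eZ; exact: cZ.
  - by rewrite eA; exact: cA.
have -> : \rank (rowspan Z) = \rank (rowspan Z').
  by apply/eqP; rewrite eqn_leq !mxrankS // rowspan_le // => v; rewrite eZ.
by [].
Qed.

Lemma strata_sum_ext Z Z' A A' W : Z =i Z' -> A =i A' ->
  strata_sum Z A W = strata_sum Z' A' W.
Proof.
elim: W Z Z' A A' => [|w W IH] Z Z' A A' eZ eA /=.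
  exact: stratum_sign_ext.
congr (_ + _); apply: IH => // v.
  by rewrite !inE eZ.
by rewrite !inE eA.
Qed.

Lemma rowspan_kill Z c v : (forall z, z \in Z -> z ` c = 0) ->
  (v <= rowspan Z)%MS -> v ` c = 0.
Proof.
move=> cZ; suff h : rowspan Z *m c = 0.
  by move=> /submxP[D ->]; rewrite -mulmxA h mulmx0 mxE.
elim: Z cZ => [|w Z IH] cZ /=; first by rewrite mul0mx.
have h1 : w *m c = 0.
  by apply/matrixP => i j; rewrite !ord1 cZ ?mem_head // mxE.
have h2 : rowspan Z *m c = 0.
  by apply: IH => z zZ; apply: cZ; rewrite inE zZ orbT.
apply/eqP; rewrite -submx0 (eqmxMr c (addsmxE w (rowspan Z))) mul_col_mx h1 h2.
by rewrite col_mx0 sub0mx.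
Qed.

Lemma rank_rowspan_cons w Z : ~~ (w <= rowspan Z)%MS ->
  \rank (rowspan (w :: Z)) = (\rank (rowspan Z)).+1.
Proof.
move=> wZ; apply/eqP; rewrite eqn_leq; apply/andP; split.
  apply: leq_trans (mxrank_adds_leqif _ _) _.
  by rewrite -[(\rank (rowspan Z)).+1]add1n leq_add2r rank_leq_row.
apply: rank_ltmx; rewrite ltmxE addsmxSr /=.
by apply: contra wZ; apply: submx_trans; exact: addsmxSl.
Qed.

(** A nonempty open cone is cut by the hyperplane of [w]. If the cut is nonempty and [w] is
    independent of [Z], both open sides are nonempty and the cut, of dimension one less, cancels one
    of them. If the cut is empty, convexity leaves exactly one side. If [w] depends on [Z], the cut
    is the whole cone. *)
Lemma stratum_split w Z A : stratum_sign Z A =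
  stratum_sign Z (w :: A) + stratum_sign (w :: Z) A + stratum_sign Z (- w :: A).
Proof.
rewrite /stratum_sign.
have sub (X Y X' Y' : seq 'rV[R]_n) : {subset X <= X'} -> {subset Y <= Y'} ->
    feasible X' Y' -> feasible X Y.
  move=> XX' YY' [c [h1 h2]]; exists c; split=> v.
    by move=> /XX'; exact: h1.
  by move=> /YY'; exact: h2.
have subcons (X : seq 'rV[R]_n) v : {subset X <= v :: X}.
  by move=> u uX; rewrite inE uX orbT.
have [wZ|wZ] := boolP (w <= rowspan Z)%MS.
  have F1 : ~ feasible Z (w :: A).
    move=> [c [cZ cA]]; have := cA w (mem_head _ _).
    by rewrite (rowspan_kill cZ wZ) ltxx.
  have F2 : ~ feasible Z (- w :: A).
    move=> [c [cZ cA]]; have := cA (- w) (mem_head _ _).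
    by rewrite (@rowspan_kill Z) ?ltxx // eqmx_opp.
  have F3 : feasible (w :: Z) A = feasible Z A.
    apply/propext; split; first exact: sub.
    move=> [c [cZ cA]]; exists c; split=> // z; rewrite inE => /orP[/eqP->|].
      exact: rowspan_kill wZ.
    exact: cZ.
  rewrite (asboolF F1) (asboolF F2) F3 add0r addr0 /=.
  have -> // : \rank (w + rowspan Z)%MS = \rank (rowspan Z).
  by rewrite (addsmx_idPr wZ).
rewrite rank_rowspan_cons // exprS mulN1r.
have [c1 c1Z c1w] := not_sub_functional wZ.
have {}c1Z z : z \in Z -> z ` c1 = 0.
  by move=> /rowspan_mem/submxP[D ->]; rewrite -mulmxA c1Z mulmx0 mxE.
(* A large multiple of a point of the cut absorbs any [c2] that vanishes on [Z], so the value at [w]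
   can be prescribed without disturbing [A]. *)
have perturb c2 : feasible (w :: Z) A -> (forall z, z \in Z -> z ` c2 = 0) ->
    exists c, [/\ forall z, z \in Z -> z ` c = 0, forall a, a \in A -> a ` c < 0 &
      w ` c = w ` c2].
  move=> [c [cZ cA]] c2Z.
  have [M M0 hM] := large_multiple A (fun a => a ` c) (fun a => a ` c2).
  exists (M *: c + c2); split=> [z zZ|a aA|]; rewrite pairD pairZ.
  - by rewrite cZ ?c2Z ?mulr0 ?addr0 // inE zZ orbT.
  - by apply: hM => //; exact: cA.
  - by rewrite cZ ?mem_head // mulr0 add0r.
have [[c2 c2Z c2w] [c3 c3Z c3w]] :
    (exists2 c : 'cV[R]_n, forall z, z \in Z -> z ` c = 0 & w ` c < 0) /\
    (exists2 c : 'cV[R]_n, forall z, z \in Z -> z ` c = 0 & 0 < w ` c).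
  have N1 z : z \in Z -> z ` (- c1) = 0 by move=> zZ; rewrite pairN c1Z // oppr0.
  move: c1w; rewrite neq_lt => /orP[h|h]; split.
  - by exists c1.
  - by exists (- c1); rewrite // pairN oppr_gt0.
  - by exists (- c1); rewrite // pairN oppr_lt0.
  - by exists c1.
have zp : feasible (w :: Z) A -> feasible Z (w :: A).
  move=> /perturb/(_ c2Z)[c [cZ cA cw]]; exists c; split=> // a.
  by rewrite inE => /orP[/eqP->|/cA//]; rewrite cw.
have zq : feasible (w :: Z) A -> feasible Z (- w :: A).
  move=> /perturb/(_ c3Z)[c [cZ cA cw]]; exists c; split=> // a.
  by rewrite inE => /orP[/eqP->|/cA//]; rewrite mulNmx mxE cw oppr_lt0.
(* The segment between points on opposite sides meets the hyperplane; the witness is the positive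
   combination that vanishes at [w]. *)
have pqz : feasible Z (w :: A) -> feasible Z (- w :: A) -> feasible (w :: Z) A.
  move=> [c [cZ cA]] [c' [c'Z c'A]].
  have cw := cA w (mem_head _ _).
  have := c'A (- w) (mem_head _ _); rewrite mulNmx mxE oppr_lt0 => c'w.
  exists ((w ` c') *: c - (w ` c) *: c'); split=> v.
    rewrite pairD pairN !pairZ inE => /orP[/eqP->|vZ]; first by rewrite mulrC subrr.
    by rewrite (cZ v vZ) (c'Z v vZ) !mulr0 subr0.
  move=> vA; rewrite pairD pairN !pairZ.
  have va := cA v (subcons _ _ _ vA); have va' := c'A v (subcons _ _ _ vA).
  have : w ` c' * v ` c < 0 by rewrite pmulr_rlt0.
  have : 0 < w ` c * v ` c' by rewrite nmulr_rgt0.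
  lra.
have ex : feasible Z A ->
    [\/ feasible Z (w :: A), feasible (w :: Z) A | feasible Z (- w :: A)].
  move=> [c [cZ cA]]; case: (ltgtP (w ` c) 0) => cw.
  - constructor 1; exists c; split=> // a; rewrite inE => /orP[/eqP->//|]; exact: cA.
  - constructor 3; exists c; split=> // a; rewrite inE => /orP[/eqP->|]; last exact: cA.
    by rewrite mulNmx mxE oppr_lt0.
  - constructor 2; exists c; split=> // a; rewrite inE => /orP[/eqP->//|]; exact: cZ.
have [h|h] := pselect (feasible Z A); last first.
  rewrite (asboolF h) !asboolF ?addr0 // => h'; apply: h.
  - by apply: (sub _ _ Z (- w :: A)).
  - by apply: (sub _ _ (w :: Z) A).
  - by apply: (sub _ _ Z (w :: A)).
rewrite (asboolT h) {perturb}.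
have [z|z] := pselect (feasible (w :: Z) A).
  by rewrite (asboolT z) (asboolT (zp z)) (asboolT (zq z)) subrr add0r.
rewrite (asboolF z) addr0.
have [p|p] := pselect (feasible Z (w :: A)).
  by rewrite (asboolT p) asboolF ?addr0 // => q; apply: z; exact: pqz.
rewrite (asboolF p) add0r asboolT //.
by case: (ex h).
Qed.

(** Allows a weak inequality to be dropped from [W] at the price of a sum with the opposite strict
    inequality in [A]. *)
Lemma strata_sum_split w Z A W : strata_sum Z A W =
  strata_sum Z A (w :: W) + strata_sum Z (- w :: A) W.
Proof.
elim: W Z A => [|w' W IH] Z A /=.
  by rewrite [stratum_sign (w :: Z) A + _]addrC -stratum_split.
rewrite {1}(IH (w' :: Z) A) {1}(IH Z (w' :: A)) /=.
have swap (X Y : seq 'rV[R]_n) u v : [:: u, v & X] =i [:: v, u & X].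
  by move=> t; rewrite !inE orbCA.
rewrite (@strata_sum_ext [:: w, w' & Z] [:: w', w & Z] A A) //; last exact: swap.
rewrite (@strata_sum_ext Z Z [:: w, w' & A] [:: w', w & A]) //; last exact: swap.
rewrite (@strata_sum_ext Z Z [:: - w, w' & A] [:: w', - w & A]) //; last exact: swap.
by rewrite addrACA; congr (_ + _); rewrite addrACA.
Qed.

Section Vanishing.
Variable c0 : 'cV[R]_n.

(** Moving along [c0], which leaves the values on [Z] and [W] unchanged, pairs each stratum on
    [w = 0] with the one on [w < 0]: they are empty together, and their dimensions differ by one. *)
Lemma strata_sum_pair w Z A W : w ` c0 < 0 ->
  (forall z, z \in Z -> z ` c0 = 0) -> (forall a, a \in A -> 0 <= a ` c0) ->
  (forall v, v \in W -> v ` c0 = 0) ->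
  strata_sum (w :: Z) A W + strata_sum Z (w :: A) W = 0.
Proof.
move=> wc0; elim: W Z A => [|w' W IH] Z A Zc0 Ac0 Wc0 /=.
  rewrite /stratum_sign rank_rowspan_cons; last first.
    by apply/negP => /(rowspan_kill Zc0) e; rewrite e ltxx in wc0.
  have -> : feasible (w :: Z) A = feasible Z (w :: A).
    apply/propext; split=> -[c [cZ cA]].
      have [M M0 hM] := large_multiple A (fun a => a ` c) (fun a => a ` c0).
      exists (M *: c + c0); split=> v.
        move=> vZ; rewrite pairD pairZ Zc0 // cZ ?mulr0 ?addr0 //.
        by rewrite inE vZ orbT.
      rewrite pairD pairZ inE => /orP[/eqP->|vA]; last by apply: hM => //; exact: cA.
      by rewrite cZ ?mem_head // mulr0 add0r.
    have cw := cA w (mem_head _ _).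
    (* Both [w] values are negative, so this is a positive multiple of [c] minus a positive multiple
       of [c0], scaled to vanish at [w]; since [c0] is nonnegative on [A], the values there stay
       negative. *)
    exists (- (w ` c0) *: c + (w ` c) *: c0); split=> v.
      rewrite pairD !pairZ inE => /orP[/eqP->|vZ].
        by rewrite mulNr mulrC addNr.
      by rewrite (cZ v vZ) (Zc0 v vZ) !mulr0 addr0.
    move=> vA; rewrite pairD !pairZ.
    have va : v ` c < 0 by apply: cA; rewrite inE vA orbT.
    have : 0 < w ` c0 * v ` c by rewrite nmulr_rgt0.
    have := Ac0 v vA; have : w ` c * v ` c0 <= 0 by rewrite nmulr_rle0 //; exact: Ac0.
    lra.
  by case: ifP => _; rewrite ?addr0 // exprS mulN1r addNr.
have w'0 : w' ` c0 = 0 by apply: Wc0; rewrite mem_head.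
have W0 v : v \in W -> v ` c0 = 0 by move=> vW; apply: Wc0; rewrite inE vW orbT.
have swap (X Y : seq 'rV[R]_n) u v : [:: u, v & X] =i [:: v, u & X].
  by move=> t; rewrite !inE orbCA.
rewrite addrACA (@strata_sum_ext [:: w', w & Z] [:: w, w' & Z] A A) //;
  last exact: swap.
rewrite (@strata_sum_ext Z Z [:: w', w & A] [:: w, w' & A]) //; last exact: swap.
rewrite !IH ?addr0 // => v.
  by rewrite inE => /orP[/eqP->|/Ac0//]; rewrite w'0.
by rewrite inE => /orP[/eqP->|/Zc0].
Qed.

(** As long as two members of [W] are negative at [c0], one is removed by [strata_sum_split]; its
    opposite joins [A], which is why only nonnegativity at [c0] is asked there. With a single one
    left, [strata_sum_pair] applies. *)
Lemma strata_sum0 Z A W :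
  (forall z, z \in Z -> z ` c0 = 0) -> (forall a, a \in A -> 0 <= a ` c0) ->
  (forall v, v \in W -> v ` c0 <= 0) -> (exists2 v, v \in W & v ` c0 < 0) ->
  strata_sum Z A W = 0.
Proof.
elim: W Z A => [|w W IH] Z A Zc0 Ac0 Wc0 [u uW uc0]; first by [].
have W0 v : v \in W -> v ` c0 <= 0 by move=> vW; apply: Wc0; rewrite inE vW orbT.
have := Wc0 w (mem_head _ _); rewrite le_eqVlt => /orP[/eqP w0|w0].
  have hW : exists2 v, v \in W & v ` c0 < 0.
    exists u => //; move: uW; rewrite inE => /orP[/eqP e|//].
    by rewrite e w0 ltxx in uc0.
  rewrite /= !IH ?addr0 // => v.
    by rewrite inE => /orP[/eqP->|/Ac0//]; rewrite w0.
  by rewrite inE => /orP[/eqP->|/Zc0].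
have [hW|hW] := pselect (exists2 v, v \in W & v ` c0 < 0).
  have /eqP := strata_sum_split w Z A W; rewrite -subr_eq => /eqP <-.
  rewrite !IH ?subr0 // => v.
  by rewrite inE => /orP[/eqP->|/Ac0//]; rewrite mulNmx mxE oppr_ge0 ltW.
apply: strata_sum_pair => // v vW; apply/eqP; rewrite eq_le W0 //= leNgt.
by apply/negP => h; apply: hW; exists v.
Qed.

End Vanishing.
End Strata.

(** * Euler's relation and combinatorial invariance *)

Section FaceSequence.
Variables (R : realType) (n : nat).
Implicit Types (P Q F G : polytope R n) (s : seq 'rV[R]_n) (c : 'cV[R]_n).
Implicit Types (u v w x y : 'rV[R]_n).
Local Notation "x '`' c" := ((x *m c) 0 0) (at level 36).

Lemma finite_polytope_faces P : finite_set [set F : polytope R n | is_face P F].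
Proof.
apply: (@finite_preimage _ _ [set F | is_face P F] (@polytope_set R n)).
  by move=> F G _ _; exact: polytope_inj.
exact/finite_faces/polytopeP.
Qed.

Definition faces P : seq (polytope R n) :=
  enum_fset (fset_set [set F : polytope R n | is_face P F]).

Lemma facesP P F : reflect (is_face P F) (F \in faces P).
Proof.
rewrite /faces in_fset_set; last exact: finite_polytope_faces.
by apply: (iffP idP); rewrite inE.
Qed.

Lemma uniq_faces P : uniq (faces P).
Proof. exact: fset_uniq. Qed.

Lemma face_sum_faces k P :
  face_sum k P =
  \sum_(F <- faces P | (affine_dim F + k == affine_dim P)%N) comb_class F.
Proof.
rewrite /face_sum; set S := [set F | _].
have fS : finite_set S.
  by apply: sub_finite_set (finite_polytope_faces P) => F [].
rewrite fsbig_finite //= -[RHS]big_filter; apply: perm_big; apply: uniq_perm.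
- exact: fset_uniq.
- by rewrite filter_uniq // uniq_faces.
move=> F; rewrite in_fset_set // mem_filter; apply/idP/andP; rewrite inE.
  by move=> -[/facesP fF /eqP dF].
by move=> [/eqP dF /facesP fF].
Qed.

Lemma polytope_neq0 P : P !=set0.
Proof. by have [] := polytopeP P. Qed.

Lemma face_poly_trans P F G : is_face P F -> is_face F G -> is_face P G.
Proof. by apply: face_trans; exact: polytopeP. Qed.

Lemma mem_facesE P F G : is_face P F ->
  (G \in faces F) = (G \in faces P) && `[< G `<=` F >].
Proof.
move=> PF; apply/facesP/andP => [FG|[/facesP PG /asboolP GF]].
  split; first by apply/facesP; exact: face_poly_trans PF FG.
  by apply/asboolP; exact: face_sub.
exact: face_inherit PG GF (face_sub PF).
Qed.

(* When [Z] generates a face [F] and [A] is empty, the sum is over the faces that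
   contain [F]. *)
Lemma strata_faces P s v0 Z A W : polytope_set P = conv_hull [set` s] ->
  v0 \in Z -> {subset Z <= s} -> {subset A <= s} -> {subset W <= s} ->
  (forall v, v \in s -> [|| v \in Z, v \in A | v \in W]) ->
  \sum_(G <- faces P | `[< exists c, [/\ forall z, z \in Z -> z ` c = v0 ` c,
      forall a, a \in A -> a ` c < v0 ` c, forall w, w \in W -> w ` c <= v0 ` c &
      polytope_set G = P `&` [set x | x ` c = v0 ` c]] >])
    (-1) ^+ affine_dim G =
  strata_sum [seq v - v0 | v <- Z] [seq v - v0 | v <- A] [seq v - v0 | v <- W].
Proof.
move=> eP; elim: W Z A => [|w W IH] Z A v0Z Zs As Ws hs.
  have GE c : (forall z, z \in Z -> z ` c = v0 ` c) ->
      (forall a, a \in A -> a ` c < v0 ` c) ->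
      P `&` [set x | x ` c = v0 ` c] = conv_hull [set` Z].
    move=> cZ cA; have sc v : v \in s -> v ` c <= v0 ` c.
      by move=> /hs /or3P[/cZ->|/cA/ltW|].
    rewrite eP gens_face //; congr conv_hull; apply/seteqP; split=> v /=.
      rewrite mem_filter => /andP[/eqP vc /hs /or3P[//|/cA|//]].
      by rewrite vc ltxx.
    by move=> vZ; rewrite mem_filter cZ // eqxx Zs.
  rewrite /= /stratum_sign; case: asboolP => [[c [cZ cA]]|nf]; last first.
    rewrite big1 // => G /asboolP[c [cZ cA _ _]]; case: nf; exists c.
    by split=> v /mapP[u uZ ->]; rewrite pairBl ?subr_lt0 ?cA // cZ // subrr.
  have {}cZ z : z \in Z -> z ` c = v0 ` c.
    move=> zZ; apply/eqP; rewrite -subr_eq0 -pairBl cZ //.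
    by apply/mapP; exists z.
  have {}cA a : a \in A -> a ` c < v0 ` c.
    by move=> aA; rewrite -subr_lt0 -pairBl cA //; apply/mapP; exists a.
  have sc v : v \in s -> v ` c <= v0 ` c.
    by move=> /hs /or3P[/cZ->|/cA/ltW|].
  have fZ : is_face P (conv_hull [set` Z]).
    rewrite -(GE c) //; exists c, (v0 ` c); split=> // x.
    by rewrite eP; exact: conv_hull_le.
  have Z0 : conv_hull [set` Z] !=set0 by exists v0; exact: conv_hull_mem.
  pose G0 := Polytope (nonempty_face_polytope (polytopeP P) fZ Z0).
  rewrite (eq_bigl (pred1 G0)) => [|G].
    rewrite -big_filter filter_pred1_uniq ?uniq_faces //; last exact/facesP.
    by rewrite big_seq1 /= (affine_dim_conv v0Z).
  apply/asboolP/eqP => [[c' [c'Z c'A _ eG]]|->].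
    by apply: polytope_inj; rewrite eG GE.
  by exists c; split=> //=; rewrite GE.
(* A face [G] either contains [w], and [w] joins the equations [Z], or does not, and [w] joins the
   strict inequalities [A]. *)
rewrite /= (bigID (fun G : polytope R n => `[< (G : set _) w >])) /=.
have ws : w \in s by apply: Ws; rewrite mem_head.
have Pw : (P : set _) w by rewrite eP; exact: conv_hull_mem.
have Ws' : {subset W <= s} by move=> v vW; apply: Ws; rewrite inE vW orbT.
rewrite -(IH (w :: Z) A) //; first last.
- move=> v /hs; rewrite !inE.
  by case/or3P => [->|->|/orP[->|->]]; rewrite ?orbT.
- by move=> v; rewrite inE => /orP[/eqP->|/Zs].
- by rewrite inE v0Z orbT.
rewrite -(IH Z (w :: A)) //; first last.
- move=> v /hs; rewrite !inE.
  by case/or3P => [->|->|/orP[->|->]]; rewrite ?orbT.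
- by move=> v; rewrite inE => /orP[/eqP->|/As].
congr (_ + _); apply: eq_bigl => G.
  apply/andP/asboolP => [[/asboolP[c [cZ cA cW eG]] /asboolP Gw]|[c [cZ cA cW eG]]].
    exists c; split=> // [z|v vW]; last by apply: cW; rewrite inE vW orbT.
    rewrite inE => /orP[/eqP->|/cZ //].
    by move: Gw; rewrite eG => -[].
  have wc : w ` c = v0 ` c by apply: cZ; rewrite mem_head.
  split; apply/asboolP; last by rewrite eG; split.
  exists c; split=> // [z zZ|v]; first by apply: cZ; rewrite inE zZ orbT.
  by rewrite inE => /orP[/eqP->|/cW//]; rewrite wc.
apply/andP/asboolP => [[/asboolP[c [cZ cA cW eG]] /asboolP Gw]|[c [cZ cA cW eG]]].
  exists c; split=> // [a|v vW]; last by apply: cW; rewrite inE vW orbT.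
  rewrite inE => /orP[/eqP->|/cA //].
  rewrite lt_neqAle cW ?mem_head // andbT; apply/eqP => wc.
  by apply: Gw; rewrite eG; split.
have wc : w ` c < v0 ` c by apply: cA; rewrite mem_head.
split; apply/asboolP.
  exists c; split=> // [a aA|v]; first by apply: cA; rewrite inE aA orbT.
  by rewrite inE => /orP[/eqP->|/cW//]; exact: ltW.
by rewrite eG => -[_ /= e]; rewrite e ltxx in wc.
Qed.

(** The functional that cuts out [F] is the certificate for [strata_sum0]: after translation by [v0]
    it vanishes on the generators of [F] and is negative on the others, of which there is one
    because [F <> P]. *)
Theorem euler_relation P F : is_face P F -> F <> P ->
  \sum_(G <- faces P | `[< F `<=` G >]) (-1) ^+ affine_dim G = 0 :> int.
Proof.
move=> fF nFP; have [c0 [b [hb eF]]] := fF.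
have [_ [s eP]] := polytopeP P.
have sb v : v \in s -> v ` c0 <= b.
  by move=> vs; apply: hb; rewrite eP; exact: conv_hull_mem.
set Z := [seq v <- s | v ` c0 == b].
have eFs : polytope_set F = conv_hull [set` Z] by rewrite eF eP gens_face.
have [v0 v0Z] : exists v, v \in Z.
  by apply: conv_hull_neq0; rewrite -eFs; exact: polytope_neq0.
have Zb z : z \in Z -> z ` c0 = b by rewrite mem_filter => /andP[/eqP].
have Zs : {subset Z <= s} by move=> z; rewrite mem_filter => /andP[].
set W := [seq v <- s | v ` c0 != b].
have Wb w : w \in W -> w ` c0 < b.
  by rewrite mem_filter => /andP[wb /sb]; rewrite lt_neqAle wb.
have Ws : {subset W <= s} by move=> z; rewrite mem_filter => /andP[].
have [u uW] : exists u, u \in W.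
  apply: contrapT => hn; apply: nFP; apply: polytope_inj; rewrite eFs eP.
  congr conv_hull; apply/seteqP; split=> v /=; first exact: Zs.
  move=> vs; rewrite mem_filter vs andbT; apply: contraT => vb.
  by case: hn; exists v; rewrite mem_filter vb.
have v0b := Zb _ v0Z.
transitivity (strata_sum [seq v - v0 | v <- Z] [seq v - v0 | v <- [::]]
  [seq v - v0 | v <- W]); last first.
  apply: (@strata_sum0 _ _ c0) => [z|//|w|].
  - by move=> /mapP[v vZ ->]; rewrite pairBl Zb // v0b subrr.
  - by move=> /mapP[v vW ->]; rewrite pairBl v0b subr_le0 ltW // Wb.
  - exists (u - v0); first by apply/mapP; exists u.
    by rewrite pairBl v0b subr_lt0 Wb.
rewrite -(@strata_faces P s) //; last first.
  move=> v vs; rewrite !mem_filter vs !andbT /=; exact: orbN.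
rewrite big_seq_cond [RHS]big_seq_cond; apply: eq_bigl => G.
apply: andb_id2l => /facesP PG; apply/asboolP/asboolP => [FG|].
  have [c [b' [hb' eG]]] := PG.
  have zb' z : z \in Z -> z ` c = b'.
    move=> zZ; have : (G : set _) z by apply: FG; rewrite eFs; exact: conv_hull_mem.
    by rewrite eG => -[].
  exists c; split=> // [z zZ|w wW|].
  - by rewrite !zb'.
  - by rewrite (zb' v0) //; apply: hb'; rewrite eP; apply: conv_hull_mem; exact: Ws.
  - by rewrite (zb' v0).
move=> [c [cZ _ _ eG]]; rewrite eG => x Fx; split; first exact: face_sub fF x Fx.
by move: Fx; rewrite eFs; exact: conv_hull_eq.
Qed.

End FaceSequence.

(** * Dimension and face operators as invariants of the face lattice *)

Section Combinatorial.
Variable R : realType.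

Definition lattice_iso n m (P : set 'rV[R]_n) (Q : set 'rV[R]_m) f : Prop :=
  set_bij [set F | is_face P F] [set G | is_face Q G] f /\
  forall F G, is_face P F -> is_face P G -> (f F `<=` f G <-> F `<=` G).

Lemma lattice_iso_top n m (P : set 'rV[R]_n) (Q : set 'rV[R]_m) f :
  lattice_iso P Q f -> f P = Q.
Proof.
move=> [[fPQ finj fsurj] fmono]; apply/seteqP; split.
  by apply: face_sub; apply: fPQ; exact: face_refl.
have [F PF <-] := fsurj _ (face_refl Q).
by apply/fmono => //; [exact: face_refl|exact: face_sub].
Qed.

Lemma lattice_iso_bot n m (P : set 'rV[R]_n) (Q : set 'rV[R]_m) f :
  lattice_iso P Q f -> f set0 = set0.
Proof.
move=> [[fPQ finj fsurj] fmono]; apply/seteqP; split=> //.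
have [F PF <-] := fsurj _ (face_set0 Q).
by apply/fmono => //; exact: face_set0.
Qed.

Lemma lattice_iso_face n m (P F : set 'rV[R]_n) (Q : set 'rV[R]_m) f :
  is_polytope P -> is_polytope Q -> lattice_iso P Q f -> is_face P F ->
  lattice_iso F (f F) f.
Proof.
move=> pP pQ [[fPQ finj fsurj] fmono] PF.
have QfF := fPQ _ PF.
have tr G : is_face F G -> is_face P G by move=> FG; exact: face_trans pP PF FG.
split; last by move=> G H /tr PG /tr PH; exact: fmono.
split.
- move=> G /= FG; have PG := tr _ FG; apply: face_inherit (fPQ _ PG) _ (face_sub QfF).
  by apply/fmono => //; exact: face_sub.
- move=> G H; rewrite !inE /= => /tr PG /tr PH; apply: finj; rewrite inE //.
- move=> H /= fFH; have QH := face_trans pQ QfF fFH.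
  have [G PG eG] := fsurj _ QH; exists G => //.
  apply: (face_inherit PG _ (face_sub PF)).
  by apply: (fmono G F PG PF).1; rewrite eG; exact: face_sub.
Qed.

(** Induction along facets: [P] has a face of dimension exactly one less, while its image, a proper
    nonempty face of [Q], loses at least one dimension. *)
Lemma lattice_iso_dim_le d n m (P : set 'rV[R]_n) (Q : set 'rV[R]_m) f :
  is_polytope P -> is_polytope Q -> lattice_iso P Q f -> affine_dim P = d ->
  (d <= affine_dim Q)%N.
Proof.
elim: d P Q => // d IH P Q pP pQ iso dP.
have [F [PF F0 dF]] := facet_exists pP dP.
have [[fPQ finj fsurj] fmono] := iso.
have QfF := fPQ _ PF.
have f0 := lattice_iso_bot iso; have fT := lattice_iso_top iso.
have fF0 : f F !=set0.
  apply/set0P; apply: contraPneq F0 => e; apply/set0P/negP; rewrite negbK.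
  by apply/eqP; apply: finj; rewrite ?inE //; [exact: face_set0|rewrite e f0].
have nfF : f F <> Q.
  rewrite -fT => e; have e' : F = P by apply: finj; rewrite ?inE //; exact: face_refl.
  by rewrite e' dP in dF; have := n_Sn d; rewrite dF.
apply: leq_ltn_trans (face_dim_lt QfF fF0 nfF).
apply: (IH F) => //; first exact: nonempty_face_polytope PF F0.
  exact: nonempty_face_polytope QfF fF0.
exact: (lattice_iso_face pP pQ iso PF).
Qed.

Lemma lattice_iso_comb n m (P : polytope R n) (Q : polytope R m) f :
  lattice_iso P Q f -> comb_equiv (AnyPolytope P) (AnyPolytope Q).
Proof. by move=> iso; apply/asboolP; exists f. Qed.

Lemma comb_equiv_dim n m (P : polytope R n) (Q : polytope R m) :
  comb_equiv (AnyPolytope P) (AnyPolytope Q) -> affine_dim P = affine_dim Q.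
Proof.
move=> PQ; have QP : comb_equiv (AnyPolytope Q) (AnyPolytope P).
  by rewrite comb_equiv_sym.
move: PQ QP => /asboolP[f iso] /asboolP[g iso'].
apply/eqP; rewrite eqn_leq; apply/andP; split.
  exact: (lattice_iso_dim_le (polytopeP P) (polytopeP Q) iso).
exact: (lattice_iso_dim_le (polytopeP Q) (polytopeP P) iso').
Qed.

Lemma comb_class_eq n m (P : polytope R n) (Q : polytope R m) :
  comb_equiv (AnyPolytope P) (AnyPolytope Q) -> comb_class P = comb_class Q.
Proof.
by move=> PQ; rewrite /comb_class; congr << _ >>; apply/eqmodP.
Qed.

Lemma face_sum_comb k n m (P : polytope R n) (Q : polytope R m) :
  comb_equiv (AnyPolytope P) (AnyPolytope Q) -> face_sum k P = face_sum k Q.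
Proof.
move=> PQ; have dPQ := comb_equiv_dim PQ.
move: PQ => /asboolP[f iso]; have [[fPQ finj fsurj] fmono] := iso.
have f0 := lattice_iso_bot iso.
(* [f] acts on sets; [g] bundles its values on nonempty faces as polytopes, with the dummy value [Q]
   elsewhere. *)
have /choice[g gP] (F : polytope R n) : exists G : polytope R m,
    is_face P F -> polytope_set G = f F.
  have [PF|] := pselect (is_face P F); last by exists Q.
  have fF0 : f F !=set0.
    have := polytope_neq0 F; move=> F0.
    apply/set0P; apply: contraPneq F0 => e; apply/set0P/negP; rewrite negbK.
    by apply/eqP; apply: finj; rewrite ?inE //; [exact: face_set0|rewrite e f0].
  by exists (Polytope (nonempty_face_polytope (polytopeP Q) (fPQ _ PF) fF0)).
have gcomb (F : polytope R n) :
    is_face P F -> comb_equiv (AnyPolytope F) (AnyPolytope (g F)).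
  move=> PF; apply: (@lattice_iso_comb _ _ _ _ f); rewrite gP //.
  exact: (lattice_iso_face (polytopeP P) (polytopeP Q)).
rewrite !face_sum_faces -dPQ.
have -> : \sum_(G <- faces Q | (affine_dim G + k == affine_dim P)%N) comb_class G =
    \sum_(G <- map g (faces P) | (affine_dim G + k == affine_dim P)%N) comb_class G.
  apply: perm_big; apply: uniq_perm; first exact: uniq_faces.
    rewrite map_inj_in_uniq ?uniq_faces // => F G /facesP PF /facesP PG e.
    by apply: polytope_inj; apply: finj; rewrite ?inE // -!gP // e.
  move=> G; apply/facesP/mapP => [QG|[F /facesP PF ->]]; last first.
    by rewrite gP //; exact: fPQ.
  have [F PF eF] := fsurj _ QG.
  have F0 : F !=set0.
    have [x Gx] := polytope_neq0 G.
    apply/set0P; apply: contraPneq Gx => F0; rewrite -eF F0 f0.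
    by case.
  exists (Polytope (nonempty_face_polytope (polytopeP P) PF F0)); first exact/facesP.
  by apply: polytope_inj; rewrite gP.
rewrite big_map big_seq_cond [RHS]big_seq_cond; apply: eq_big => F.
  apply: andb_id2l => /facesP PF.
  by rewrite (comb_equiv_dim (gcomb F PF)).
by move=> /andP[/facesP PF _]; apply: comb_class_eq; exact: gcomb.
Qed.

Lemma face_op_class k n (P : polytope R n) : face_op R k (comb_class P) = face_sum k P.
Proof.
rewrite /= /face_op_fun /comb_class liftU scale1r.
set C := repr _; have : comb_equiv (AnyPolytope P) C.
  by rewrite -/(comb_equiv_rel R _ _); apply/eqmodP; rewrite reprK.
by rewrite comb_equiv_sym; case: C => m Q; exact: face_sum_comb.
Qed.

Lemma comb_class_ind (f g : {additive polytope_group R -> polytope_group R}) :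
  (forall n (P : polytope R n), f (comb_class P) = g (comb_class P)) -> f =1 g.
Proof.
move=> fg; apply: (@freeg_ext _ _ f g) => C.
have -> : << C >> = comb_class (any_polytope_body (repr C)) :> polytope_group R.
  rewrite /comb_class; congr << _ >>; rewrite -[LHS]reprK.
  by case: (repr C).
exact: fg.
Qed.

(** Evaluated at [P], the coefficient of a face [F] of codimension [n] is an alternating count of
    the faces between [F] and [P]. Here [0 < n] excludes [F = P]. *)
Lemma face_op_euler n : (0 < n)%N ->
  \sum_(i < n.+1) (-1) ^+ i * face_op R i * face_op R (n - i) = 0.
Proof.
move=> n0; apply: endo_ext; apply: comb_class_ind => m P.
have sumE (I : finType) (F : I -> endo (polytope_group R)) x :
    (\sum_i F i : endo _) x = \sum_i F i x.
  by elim/big_rec2: _ => //= i y z _ <-.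
have signE i (g : endo (polytope_group R)) x : ((-1) ^+ i * g) x = g x *~ (-1) ^+ i.
  elim: i x => [|i IH] x; first by rewrite expr0 mul1r mulr1z.
  rewrite exprS -mulrA mulN1r exprS mulN1r mulrNz -IH; by [].
have mulE (f g : endo (polytope_group R)) x : (f * g) x = f (g x) by [].
rewrite sumE.
pose term i (G F : polytope R m) : bool :=
  [&& (affine_dim G + (n - i) == affine_dim P)%N, `[< F `<=` G >] &
      (affine_dim F + i == affine_dim G)%N].
transitivity (\sum_(i < n.+1) \sum_(G <- faces P) \sum_(F <- faces P | term i G F)
    comb_class F *~ (-1) ^+ i).
  apply: eq_bigr => i _; rewrite -mulrA signE mulE face_op_class.
  rewrite face_sum_faces raddf_sum.
  rewrite mulrz_suml big_seq_cond [RHS]big_seq /= big_mkcondr /=.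
  apply: eq_bigr => G /facesP PG.
  rewrite face_op_class face_sum_faces /term.
  case: eqP => _; last by rewrite big_pred0.
  rewrite mulrz_suml -[LHS]big_filter -[RHS]big_filter; apply: perm_big.
  apply: uniq_perm; rewrite ?filter_uniq ?uniq_faces // => F.
  rewrite !mem_filter (mem_facesE _ PG) /= andbCA [RHS]andbC.
  by congr (_ && _); rewrite andbC.
under eq_bigr => i _.
  under eq_bigr do rewrite big_mkcond /=.
  rewrite exchange_big /=; over.
rewrite exchange_big /= big_seq big1 // => F /facesP PF.
have [dF|dF] := eqVneq (affine_dim F + n)%N (affine_dim P); last first.
  rewrite big1 // => i _; rewrite big1 // => G _.
  case: ifP => // /and3P[/eqP e1 _ /eqP e2].
  by case/eqP: dF; have := ltn_ord i; lia.
have FP : F <> P by move=> e; rewrite e -[RHS]addn0 in dF; move/addnI: dF n0 => ->.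
(* The exponent should be the difference of the dimensions; the sum has the same parity and factors
   without subtraction. *)
transitivity (\sum_(G <- faces P | `[< F `<=` G >])
    comb_class F *~ ((-1) ^+ (affine_dim G + affine_dim F))); last first.
  rewrite -mulrz_sumr (_ : \sum_(_ <- _ | _) _ = 0) ?mulr0z //.
  under eq_bigr do rewrite exprD.
  by rewrite -mulr_suml euler_relation // mul0r.
rewrite exchange_big /= [RHS]big_mkcond big_seq [RHS]big_seq.
apply: eq_bigr => G /facesP PG; rewrite -big_mkcond /=.
case: asboolP => FG; last first.
  by rewrite big_pred0 // => i; rewrite /term (asboolF FG) andbF.
have dFG := affine_dim_le (polytope_neq0 F) FG.
have dGP := affine_dim_le (polytope_neq0 G) (face_sub PG).
have iP : (affine_dim G - affine_dim F < n.+1)%N by lia.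
rewrite (big_pred1 (Ordinal iP)) /=.
  congr (_ *~ _); rewrite -[X in _ ^+ (X + _)](subnK dFG) -addnA addnn exprD.
  by rewrite -[X in _ * X]signr_odd odd_double mulr1.
move=> i; rewrite /term (asboolT FG) /= -val_eqE /=.
by apply/andP/eqP => [[/eqP e1 /eqP e2]|->]; [lia|split; apply/eqP; lia].
Qed.

End Combinatorial.

(** * Prisms and pyramids *)

Section Frustum.
Variables (R : realType) (n : nat).
Implicit Types (X F : set 'rV[R]_n) (c : 'cV[R]_n).
Implicit Types (u v w x y : 'rV[R]_n) (t h g : R) (b : bool).
Local Notation "x '`' c" := ((x *m c) 0 0) (at level 36).

(** Prism and pyramid are both swept out by segments that start at [(x, 0)] and end at [(x, 1)] or
    at the apex [(0, 1)]; one boolean lets them share the analysis of faces. *)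
Definition shrink b t : R := if b then 1 else 1 - t.
Definition frpt b x t : 'rV[R]_(n + 1) := row_mx (shrink b t *: x) t%:M.

(* The prism over [X] if [b], the pyramid over [X] otherwise. *)
Definition frustum b X : set 'rV[R]_(n + 1) :=
  [set y | exists x t, [/\ X x, 0 <= t, t <= 1 & y = frpt b x t]].

Definition slice h X : set 'rV[R]_(n + 1) := [set row_mx x h%:M | x in X].
Definition frtop b X : set 'rV[R]_(n + 1) := [set frpt b x 1 | x in X].

Lemma pair0 x : x ` (0 : 'cV[R]_n) = 0.
Proof. by rewrite mulmx0 mxE. Qed.

Lemma one_neq0 t : t = 1 -> t <> 0.
Proof. by move=> -> /eqP; rewrite oner_eq0. Qed.

Lemma frpt0 b x : frpt b x 0 = row_mx x 0%:M.
Proof. by rewrite /frpt /shrink; case: b; rewrite ?subr0 scale1r. Qed.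

Lemma frpt_apex x : frpt false x 1 = row_mx 0 1%:M.
Proof. by rewrite /frpt /shrink subrr scale0r. Qed.

Lemma frtop_prism X : frtop true X = slice 1 X.
Proof.
by apply/seteqP; split=> y [x Xx <-]; exists x => //; rewrite /frpt scale1r.
Qed.

Lemma row_mx_inj x y t h : row_mx x t%:M = row_mx y h%:M :> 'rV[R]_(n + 1) ->
  x = y /\ t = h.
Proof.
move=> /eq_row_mx[-> e]; split=> //.
by have := congr1 (fun M : 'M_1 => M 0 0) e; rewrite !mxE eqxx.
Qed.

Lemma pair_row x t (c : 'cV[R]_(n + 1)) :
  row_mx x t%:M ` c = x ` usubmx c + t * dsubmx c 0 0.
Proof.
by rewrite -{1}[c]vsubmxK mul_row_col mul_scalar_mx mxE; congr (_ + _); rewrite mxE.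
Qed.

(** A functional interpolates between its values at the two ends of the segment over [x]; in a
    pyramid the value at the upper end does not depend on [x]. *)
Lemma pair_frpt b x t (c : 'cV[R]_(n + 1)) :
  frpt b x t ` c = (1 - t) * x ` usubmx c +
    t * (x ` (if b then usubmx c else 0) + dsubmx c 0 0).
Proof.
rewrite /frpt pair_row pairZl /shrink; case: b; last by rewrite pair0; lra.
by lra.
Qed.

Lemma conv_eq0 t (p q : R) : 0 <= t -> t <= 1 -> p <= 0 -> q <= 0 ->
  (1 - t) * p + t * q = 0 <-> (t = 1 \/ p = 0) /\ (t = 0 \/ q = 0).
Proof.
move=> t0 t1 p0 q0; split; last first.
  by move=> [[->|->] [->|->]]; rewrite ?subrr ?subr0; lra.
have h1 : (1 - t) * p <= 0 by rewrite mulr_ge0_le0 // subr_ge0.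
have h2 : t * q <= 0 by rewrite mulr_ge0_le0.
move=> e; have : (1 - t) * p = 0 by lra.
have : t * q = 0 by lra.
move=> /eqP; rewrite mulf_eq0 => /orP[] /eqP e1;
  move=> /eqP; rewrite mulf_eq0 => /orP[] /eqP e2; split; (try by right);
  left; lra.
Qed.

Lemma frustum_tight b x t (c : 'cV[R]_(n + 1)) (d : R) : 0 <= t -> t <= 1 ->
  x ` usubmx c <= d -> x ` (if b then usubmx c else 0) + dsubmx c 0 0 <= d ->
  frpt b x t ` c = d <-> (t = 1 \/ x ` usubmx c = d) /\
    (t = 0 \/ x ` (if b then usubmx c else 0) + dsubmx c 0 0 = d).
Proof.
move=> t0 t1; rewrite pair_frpt; move: (x ` usubmx c) (_ + _) => p q pd qd.
have [||h1 h2] := @conv_eq0 t (p - d) (q - d) t0 t1; rewrite ?subr_le0 //.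
split=> [e|[e1 e2]].
  have [|e1 e2] := h1; first lra.
  by split; [case: e1|case: e2] => ?; [left|right; lra|left|right; lra].
suff : (1 - t) * (p - d) + t * (q - d) = 0 by lra.
by apply: h2; split; [case: e1|case: e2] => ?; [left|right; lra|left|right; lra].
Qed.

Lemma frustum_le b x t (c : 'cV[R]_(n + 1)) (d : R) : 0 <= t -> t <= 1 ->
  x ` usubmx c <= d -> x ` (if b then usubmx c else 0) + dsubmx c 0 0 <= d ->
  frpt b x t ` c <= d.
Proof.
move=> t0 t1; rewrite pair_frpt; move: (x ` usubmx c) (_ + _) => p q pd qd.
have : (1 - t) * (p - d) <= 0 by rewrite mulr_ge0_le0 ?subr_ge0 ?subr_le0.
have : t * (q - d) <= 0 by rewrite mulr_ge0_le0 ?subr_le0.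
lra.
Qed.

Lemma frustum_pt b X x t : X x -> 0 <= t -> t <= 1 -> frustum b X (frpt b x t).
Proof. by move=> Xx t0 t1; exists x, t. Qed.

(** By [frustum_tight], a point is in [G] exactly when every end of its segment that carries
    positive weight attains the bound [d]. The cases are that [d] is attained at both levels, only
    below, or only above. *)
Lemma frustum_face_cases b X G : X !=set0 -> is_face (frustum b X) G -> G !=set0 ->
  exists F, [/\ is_face X F, F !=set0 &
    [\/ G = frustum b F, G = slice 0 F | G = frtop b F]].
Proof.
move=> [x0 Xx0] [c [d [hd eG]]] [y0 Gy0].
set c1 := usubmx c; set c2 := if b then c1 else 0; set g : R := dsubmx c 0 0.
have hA x : X x -> x ` c1 <= d.
  move=> Xx; have := hd _ (frustum_pt b Xx (lexx 0) ler01).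
  by rewrite pair_frpt -/c1; lra.
have hB x : X x -> x ` c2 + g <= d.
  move=> Xx; have := hd _ (frustum_pt b Xx ler01 (lexx 1)).
  by rewrite pair_frpt -/c1 -/c2 -/g; lra.
have tight x t : X x -> 0 <= t -> t <= 1 -> frpt b x t ` c = d <->
    (t = 1 \/ x ` c1 = d) /\ (t = 0 \/ x ` c2 + g = d).
  by move=> Xx t0 t1; apply: frustum_tight => //; [exact: hA|exact: hB].
have GP (y : 'rV[R]_(n + 1)) : G y <-> exists x t, [/\ X x, 0 <= t, t <= 1, y = frpt b x t &
    (t = 1 \/ x ` c1 = d) /\ (t = 0 \/ x ` c2 + g = d)].
  rewrite eG; split=> [[[x [t [Xx t0 t1 ->]]] /= /tight h]|[x [t [Xx t0 t1 -> h]]]].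
    by exists x, t; split=> //; exact: h.
  by split; [exists x, t|apply/tight].
have fA : is_face X (X `&` [set x | x ` c1 = d]) by exists c1, d.
have fB : is_face X (X `&` [set x | x ` c2 = d - g]).
  by exists c2, (d - g); split=> // x Xx; rewrite lerBrDr; exact: hB.
have [[xA XxA xAd]|nA] := pselect (exists2 x, X x & x ` c1 = d); last first.
  exists (X `&` [set x | x ` c2 = d - g]); split=> //.
    have [x [t [Xx t0 t1 _ [[t1'|xd] hB']]]] := (GP _).1 Gy0.
      exists x; split=> //=; case: hB' => [/(one_neq0 t1')//|<-].
      by rewrite addrK.
    by case: nA; exists x.
  constructor 3; apply/seteqP; split=> y.
    move=> /GP[x [t [Xx t0 t1 -> [[e|xd] hB']]]]; last by case: nA; exists x.
    exists x; last by rewrite e.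
    by split=> //=; case: hB' => [/(one_neq0 e)//|<-]; rewrite addrK.
  move=> [x [Xx /= xd] <-]; apply/GP; exists x, 1; split=> //.
  by split; [left|right; rewrite xd subrK].
have [[xB XxB xBd]|nB] := pselect (exists2 x, X x & x ` c2 + g = d); last first.
  exists (X `&` [set x | x ` c1 = d]); split=> //; first by exists xA.
  constructor 2; apply/seteqP; split=> y.
    move=> /GP[x [t [Xx t0 t1 -> [hA' [e|xd]]]]]; last by case: nB; exists x.
    exists x; last by rewrite e frpt0.
    by split=> //=; case: hA' => // /one_neq0/(_ e).
  move=> [x [Xx /= xd] <-]; apply/GP; exists x, 0; rewrite frpt0; split=> //.
  by split; [right|left].
exists (X `&` [set x | x ` c1 = d]); split=> //; first by exists xA.
constructor 1.
(* In a prism, attainment at both levels forces [g = 0], so both ends over [x] are tight together;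
   in a pyramid the apex is tight regardless of [x]. *)
have AB x : x ` c1 = d -> x ` c2 + g = d.
  have := hB _ XxA; have := hA _ XxB; move: xBd; rewrite /c2; case: (b).
    by lra.
  by rewrite !pair0; lra.
have BA x : b -> X x -> x ` c2 + g = d -> x ` c1 = d.
  have := hB _ XxA; have := hA _ XxB; move: xBd; rewrite /c2; case: (b) => //.
  by move=> + + + _ /hA; lra.
apply/seteqP; split=> y.
  move=> /GP[x [t [Xx t0 t1 -> [[e|xd] h]]]]; last by exists x, t.
  rewrite e; have [bT|bF] := boolP b.
    exists x, 1; split=> //; split=> //=; apply: BA => //.
    by case: h => // /(one_neq0 e).
  by exists xA, 1; split=> //; rewrite !frpt_apex.
move=> [x [t [[Xx /= xd] t0 t1 ->]]]; apply/GP; exists x, t; split=> //.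
by split; right=> //; exact: AB.
Qed.

Let vfun c g : 'cV[R]_(n + 1) := col_mx c g%:M.

Let vfun_u c g : usubmx (vfun c g) = c. Proof. exact: col_mxKu. Qed.
Let vfun_d c g : dsubmx (vfun c g) 0 0 = g.
Proof. by rewrite col_mxKd mxE eqxx. Qed.

Lemma frustum_face b X F : is_face X F -> F !=set0 ->
  is_face (frustum b X) (frustum b F).
Proof.
(* With this [g] the upper end is tight together with the lower one in a prism, and the apex is
   tight in a pyramid. *)
move=> [c [d [hd eF]]] [x0 Fx0]; pose g := if b then 0 else d.
have hB x : X x -> x ` (if b then c else 0) + g <= d.
  by move=> /hd; rewrite /g; case: (b); rewrite ?addr0 // pair0 add0r.
exists (vfun c g), d; split=> [y [x [t [Xx t0 t1 ->]]]|].
  by apply: frustum_le; rewrite ?vfun_u ?vfun_d //; [exact: hd|exact: hB].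
apply/seteqP; split=> y.
  move=> [x [t [+ t0 t1 ->]]]; rewrite eF => -[Xx /= xd]; split; first by exists x, t.
  apply/frustum_tight; rewrite ?vfun_u ?vfun_d //; [exact: hd|exact: hB|].
  split; right=> //; rewrite /g; case: (b); rewrite ?addr0 // pair0 add0r //.
move=> [[x [t [Xx t0 t1 ->]]] /= /frustum_tight].
rewrite vfun_u vfun_d => /(_ t0 t1 (hd _ Xx) (hB _ Xx)) [[e|xd] h2]; last first.
  by exists x, t; split=> //; rewrite eF.
rewrite e; move: h2; rewrite e /g; case: (b) => h2.
  exists x, 1; split=> //; rewrite eF; split=> //=.
  by case: h2 => [/(one_neq0 (erefl _))//|]; rewrite addr0.
by exists x0, 1; rewrite !frpt_apex.
Qed.

Lemma slice_face b X F : is_face X F -> is_face (frustum b X) (slice 0 F).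
Proof.
(* This [g] keeps all upper ends strictly below [d]. *)
move=> [c [d [hd eF]]]; pose g := if b then -1 else d - 1.
have hB x : X x -> x ` (if b then c else 0) + g < d.
  by move=> /hd; rewrite /g; case: (b); rewrite ?pair0; lra.
have hB' x (Xx : X x) := ltW (hB x Xx).
exists (vfun c g), d; split=> [y [x [t [Xx t0 t1 ->]]]|].
  by apply: frustum_le; rewrite ?vfun_u ?vfun_d //; [exact: hd|exact: hB'].
apply/seteqP; split=> y.
  move=> [x + <-]; rewrite eF => -[Xx /= xd]; rewrite -(frpt0 b).
  split; first exact: frustum_pt.
  apply/frustum_tight; rewrite ?vfun_u ?vfun_d //; [exact: hd|exact: hB'|].
  by split; [right|left].
move=> [[x [t [Xx t0 t1 ->]]] /= /frustum_tight].
rewrite vfun_u vfun_d => /(_ t0 t1 (hd _ Xx) (hB' _ Xx)) [h1 [e|h2]].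
  exists x; last by rewrite e frpt0.
  by rewrite eF; split=> //=; case: h1 => // /one_neq0/(_ e).
by have := hB _ Xx; rewrite h2 ltxx.
Qed.

Lemma frtop_face b X F : is_face X F -> F !=set0 ->
  is_face (frustum b X) (frtop b F).
Proof.
move=> [c [d [hd eF]]] [x0 Fx0].
(* The height gets coefficient 1 and the bound is raised by 1, so no lower end is tight. For a
   pyramid the height alone cuts out the apex. *)
pose c' := if b then c else 0; pose d' := (if b then d else 0) + 1.
have c'E : (if b then c' else 0) = c' by rewrite /c'; case: (b).
have hA x : X x -> x ` c' < d'.
  by move=> /hd; rewrite /c' /d'; case: (b); rewrite ?pair0; lra.
have hA' x (Xx : X x) := ltW (hA x Xx).
have hB x : X x -> x ` (if b then c' else 0) + 1 <= d'.
  by rewrite c'E => /hd; rewrite /c' /d'; case: (b); rewrite ?pair0; lra.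
exists (vfun c' 1), d'; split=> [y [x [t [Xx t0 t1 ->]]]|].
  by apply: frustum_le; rewrite ?vfun_u ?vfun_d //; [exact: hA'|exact: hB].
apply/seteqP; split=> y.
  move=> [x + <-]; rewrite eF => -[Xx /= xd]; split; first exact: frustum_pt.
  apply/frustum_tight; rewrite ?vfun_u ?vfun_d //; [exact: hA'|exact: hB|].
  split; first by left.
  by right; rewrite c'E /c' /d'; case: (b); rewrite ?pair0 ?xd.
move=> [[x [t [Xx t0 t1 ->]]] /= /frustum_tight].
rewrite vfun_u vfun_d => /(_ t0 t1 (hA' _ Xx) (hB _ Xx)) [[e|h2] h]; last first.
  by have := hA _ Xx; rewrite h2 ltxx.
case: h => [/(one_neq0 e)//|].
rewrite c'E /c' /d' e; case: (b) => xd.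
  by exists x => //; rewrite eF; split=> //=; lra.
by exists x0; rewrite // !frpt_apex.
Qed.

Lemma slice_inj h X F : slice h X = slice h F -> X = F.
Proof.
move=> e; apply/seteqP; split=> x Xx.
  have : slice h F (row_mx x h%:M) by rewrite -e; exists x.
  by move=> [y Fy /row_mx_inj[<-]].
have : slice h X (row_mx x h%:M) by rewrite e; exists x.
by move=> [y Fy /row_mx_inj[<-]].
Qed.

Lemma slice_iso h X : lattice_iso X (slice h X) (slice h).
Proof.
split; first split.
- move=> F [c [d [hd ->]]]; exists (vfun c 0), d; split=> [y [x Xx <-]|].
    by rewrite pair_row vfun_u vfun_d mulr0 addr0; exact: hd.
  apply/seteqP; split=> y.
    move=> [x [Xx /= xd] <-]; split; first by exists x.
    by rewrite /= pair_row vfun_u vfun_d mulr0 addr0.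
  move=> [[x Xx <-]] /=; rewrite pair_row vfun_u vfun_d mulr0 addr0 => xd.
  by exists x.
- by move=> F G _ _; exact: slice_inj.
- move=> H [c [d [hd eH]]].
  exists (X `&` [set x | x ` usubmx c = d - h * dsubmx c 0 0]).
    exists (usubmx c), (d - h * dsubmx c 0 0); split=> // x Xx.
    by rewrite lerBrDr -pair_row; apply: hd; exists x.
  rewrite eH; apply/seteqP; split=> y.
    move=> [x [Xx /= xd] <-]; split; first by exists x.
    by rewrite /= pair_row xd subrK.
  move=> [[x Xx <-]] /=; rewrite pair_row => xd.
  by exists x => //; split=> //=; rewrite -xd addrK.
move=> F G _ _; split=> FG x; last by move=> [y /FG Gy <-]; exists y.
move=> Fx; have /FG [y Gy /row_mx_inj[<-]] // : slice h F (row_mx x h%:M).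
by exists x.
Qed.

Lemma frustum0 b X x : frustum b X (row_mx x 0%:M) <-> X x.
Proof.
split=> [[y [t [Xy t0 t1 /row_mx_inj[e e']]]]|Xx].
  by rewrite e -e' /shrink subr0; case: (b); rewrite scale1r.
by rewrite -(frpt0 b); exact: frustum_pt.
Qed.

Lemma frustum_inj b X F : frustum b X = frustum b F -> X = F.
Proof. by move=> e; apply/seteqP; split=> x; rewrite -!(frustum0 b) e. Qed.

Lemma frustum_slice b X F h : X !=set0 -> frustum b X <> slice h F.
Proof.
move=> [x Xx] e.
have := frustum_pt b Xx (lexx 0) ler01; rewrite e => -[y _ /row_mx_inj[_ h0]].
have := frustum_pt b Xx ler01 (lexx 1); rewrite e => -[z _ /row_mx_inj[_ h1]].
by have := oner_eq0 R; rewrite -h1 h0 eqxx.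
Qed.

Lemma frustum_frtop b X F : X !=set0 -> frustum b X <> frtop b F.
Proof.
move=> [x Xx] e.
have := frustum_pt b Xx (lexx 0) ler01; rewrite e => -[y _ /row_mx_inj[_ h0]].
by have := oner_eq0 R; rewrite h0 eqxx.
Qed.

Lemma slice_frtop b X F : X !=set0 -> slice 0 X <> frtop b F.
Proof.
move=> [x Xx] e.
have [y _ /row_mx_inj[_ h0]] : frtop b F (row_mx x 0%:M) by rewrite -e; exists x.
by have := oner_eq0 R; rewrite h0 eqxx.
Qed.

Lemma frpt_conv b h l x y :
  frpt b (l *: x + (1 - l) *: y) h = l *: frpt b x h + (1 - l) *: frpt b y h.
Proof.
rewrite /frpt !scale_row_mx add_row_mx; congr row_mx.
  by rewrite scalerDr !scalerA ![shrink b h * _]mulrC.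
by rewrite !scale_scalar_mx -raddfD /=; congr _%:M; lra.
Qed.

Lemma frpt_segment b x t : frpt b x t = (1 - t) *: frpt b x 0 + t *: frpt b x 1.
Proof.
rewrite /frpt !scale_row_mx add_row_mx; congr row_mx.
  rewrite !scalerA -scalerDl; congr (_ *: _).
  by rewrite /shrink; case: (b); lra.
by rewrite !scale_scalar_mx -raddfD /=; congr _%:M; lra.
Qed.

Lemma frustum_gens b (s : seq 'rV[R]_n) : frustum b (conv_hull [set` s]) =
  conv_hull [set` [seq frpt b v 0 | v <- s] ++ [seq frpt b v 1 | v <- s]].
Proof.
set s' := _ ++ _; apply/seteqP; split=> y.
  move=> [x [t [sx t0 t1 ->]]]; rewrite frpt_segment.
  have frh h : (forall v, v \in s -> frpt b v h \in s') ->
      conv_hull [set` s'] (frpt b x h).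
    move=> hs; move: x sx; apply: conv_hull_ind => [l x z l0 l1 hx hz|v /hs].
      by rewrite frpt_conv; exact: conv_hull_conv.
    exact: conv_hull_mem.
  rewrite -[t in X in _ + X](subKr 1); apply: conv_hull_conv; rewrite ?subr_ge0 //.
  - by rewrite lerBlDr lerDl.
  - by apply: frh => v vs; rewrite mem_cat; apply/orP; left; apply/mapP; exists v.
  - by apply: frh => v vs; rewrite mem_cat; apply/orP; right; apply/mapP; exists v.
apply: conv_hull_ind => [l x z l0 l1|v]; last first.
  rewrite mem_cat => /orP[] /mapP[v' v's ->]; apply: frustum_pt => //;
    exact: conv_hull_mem.
move=> [x' [t [sx t0 t1 ->]]] [z' [t' [sz t'0 t'1 ->]]].
have l1' : 0 <= 1 - l by rewrite subr_ge0.
pose w := l * t + (1 - l) * t'.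
have w0 : 0 <= w by rewrite addr_ge0 // mulr_ge0.
have w1 : w <= 1.
  have : l * t <= l * 1 by rewrite ler_wpM2l.
  have : (1 - l) * t' <= (1 - l) * 1 by rewrite ler_wpM2l.
  by rewrite /w; lra.
have sh0 r : r <= 1 -> 0 <= shrink b r.
  by rewrite /shrink; case: (b) => // r1; rewrite subr_ge0.
pose p := l * shrink b t; pose q := (1 - l) * shrink b t'.
have pq : p + q = shrink b w by rewrite /p /q /w /shrink; case: (b); lra.
have p0 : 0 <= p by rewrite mulr_ge0 // sh0.
have q0 : 0 <= q by rewrite mulr_ge0 // sh0.
have hgt : l *: t%:M + (1 - l) *: t'%:M = w%:M :> 'M[R]_1.
  by rewrite !scale_scalar_mx -raddfD /= /w.
rewrite /frpt !scale_row_mx add_row_mx hgt !scalerA -/p -/q.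
(* Here the combination is the apex, and the weights on the base points cannot be normalised; any
   base point represents it. *)
have [e|ne] := eqVneq (p + q) 0.
  exists x', w; split=> //; rewrite /frpt -pq e scale0r.
  have -> : p = 0 by lra.
  have -> : q = 0 by lra.
  by rewrite !scale0r addr0.
exists ((p / (p + q)) *: x' + (1 - p / (p + q)) *: z'), w; split=> //.
  have pq0 : 0 < p + q by rewrite lt_neqAle eq_sym ne addr_ge0.
  apply: conv_hull_conv => //; first by rewrite divr_ge0 // ltW.
  by rewrite ler_pdivrMr // mul1r lerDl.
rewrite /frpt -pq scalerDr !scalerA; congr (row_mx (_ *: _ + _ *: _) _).
  by rewrite mulrC divfK.
by rewrite mulrBr mulr1 [(p + q) * _]mulrC divfK // addrC addKr.
Qed.

Lemma frustum_polytope b X : is_polytope X -> is_polytope (frustum b X).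
Proof.
move=> [[x Xx] [s eX]]; split.
  by exists (frpt b x 0); exact: frustum_pt.
by rewrite eX frustum_gens; eexists.
Qed.

End Frustum.

(** * Flag numbers *)

Section FrustumPolytope.
Variables (R : realType) (n : nat).
Implicit Types (P F G : polytope R n) (b : bool).

Definition frpoly b P : polytope R (n + 1) :=
  Polytope (frustum_polytope b (polytopeP P)).

Lemma slice_polytope P : is_polytope (slice 0 P).
Proof.
apply: nonempty_face_polytope (polytopeP (frpoly true P)) _ _.
  exact/slice_face/face_refl.
by have [x Px] := polytope_neq0 P; exists (row_mx x 0%:M), x.
Qed.
Definition basepoly P : polytope R (n + 1) := Polytope (slice_polytope P).

Lemma frtop_polytope b P : is_polytope (frtop b P).
Proof.
apply: nonempty_face_polytope (polytopeP (frpoly b P)) _ _.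
  by apply: frtop_face; [exact: face_refl|exact: polytope_neq0].
by have [x Px] := polytope_neq0 P; exists (frpt b x 1), x.
Qed.
Definition toppoly b P : polytope R (n + 1) := Polytope (frtop_polytope b P).

Lemma comb_basepoly P : comb_equiv (AnyPolytope P) (AnyPolytope (basepoly P)).
Proof. exact/lattice_iso_comb/slice_iso. Qed.

Lemma comb_toppoly P : comb_equiv (AnyPolytope P) (AnyPolytope (toppoly true P)).
Proof.
apply: (@lattice_iso_comb _ _ _ _ _ (slice 1)); rewrite /= frtop_prism.
exact: slice_iso.
Qed.

Lemma affine_dim_apex P : affine_dim (toppoly false P) = 0%N.
Proof.
have [x Px] := polytope_neq0 P.
apply/eqP; rewrite -leqn0 -[leqRHS](mxrank0 R (n + 1) (n + 1)).
apply: (@affine_dim_ub _ _ _ (frpt false x 1)); first by exists x.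
by move=> y [z _ <-]; rewrite !frpt_apex subrr sub0mx.
Qed.

Lemma toppoly_apex P F : toppoly false P = toppoly false F.
Proof.
apply: polytope_inj; apply/seteqP; split=> y [x Xx <-].
  by have [z Fz] := polytope_neq0 F; exists z; rewrite ?frpt_apex.
by have [z Fz] := polytope_neq0 P; exists z; rewrite ?frpt_apex.
Qed.

Lemma affine_dim_frpoly b P : affine_dim (frpoly b P) = (affine_dim P).+1.
Proof.
apply/eqP; rewrite eqn_leq; apply/andP; split.
  have [x [A fr]] := affine_frame_ex (polytope_neq0 P); have [Px PA fA] := fr.
  pose N := (row_mx A 0 : 'M[R]_(_, n + 1)).
  (* The direction of the segment over the origin [x] of the frame. It is the only direction to be
     added to those of [P]; that the dimension really grows follows from the base being a proper
     face. *)
  pose w : 'rV[R]_(n + 1) := row_mx ((shrink b 1 - 1) *: x) 1%:M.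
  have h : (affine_dim (frpoly b P) <= \rank (N + w)%MS)%N.
    apply: (@affine_dim_ub _ _ _ (frpt b x 0)); first exact: frustum_pt.
    move=> y [z [t [Pz t0 t1 ->]]].
    have -> : frpt b z t - frpt b x 0 =
        shrink b t *: row_mx (z - x) 0 + t *: w.
      rewrite /frpt /w opp_row_mx !scale_row_mx !add_row_mx; congr row_mx.
        rewrite scalerBr scalerA -addrA; congr (_ + _).
        rewrite -!scaleNr -scalerDl; congr (_ *: _).
        by rewrite /shrink; case: (b); lra.
      rewrite scaler0 add0r scale_scalar_mx mulr1 -[RHS]subr0; congr (_ - _).
      by rewrite raddf0.
    apply: addmx_sub; last by apply: scalemx_sub; exact: addsmxSr.
    apply/scalemx_sub/(submx_trans _ (addsmxSl _ _)).
    have /submxP[D ->] := frame_spans fr Pz.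
    by rewrite -[0](mulmx0 _ D) -mul_mx_row submxMl.
  apply: leq_trans h _; apply: leq_trans (mxrank_adds_leqif _ _) _.
  rewrite -[leqRHS]addn1; apply: leq_add; last exact: rank_leq_row.
  rewrite -[leqRHS](eqP fA) /N -[A in row_mx A _]mulmx1 -[0](mulmx0 _ A) -mul_mx_row.
  exact: mxrankM_maxl.
rewrite (comb_equiv_dim (comb_basepoly P)); apply: face_dim_lt => /=.
- exact/slice_face/face_refl.
- exact: (polytope_neq0 (basepoly P)).
- by apply/nesym/frustum_slice/polytope_neq0.
Qed.

(** In a pyramid all top faces coincide with the apex, which must be listed only once. *)
Definition top_faces b P : seq (polytope R (n + 1)) :=
  if b then map (toppoly true) (faces P) else [:: toppoly false P].

Lemma faces_frpoly b P : perm_eq (faces (frpoly b P))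
  (map (frpoly b) (faces P) ++ map basepoly (faces P) ++ top_faces b P).
Proof.
apply: uniq_perm; first exact: uniq_faces.
  have iF : injective (frpoly b).
    move=> F G /(congr1 (@polytope_set _ _)) /= /frustum_inj; exact: polytope_inj.
  have iB : injective basepoly.
    move=> F G /(congr1 (@polytope_set _ _)) /= /slice_inj; exact: polytope_inj.
  have iT : injective (toppoly true).
    move=> F G /(congr1 (@polytope_set _ _)) /=; rewrite !frtop_prism => /slice_inj.
    exact: polytope_inj.
  rewrite !cat_uniq !map_inj_uniq ?uniq_faces //=; apply/and3P; split.
  - apply/hasPn => G; rewrite mem_cat => hG; apply/negP => /mapP[F _ eF].
    move: hG; rewrite eF => /orP[/mapP[K _]|].
      by move/(congr1 (@polytope_set _ _)); exact/frustum_slice/polytope_neq0.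
    rewrite /top_faces; case: (b); last rewrite inE => /eqP.
      move=> /mapP[K _] /(congr1 (@polytope_set _ _)); exact/frustum_frtop/polytope_neq0.
    by move/(congr1 (@polytope_set _ _)); exact/frustum_frtop/polytope_neq0.
  - apply/hasPn => G hG; apply/negP => /mapP[F _ eF].
    move: hG; rewrite eF /top_faces; case: (b); last rewrite inE => /eqP.
      move=> /mapP[K _] /(congr1 (@polytope_set _ _)); exact/slice_frtop/polytope_neq0.
    by move/(congr1 (@polytope_set _ _)); exact/slice_frtop/polytope_neq0.
  - by rewrite /top_faces; case: (b); rewrite ?map_inj_uniq ?uniq_faces.
move=> G; apply/facesP/idP => [fG|].
  have [F [PF F0 hF]] := frustum_face_cases (polytope_neq0 P) fG (polytope_neq0 G).
  pose F' := Polytope (nonempty_face_polytope (polytopeP P) PF F0).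
  have F'P : F' \in faces P by exact/facesP.
  rewrite !mem_cat; case: hF => eG; apply/or3P.
  - by constructor 1; apply/mapP; exists F' => //; exact: polytope_inj.
  - by constructor 2; apply/mapP; exists F' => //; exact: polytope_inj.
  - constructor 3; rewrite /top_faces; move: eG; case: (b) => eG.
      by apply/mapP; exists F' => //; exact: polytope_inj.
    by rewrite inE (toppoly_apex P F'); apply/eqP; exact: polytope_inj.
rewrite !mem_cat => /or3P[/mapP[F /facesP PF ->]|/mapP[F /facesP PF ->]|].
- by apply: frustum_face PF _; exact: polytope_neq0.
- exact: slice_face.
rewrite /top_faces; case: (b) => [/mapP[F /facesP PF ->]|].
  by apply: frtop_face PF _; exact: polytope_neq0.
rewrite inE => /eqP->; apply: frtop_face; first exact: face_refl.
exact: polytope_neq0.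
Qed.

End FrustumPolytope.

(** * Flag numbers of prisms and pyramids, and faithfulness *)

Section Counting.
Variable R : realType.

Definition point_count : polytope_group R -> int := freeg_lift (fun=> 1).
HB.instance Definition _ := GRing.Additive.on point_count.

(** On a word this counts the flags descending from [P] whose codimension steps are given by the
    letters, read from the right. *)
Definition flag_count n (P : polytope R n) (x : fsum) : int :=
  point_count (ev (face_op R) x (comb_class P)).

Lemma flag_count_is_additive n (P : polytope R n) : zmod_morphism (flag_count P).
Proof. by move=> x y; rewrite /flag_count !raddfB. Qed.
HB.instance Definition _ n (P : polytope R n) :=
  GRing.isZmodMorphism.Build fsum int (flag_count P) (flag_count_is_additive P).

Lemma flag_count_comb n m (P : polytope R n) (Q : polytope R m) x :
  comb_equiv (AnyPolytope P) (AnyPolytope Q) -> flag_count P x = flag_count Q x.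
Proof. by move=> PQ; rewrite /flag_count (comb_class_eq PQ). Qed.

Lemma flag_count_nil n (P : polytope R n) : flag_count P << [::] >> = 1.
Proof. by rewrite /flag_count evU big_nil /= /point_count freeg_liftU. Qed.

Lemma ev_rmulw_class k x n (P : polytope R n) :
  ev (face_op R) (rmulw k x) (comb_class P) =
  \sum_(F <- faces P | (affine_dim F + k == affine_dim P)%N)
    ev (face_op R) x (comb_class F).
Proof.
rewrite ev_rmulw; last exact: face_op0.
rewrite -[LHS]/(ev (face_op R) x (face_op R k (comb_class P))).
by rewrite face_op_class face_sum_faces raddf_sum.
Qed.

Lemma flag_count_rmulw k x n (P : polytope R n) :
  flag_count P (rmulw k x) =
  \sum_(F <- faces P | (affine_dim F + k == affine_dim P)%N) flag_count F x.
Proof. by rewrite /flag_count ev_rmulw_class raddf_sum. Qed.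

Lemma flag_count_rcons u k n (P : polytope R n) :
  flag_count P << rcons u k >> =
  \sum_(F <- faces P | (affine_dim F + k.+1 == affine_dim P)%N) flag_count F << u >>.
Proof. by rewrite -(flag_count_rmulw k.+1) rmulwU. Qed.

Lemma flag_count_big u n (P : polytope R n) :
  (affine_dim P < weight u)%N -> flag_count P << u >> = 0.
Proof.
elim/last_ind: u n P => // u k IH n P; rewrite weight_rcons flag_count_rcons => h.
by rewrite big1 // => F /eqP dF; apply: IH; lia.
Qed.

Definition dim_count (d : nat) : polytope_group R -> int := freeg_lift
  (fun C : comb_polytope R =>
     (affine_dim (any_polytope_body (repr C)) == d)%:R : int).
HB.instance Definition _ d := GRing.Additive.on (dim_count d).

Lemma dim_countU d n (P : polytope R n) :
  dim_count d (comb_class P) = (affine_dim P == d)%:R.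
Proof.
rewrite /dim_count /comb_class freeg_liftU; set C := repr _.
have : comb_equiv (AnyPolytope P) C.
  by rewrite -/(comb_equiv_rel R _ _); apply/eqmodP; rewrite reprK.
by case: C => m Q /comb_equiv_dim ->.
Qed.

Lemma dim_count_word d u n (P : polytope R n) :
  dim_count d (ev (face_op R) << u >> (comb_class P)) =
  if (weight u + d)%N == affine_dim P then flag_count P << u >> else 0.
Proof.
elim/last_ind: u n P => [|u k IH] n P.
  rewrite flag_count_nil evU big_nil /= dim_countU eq_sym.
  by case: (d == _).
rewrite flag_count_rcons -[<< rcons u k >>](rmulwU k.+1) ev_rmulw_class raddf_sum /=.
under eq_bigr do rewrite IH.
rewrite weight_rcons; case: eqP => [e|ne].
  by apply: eq_bigr => F /eqP dF; rewrite ifT //; apply/eqP; lia.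
by rewrite big1 // => F /eqP dF; case: eqP => // e; case: ne; lia.
Qed.

(** A word of degree [k] produces faces of codimension [k], so counting vertices isolates the
    component of degree [affine_dim P]. *)
Lemma dim_count0 x n (P : polytope R n) :
  dim_count 0 (ev (face_op R) x (comb_class P)) =
  flag_count P (wpart (affine_dim P) x).
Proof.
elim/freeg_ind: x => [w|x y ex ey|].
- by rewrite dim_count_word addn0 wpartU; case: ifP; rewrite ?raddf0.
- by rewrite wpartB !raddfB /= ex ey.
- by rewrite !raddf0.
Qed.

(* On words of degree [affine_dim P + 1], the number of flags of the pyramid over
   [P] that end at the apex. *)
Definition apex_count n (P : polytope R n) : fsum -> int :=
  freeg_lift (fun w => if w is a :: u then flag_count P << u >> else 0).
HB.instance Definition _ n (P : polytope R n) := GRing.Additive.on (apex_count P).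

Lemma apex_countU n (P : polytope R n) a u :
  apex_count P << a :: u >> = flag_count P << u >>.
Proof. exact: freeg_liftU. Qed.

Lemma apex_count_lmulw n (P : polytope R n) a x :
  apex_count P (lmulw a.+1 x) = flag_count P x.
Proof.
elim/freeg_ind: x => [w|x y ex ey|].
- by rewrite lmulwU apex_countU.
- by rewrite !raddfB /= ex ey.
- by rewrite !raddf0.
Qed.

Lemma sum_frpoly b n (P : polytope R n) k (f : polytope R (n + 1) -> int) :
  \sum_(G <- faces (frpoly b P) | (affine_dim G + k.+1 == (affine_dim P).+1)%N) f G =
  \sum_(F <- faces P | (affine_dim F + k.+1 == affine_dim P)%N) f (frpoly b F) +
  \sum_(F <- faces P | (affine_dim F + k == affine_dim P)%N) f (basepoly F) +
  if b then \sum_(F <- faces P | (affine_dim F + k == affine_dim P)%N) f (toppoly true F)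
  else if k == affine_dim P then f (toppoly false P) else 0.
Proof.
rewrite (perm_big _ (faces_frpoly b P)) /= !big_cat /= !big_map addrA.
congr (_ + _ + _).
- by apply: eq_bigl => F; rewrite affine_dim_frpoly addSn eqSS.
- apply: eq_bigl => F.
  by rewrite -(comb_equiv_dim (comb_basepoly F)) addnS eqSS.
rewrite /top_faces; case: b.
  rewrite big_map; apply: eq_bigl => F.
  by rewrite -(comb_equiv_dim (comb_toppoly F)) addnS eqSS.
by rewrite big_mkcond big_seq1 affine_dim_apex add0n eqSS.
Qed.

(** A flag of the prism runs through prisms over faces and may switch once to the base or the top.
    At the switch the underlying face drops by one dimension less than the letter says, and [wder]
    sums over the possible positions. *)
Lemma flag_count_prism u n (P : polytope R n) :
  flag_count (frpoly true P) << u >> =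
  flag_count P << u >> + flag_count P (wder u) *+ 2.
Proof.
elim/last_ind: u n P => [|u k IH] n P.
  by rewrite !flag_count_nil raddf0 mul0rn addr0.
rewrite !flag_count_rcons affine_dim_frpoly sum_frpoly.
under eq_bigr do rewrite IH.
under [X in _ + X + _]eq_bigr do rewrite -(flag_count_comb _ (comb_basepoly _)).
under [X in _ + X]eq_bigr do rewrite -(flag_count_comb _ (comb_toppoly _)).
rewrite wder_rcons raddfD /= !flag_count_rmulw big_split -!addrA mulrnDl.
by congr (_ + (_ + _)); rewrite ?sumrMnl // mulr2n.
Qed.

(** As for prisms, but only the base is a copy of [P]. A flag that reaches the apex must end there,
    which fixes the degree of the word. *)
Lemma flag_count_pyramid u n (P : polytope R n) :
  flag_count (frpoly false P) << u >> =
  flag_count P << u >> + flag_count P (wder u) +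
  if weight u == (affine_dim P).+1 then apex_count P << u >> else 0.
Proof.
elim/last_ind: u n P => [|u k IH] n P.
  by rewrite !flag_count_nil raddf0 !addr0.
rewrite !flag_count_rcons affine_dim_frpoly sum_frpoly.
under eq_bigr do rewrite IH.
under [X in _ + X + _]eq_bigr do rewrite -(flag_count_comb _ (comb_basepoly _)).
rewrite wder_rcons raddfD /= !flag_count_rmulw !big_split /= -!addrA.
congr (_ + (_ + _)); rewrite addrCA; congr (_ + _).
case: u {IH} => [|a u] /=.
  rewrite big1 // add0r weight_cons addn0 eqSS apex_countU flag_count_nil.
  by case: ifP => //; rewrite flag_count_nil.
rewrite apex_countU flag_count_rcons.
have -> : (if k == affine_dim P then
    flag_count (toppoly false P) << a :: u >> else 0) = 0.
  by case: ifP => // _; rewrite flag_count_big // affine_dim_apex weight_cons.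
rewrite addr0 -rcons_cons weight_rcons; case: eqP => [e|ne].
  apply: eq_bigr => F /eqP dF; rewrite apex_countU ifT //; apply/eqP; lia.
by rewrite big1 // => F /eqP dF; case: eqP => // e; case: ne; lia.
Qed.

Lemma wpart_ind n (p : fsum -> Prop) : p 0 ->
  (forall x y, p x -> p y -> p (x - y)) ->
  (forall w, weight w = n -> p << w >>) -> forall x, wpart n x = x -> p x.
Proof.
move=> p0 pB pU x <-; elim/freeg_ind: x => [w|x y px py|].
- by rewrite wpartU; case: eqP => // /pU.
- by rewrite wpartB; exact: pB.
- by rewrite raddf0.
Qed.

Lemma apex_count_prism n (P : polytope R n) x : wpart (affine_dim P).+2 x = x ->
  apex_count (frpoly true P) x = apex_count P (der x) *+ 2 - apex_count P (peel x).
Proof.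
move: x; apply: wpart_ind => [|x y ex ey|w].
- by rewrite !raddf0 mul0rn.
- by rewrite !raddfB /= ex ey mulrnBl !opprD !opprK addrACA.
case: w => [//|[|a] u]; rewrite weight_cons => e.
(* For a leading [d_1] the rest [u] is too long to have flags in [P]. However, [der] also contains
   [u] itself, and the factor 2 in [wpeel] cancels its doubled apex count. *)
- rewrite derU peelU /= raddfMn raddfD /= apex_count_lmulw [LHS]apex_countU.
  rewrite flag_count_prism flag_count_big; last by lia.
  by rewrite add0r mulrnDl addrAC subrr add0r.
- rewrite derU peelU /= !raddfD /= apex_count_lmulw !apex_countU.
  by rewrite flag_count_prism mulrnDl mulr2n addrAC addrK.
Qed.

Lemma apex_count_pyramid n (P : polytope R n) x : wpart (affine_dim P).+2 x = x ->
  apex_count (frpoly false P) x = apex_count P (der x).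
Proof.
move: x; apply: wpart_ind => [|x y ex ey|w].
- by rewrite !raddf0.
- by rewrite !raddfB /= ex ey.
case: w => [//|[|a] u]; rewrite weight_cons => e.
- rewrite derU /= !raddfD /= apex_count_lmulw apex_countU.
  rewrite flag_count_pyramid flag_count_big; last by lia.
  by rewrite ifT ?add0r 1?addrC //; apply/eqP; lia.
- rewrite derU /= !raddfD /= apex_count_lmulw !apex_countU.
  by rewrite flag_count_pyramid ifF ?addr0 //; apply/eqP; lia.
Qed.

Lemma face_op_family : euler_family (face_op R).
Proof. by split=> [|n]; [exact: face_op0|exact: face_op_euler]. Qed.

Lemma flag_count_pyramid_hom n (P : polytope R n) x : wpart (affine_dim P).+1 x = x ->
  flag_count (frpoly false P) x = flag_count P (der x) + apex_count P x.
Proof.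
move: x; apply: wpart_ind => [|x y ex ey|w wP].
- by rewrite !raddf0 addr0.
- by rewrite !raddfB /= ex ey opprD addrACA.
rewrite flag_count_pyramid derU wP eqxx flag_count_big ?wP //.
by rewrite add0r.
Qed.

Lemma flag_count_prism_hom n (P : polytope R n) x : wpart (affine_dim P).+1 x = x ->
  flag_count (frpoly true P) x = flag_count P (der x) *+ 2.
Proof.
move: x; apply: wpart_ind => [|x y ex ey|w wP].
- by rewrite !raddf0 mul0rn.
- by rewrite !raddfB /= ex ey mulrnBl.
by rewrite flag_count_prism derU flag_count_big ?wP // add0r.
Qed.

Lemma point_polytope : exists P : polytope R 0, affine_dim P = 0%N.
Proof.
have pP : is_polytope (conv_hull [set` [:: 0 : 'rV[R]_0]]).
  split; last by eexists.
  by exists 0; apply: conv_hull_mem; rewrite mem_head.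
exists (Polytope pP); apply/eqP; rewrite -leqn0 -[leqRHS](mxrank0 R 0 0).
apply: (@affine_dim_ub _ _ _ 0); first by apply: conv_hull_mem; rewrite mem_head.
by move=> y _; rewrite [_ - _]thinmx0 sub0mx.
Qed.

Definition apex_annihilated (n : nat) (x : fsum) : Prop :=
  forall d (P : polytope R d), affine_dim P = n -> apex_count P x = 0.

Lemma apex_annihilated_null n x :
  wpart n.+1 x = x -> apex_annihilated n x -> euler_null x.
Proof.
have [pt dpt] := point_polytope.
move: n x; apply: annihilator_null => [n x y hx hy|n x hx nx|n x hx hN|n x hx hN|x hx hN]
  d P dP.
- by rewrite raddfB /= hx // hy // subrr.
(* Flag numbers vanish on null sums because the face operators form an Euler family; the pyramid
   identity transfers this to the apex count. *)
- have := @flag_count_pyramid_hom _ P x; rewrite dP => /(_ hx).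
  rewrite /flag_count (nx _ _ face_op_family) (null_der nx face_op_family) /=.
  by rewrite raddf0 add0r.
- rewrite -apex_count_pyramid ?dP //; apply: hN.
  by rewrite affine_dim_frpoly dP.
- have := @apex_count_prism _ P x; rewrite dP => /(_ hx).
  rewrite -apex_count_pyramid ?dP // !hN ?affine_dim_frpoly ?dP //.
  by rewrite mul0rn sub0r => /eqP; rewrite eq_sym oppr_eq0 => /eqP.
have [c ex] := wpart1 x; move: hN; rewrite -hx ex => hN.
have := hN _ pt dpt; rewrite raddfMz /= apex_countU flag_count_nil => hc.
have -> : c = 0 by rewrite -hc -mulrzl mulr1 intz.
by rewrite raddfMz /= mulr0z.
Qed.

(** Degree by degree: the prism over [P] gives twice the flag number of the derivative, which must
    therefore vanish, and the pyramid then leaves just the apex count. *)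
Theorem face_op_faithful x : ev (face_op R) x = 0 -> euler_null x.
Proof.
move=> ex; have [N ->] := sum_hom x; apply: null_sum => -[n /= _] _.
have z d (P : polytope R d) : affine_dim P = n -> flag_count P (wpart n x) = 0.
  by move=> dP; rewrite -dP -dim_count0 ex /= raddf0.
case: n z => [|n] z.
  have [pt dpt] := point_polytope.
  have := z _ pt dpt; have [c ->] := wpart0 x.
  rewrite raddfMz /= flag_count_nil => hc.
  have -> : c = 0 by rewrite -hc -mulrzl mulr1 intz.
  by rewrite mulr0z; exact: null0.
apply: (@apex_annihilated_null n); first by rewrite wpart_id eqxx.
move=> d P dP.
have hx : wpart (affine_dim P).+1 (wpart n.+1 x) = wpart n.+1 x.
  by rewrite wpart_id dP eqxx.
have zb b : flag_count (frpoly b P) (wpart n.+1 x) = 0.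
  by apply: z; rewrite affine_dim_frpoly dP.
have /eqP := flag_count_prism_hom hx; rewrite zb eq_sym mulrn_eq0 /= => /eqP e.
by have := flag_count_pyramid_hom hx; rewrite zb e add0r.
Qed.

End Counting.

(** * Presentation of the ring of face operators *)

Section Convolution.

Lemma sum_assoc (V : nmodType) n (F : nat -> nat -> nat -> V) :
  \sum_(m < n.+1) \sum_(i < m.+1) F i (m - i)%N (n - m)%N =
  \sum_(i < n.+1) \sum_(j < (n - i).+1) F i j (n - i - j)%N.
Proof.
rewrite -(big_mkord xpredT (fun m => \sum_(i < m.+1) F i (m - i)%N (n - m)%N)).
transitivity (\sum_(0 <= m < n.+1) \sum_(0 <= i < n.+1 | (i < m.+1)%N)
    F i (m - i)%N (n - m)%N).
  apply: eq_big_nat => m /andP[_ mn].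
  rewrite -(big_mkord xpredT (fun i => F i (m - i)%N (n - m)%N)).
  by rewrite (big_nat_widen _ _ n.+1).
rewrite (exchange_big_dep xpredT) //=.
rewrite -(big_mkord xpredT (fun i => \sum_(j < (n - i).+1) F i j (n - i - j)%N)).
apply: eq_big_nat => i /andP[_ ni].
rewrite -(big_mkord xpredT (fun j => F i j (n - i - j)%N)).
transitivity (\sum_(i <= m < n.+1) F i (m - i)%N (n - m)%N).
  by rewrite [RHS](big_nat_widenl _ 0).
rewrite -{1}[i]add0n big_addn subSn //; apply: eq_big_nat => j _.
by rewrite addnK subnDA subnAC.
Qed.

Variable B : pzRingType.
Implicit Types f g h : nat -> B.

Definition cauchy f g (n : nat) : B := \sum_(i < n.+1) f i * g (n - i)%N.
Definition alternate f (n : nat) : B := (-1) ^+ n * f n.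
Definition delta0 (n : nat) : B := (n == 0%N)%:R.

Lemma cauchyA f g h : cauchy f (cauchy g h) = cauchy (cauchy f g) h.
Proof.
apply/funext => n; rewrite /cauchy.
under eq_bigr do rewrite mulr_sumr.
under [RHS]eq_bigr do rewrite mulr_suml.
rewrite (sum_assoc n (fun i j k => f i * g j * h k)).
by apply: eq_bigr => i _; apply: eq_bigr => j _; rewrite mulrA.
Qed.

Lemma cauchyC f g : (forall i j, f i * g j = g j * f i) -> cauchy f g = cauchy g f.
Proof.
move=> fg; apply/funext => n; rewrite /cauchy (reindex_inj rev_ord_inj) /=.
by apply: eq_bigr => i _; rewrite subSS subKn -1?ltnS // fg.
Qed.

Lemma cauchy_delta0 f : cauchy f delta0 = f.
Proof.
apply/funext => n; rewrite /cauchy big_ord_recr /= subnn mulr1 big1 ?add0r //.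
by move=> i _; rewrite /delta0 subn_eq0 leqNgt ltn_ord mulr0.
Qed.

Lemma alternate_cauchy f g :
  alternate (cauchy f g) = cauchy (alternate f) (alternate g).
Proof.
apply/funext => n; rewrite /alternate /cauchy mulr_sumr; apply: eq_bigr => i _.
rewrite -{1}[n](@subnKC i) -1?ltnS // exprD -!mulrA; congr (_ * _).
by rewrite [RHS]mulrA (commr_sign (f i)) -mulrA.
Qed.

(** For the generating series [h(t)] the relations read [h(-t) h(t) = 1], with [alternate] as the
    substitution of [-t]. *)
Lemma euler_familyE h : euler_family h <-> h 0%N = 1 /\ cauchy (alternate h) h = delta0.
Proof.
split=> -[h0 hh]; split=> //.
  apply/funext => -[|n]; last exact: hh.
  by rewrite /cauchy big_ord1 /alternate expr0 mul1r h0 mulr1.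
by move=> n n0; have := congr1 (@^~ n) hh; rewrite /cauchy /= => ->;
  rewrite /delta0 gtn_eqF.
Qed.

End Convolution.

Lemma tensor_ext (A B M : zmodType) (F G : {additive tensor A B -> M}) :
  (forall a b, F (a ⊗ b) = G (a ⊗ b)) -> F =1 G.
Proof.
move=> FG; apply: tensor_ind => [|//|x y ex ey]; first by rewrite !raddf0.
by rewrite !raddfD ex ey.
Qed.

Lemma biadditive_tmap (A B A' B' : zmodType) (f : {additive A -> A'})
  (g : {additive B -> B'}) : biadditive (fun a b => f a ⊗ g b).
Proof.
have [hl hr] := biadditive_tens A' B'.
by split=> c x y; rewrite raddfB ?hl ?hr.
Qed.

HB.instance Definition _ (A B A' B' : zmodType) (f : {additive A -> A'})
    (g : {additive B -> B'}) :=
  GRing.isZmodMorphism.Build (tensor A B) (tensor A' B') (tmap f g)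
    (tlift_is_additive (biadditive_tmap f g)).

Lemma tensBl (A B : zmodType) (x y : A) (b : B) : (x - y) ⊗ b = x ⊗ b - y ⊗ b.
Proof. by have [h _] := biadditive_tens A B; exact: h. Qed.
Lemma tensBr (A B : zmodType) (a : A) (x y : B) : a ⊗ (x - y) = a ⊗ x - a ⊗ y.
Proof. by have [_ h] := biadditive_tens A B; exact: h. Qed.

HB.instance Definition _ (A B : zmodType) (a : A) :=
  GRing.isZmodMorphism.Build B (tensor A B) (tens a) (fun x y => tensBr a x y).
Lemma tens0l (A B : zmodType) (b : B) : (0 : A) ⊗ b = 0.
Proof. by rewrite -(subrr 0) tensBl subrr. Qed.
Lemma tensDl (A B : zmodType) (x y : A) (b : B) : (x + y) ⊗ b = x ⊗ b + y ⊗ b.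
Proof. by rewrite -{1}[y]opprK tensBl -sub0r tensBl tens0l sub0r opprK. Qed.

Lemma tens_suml (A B : zmodType) (I : finType) (F : I -> A) (b : B) :
  (\sum_i F i) ⊗ b = \sum_i F i ⊗ b.
Proof.
apply: (big_morph (tens^~ b)) => [x y|]; [exact: tensDl|exact: tens0l].
Qed.
Lemma tens_sumr (A B : zmodType) (I : finType) (F : I -> B) (a : A) :
  a ⊗ (\sum_i F i) = \sum_i a ⊗ F i.
Proof. exact: raddf_sum. Qed.

Lemma tassoc_is_additive (A B C : zmodType) : zmod_morphism (@tassoc A B C).
Proof.
apply: tlift_is_additive; split=> [c|x c1 c2].
  exact/tlift_is_additive/biadditive_tens3.
elim/tensor_ind: x => [|a b|x y IHx IHy].
- by rewrite !(tlift0 (biadditive_tens3 _ _ _)) subrr.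
- by rewrite !(tlift_tens _ _ (biadditive_tens3 _ _ _)) !tensBr.
- by rewrite !(tliftD _ _ (biadditive_tens3 _ _ _)) IHx IHy opprD addrACA.
Qed.
HB.instance Definition _ (A B C : zmodType) := GRing.isZmodMorphism.Build
  (tensor (tensor A B) C) (tensor A (tensor B C)) (@tassoc A B C)
  (@tassoc_is_additive A B C).

Lemma tunitl_is_additive (A : zmodType) : zmod_morphism (@tunitl A).
Proof.
by apply: tlift_is_additive; split=> c x y; rewrite /= ?mulrzBr ?mulrzBl.
Qed.
HB.instance Definition _ (A : zmodType) := GRing.isZmodMorphism.Build
  (tensor int A) A (@tunitl A) (@tunitl_is_additive A).

Lemma tunitr_is_additive (A : zmodType) : zmod_morphism (@tunitr A).
Proof.
by apply: tlift_is_additive; split=> c x y; rewrite /= ?mulrzBr ?mulrzBl.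
Qed.
HB.instance Definition _ (A : zmodType) := GRing.isZmodMorphism.Build
  (tensor A int) A (@tunitr A) (@tunitr_is_additive A).

Lemma tmult_is_additive (A : pzRingType) : zmod_morphism (@tmult A).
Proof.
by apply: tlift_is_additive; split=> c x y; rewrite /= ?mulrBl ?mulrBr.
Qed.
HB.instance Definition _ (A : pzRingType) := GRing.isZmodMorphism.Build
  (tensor A A) A (@tmult A) (@tmult_is_additive A).

Section Multiplicative.
Variables A B A' B' C : pzRingType.

Lemma tmapM (f : {rmorphism A -> A'}) (g : {rmorphism B -> B'}) x y :
  tmap f g (x * y) = tmap f g x * tmap f g y.
Proof.
elim/tensor_ind: x => [|a b|x x' ex ex'].
- by rewrite mul0r !raddf0 mul0r.
- elim/tensor_ind: y => [|a' b'|y y' ey ey'].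
  + by rewrite mulr0 !raddf0 mulr0.
  + by rewrite tensM !tmapE /= tensM !rmorphM.
  + by rewrite mulrDr !raddfD /= ey ey' mulrDr.
- by rewrite mulrDl !raddfD /= ex ex' mulrDl.
Qed.

Lemma tassocM (x y : tensor (tensor A B) C) : tassoc (x * y) = tassoc x * tassoc y.
Proof.
elim/tensor_ind: x => [|x c|x x' ex ex'].
- by rewrite mul0r !raddf0 mul0r.
- elim/tensor_ind: y => [|y c'|y y' ey ey'].
  + by rewrite mulr0 !raddf0 mulr0.
  + elim/tensor_ind: x => [|a b|x x' ex ex'].
    * by rewrite tens0l mul0r raddf0 mul0r.
    * elim/tensor_ind: y => [|a' b'|y y' ey ey'].
      - by rewrite tens0l mulr0 raddf0 mulr0.
      - by rewrite !tensM !tassocE !tensM.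
      - by rewrite tensDl mulrDr !raddfD /= ey ey' mulrDr.
    * by rewrite tensDl mulrDl !raddfD /= ex ex' mulrDl.
  + by rewrite mulrDr !raddfD /= ey ey' mulrDr.
- by rewrite mulrDl !raddfD /= ex ex' mulrDl.
Qed.

Lemma tunitlM (x y : tensor int A) : tunitl (x * y) = tunitl x * tunitl y.
Proof.
elim/tensor_ind: x => [|a b|x x' ex ex'].
- by rewrite mul0r !raddf0 mul0r.
- elim/tensor_ind: y => [|a' b'|y y' ey ey'].
  + by rewrite mulr0 !raddf0 mulr0.
  + by rewrite tensM !tunitlE mulrzAl mulrzAr -mulrzA mulrC.
  + by rewrite mulrDr !raddfD /= ey ey' mulrDr.
- by rewrite mulrDl !raddfD /= ex ex' mulrDl.
Qed.

Lemma tunitrM (x y : tensor A int) : tunitr (x * y) = tunitr x * tunitr y.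
Proof.
elim/tensor_ind: x => [|a b|x x' ex ex'].
- by rewrite mul0r !raddf0 mul0r.
- elim/tensor_ind: y => [|a' b'|y y' ey ey'].
  + by rewrite mulr0 !raddf0 mulr0.
  + by rewrite tensM !tunitrE mulrzAl mulrzAr -mulrzA mulrC.
  + by rewrite mulrDr !raddfD /= ey ey' mulrDr.
- by rewrite mulrDl !raddfD /= ex ex' mulrDl.
Qed.

End Multiplicative.

Lemma rmorph_ev (A B : pzRingType) (f : {rmorphism A -> B}) h x :
  f (ev h x) = ev (f \o h) x.
Proof.
elim/freeg_ind: x => [w|x y ex ey|].
- by rewrite !evU rmorph_prod.
- by rewrite !raddfB /= ex ey.
- by rewrite !raddf0.
Qed.

Lemma ev_generated (A : pzRingType) (h : nat -> A) x :
  subring_generated [set h i | i in [set i | (0 < i)%N]] (ev h x).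
Proof.
set G := [set h i | i in _].
suff : ev h x \in in_subring_generated G by rewrite inE.
elim/freeg_ind: x => [w|x y ex ey|].
- rewrite evU; apply: rpred_prod => k _; rewrite inE.
  by apply: sub_gen_smallest; exists k.+1.
- by rewrite raddfB; exact: rpredB.
- by rewrite raddf0; exact: rpred0.
Qed.

Lemma generated_ev (A : pzRingType) (h : nat -> A) y :
  subring_generated [set h i | i in [set i | (0 < i)%N]] y -> exists x, ev h x = y.
Proof.
move=> hy; apply: (hy [set y | exists x, ev h x = y]); split.
  split=> [|a b|a b]; rewrite !inE /=.
  - by exists << [::] >>; rewrite evU big_nil.
  - by move=> [x <-] [z <-]; exists (x - z); rewrite raddfB.
  - by move=> [x <-] [z <-]; exists (fmul x z); rewrite ev_fmul.
move=> _ [[|i] // _ <-]; exists << [:: i] >>.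
by rewrite evU big_seq1.
Qed.

Section Presentation.
Variable R : realType.

Lemma val_ev x : gen_subring_val (ev (face_gen R) x) = ev (face_op R) x.
Proof. exact: (rmorph_ev (\val : {rmorphism face_alg R -> _})). Qed.

Lemma face_gen0 : face_gen R 0 = 1.
Proof. by apply: val_inj; exact: face_op0. Qed.

Lemma face_gen_family : euler_family (face_gen R).
Proof.
split=> [|n n0]; first exact: face_gen0.
pose v : {rmorphism face_alg R -> endo (polytope_group R)} := \val.
apply: val_inj; rewrite -[RHS](face_op_euler R n0) -/(v _) (rmorph_sum v).
by apply: eq_bigr => i _; rewrite 2!(rmorphM v) (rmorph_sign v).
Qed.

Lemma face_alg_ev (y : face_alg R) : exists x, ev (face_gen R) x = y.
Proof.
have := gen_subring_valP y; rewrite inE => /generated_ev[x ex].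
by exists x; apply: val_inj; apply: etrans ex; exact: val_ev.
Qed.

Lemma face_alg_ind (P : face_alg R -> Prop) : P 1 ->
  (forall x y, P x -> P y -> P (x - y)) -> (forall x y, P x -> P y -> P (x * y)) ->
  (forall i, P (face_gen R i)) -> forall x, P x.
Proof.
move=> P1 PB PM PG y; have [x <-] := face_alg_ev y.
elim/freeg_ind: x => [w|x z ex ez|].
- by rewrite evU; elim/big_ind: _.
- by rewrite raddfB; exact: PB.
- by rewrite raddf0 -(subrr 1); exact: PB.
Qed.

Lemma face_gen_faithful x : ev (face_gen R) x = 0 -> euler_null x.
Proof. by move=> ex; apply: (@face_op_faithful R); rewrite -val_ev ex. Qed.

Section Lift.
Variables (B : pzRingType) (h : nat -> B) (hh : euler_family h).

(* [hh] is a phantom argument on which the ring morphism structure is keyed. *)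
Definition face_lift (y : face_alg R) : B :=
  let _ := hh in ev h (projT1 (cid (face_alg_ev y))).

(** Faithfulness enters here: two preimages of the same operator differ by a null sum, so the chosen
    one is immaterial. *)
Lemma face_lift_ev x : face_lift (ev (face_gen R) x) = ev h x.
Proof.
rewrite /face_lift; case: cid => z /= ez; apply/eqP; rewrite -subr_eq0 -raddfB.
by apply/eqP/(face_gen_faithful _ hh); rewrite raddfB /= ez subrr.
Qed.

Lemma face_lift_is_additive : zmod_morphism face_lift.
Proof.
move=> y z; have [x <-] := face_alg_ev y; have [t <-] := face_alg_ev z.
by rewrite -raddfB !face_lift_ev raddfB.
Qed.

Lemma face_lift_is_multiplicative : monoid_morphism face_lift.
Proof.
split=> [|y z].
  have -> : 1 = ev (face_gen R) << [::] >> by rewrite evU big_nil.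
  by rewrite face_lift_ev evU big_nil.
have [x <-] := face_alg_ev y; have [t <-] := face_alg_ev z.
by rewrite -ev_fmul !face_lift_ev ev_fmul.
Qed.

HB.instance Definition _ :=
  GRing.isZmodMorphism.Build (face_alg R) B face_lift face_lift_is_additive.
HB.instance Definition _ :=
  GRing.isMonoidMorphism.Build (face_alg R) B face_lift face_lift_is_multiplicative.

Lemma face_lift_gen i : face_lift (face_gen R i) = h i.
Proof.
case: i => [|i]; first by rewrite face_gen0 rmorph1; case: hh.
have -> : face_gen R i.+1 = ev (face_gen R) << [:: i] >> by rewrite evU big_seq1.
by rewrite face_lift_ev evU big_seq1.
Qed.

End Lift.
End Presentation.

(** * Hopf algebras *)

Section TensorEmbeddings.
Variables B C : pzRingType.

Definition tinl (x : B) : tensor B C := x ⊗ 1.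
Definition tinr (y : C) : tensor B C := 1 ⊗ y.

Lemma tinl_is_additive : zmod_morphism tinl.
Proof. by move=> x y; exact: tensBl. Qed.
Lemma tinr_is_additive : zmod_morphism tinr.
Proof. by move=> x y; exact: tensBr. Qed.
Lemma tinl_is_multiplicative : monoid_morphism tinl.
Proof. by split=> // x y; rewrite /tinl tensM mulr1. Qed.
Lemma tinr_is_multiplicative : monoid_morphism tinr.
Proof. by split=> // x y; rewrite /tinr tensM mulr1. Qed.

HB.instance Definition _ :=
  GRing.isZmodMorphism.Build B (tensor B C) tinl tinl_is_additive.
HB.instance Definition _ :=
  GRing.isMonoidMorphism.Build B (tensor B C) tinl tinl_is_multiplicative.
HB.instance Definition _ :=
  GRing.isZmodMorphism.Build C (tensor B C) tinr tinr_is_additive.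
HB.instance Definition _ :=
  GRing.isMonoidMorphism.Build C (tensor B C) tinr tinr_is_multiplicative.

Lemma tens11 : 1 = 1 ⊗ 1 :> tensor B C.
Proof. by []. Qed.

Lemma tinlr x y : tinl x * tinr y = x ⊗ y.
Proof. by rewrite /tinl /tinr tensM mulr1 mul1r. Qed.

Lemma tinrl x y : tinr y * tinl x = tinl x * tinr y.
Proof. by rewrite /tinl /tinr !tensM !mulr1 !mul1r. Qed.

End TensorEmbeddings.

Section FamilyConstructions.

Lemma rmorph_euler (A B : pzRingType) (f : {rmorphism A -> B}) h :
  cauchy (alternate h) h = delta0 A ->
  cauchy (alternate (f \o h)) (f \o h) = delta0 B.
Proof.
move=> hh; apply/funext => n; transitivity (f (delta0 A n)); last exact: rmorph_nat.
rewrite -hh rmorph_sum; apply: eq_bigr => i _.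
by rewrite rmorphM /alternate rmorphM rmorph_sign.
Qed.

Definition tensor_seq (B C : pzRingType) (h : nat -> B) (h' : nat -> C) n :
  tensor B C := \sum_(i < n.+1) h i ⊗ h' (n - i)%N.

(* [tensor_seq h h'] is the Cauchy product of [h ⊗ 1] and [1 ⊗ h'], which commute. *)
Lemma tensor_family (B C : pzRingType) (h : nat -> B) (h' : nat -> C) :
  euler_family h -> euler_family h' -> euler_family (tensor_seq h h').
Proof.
move=> /euler_familyE[h0 hh] /euler_familyE[h'0 hh']; apply/euler_familyE.
pose a : nat -> tensor B C := @tinl B C \o h.
pose b : nat -> tensor B C := @tinr B C \o h'.
have -> : tensor_seq h h' = cauchy a b.
  by apply/funext => n; apply: eq_bigr => i _; rewrite /a /b /= tinlr.
split; first by rewrite /cauchy big_ord1 /a /b /= h0 h'0 !rmorph1 mulr1.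
(* As series, [a(-t) b(-t) a(t) b(t)]: exchanging the two middle factors leaves
   [a(-t) a(t) b(-t) b(t) = 1]. *)
rewrite alternate_cauchy -cauchyA [X in cauchy _ X]cauchyA.
rewrite [X in cauchy _ (cauchy X _)]cauchyC; last first.
  move=> i j; rewrite /alternate /b /= -(rmorph_sign (@tinr B C)) -(rmorphM (@tinr B C)).
  exact: tinrl.
rewrite -[X in cauchy _ X]cauchyA (rmorph_euler (@tinr B C) hh') cauchy_delta0.
exact: (rmorph_euler (@tinl B C) hh).
Qed.

Definition unit_seq (n : nat) : int := (n == 0%N)%:R.

Lemma unit_family : euler_family unit_seq.
Proof.
split=> // n n0; rewrite big1 // => i _; rewrite /unit_seq.
have [->|i0] := eqVneq (i : nat) 0%N; last by rewrite mulr0 mul0r.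
by rewrite subn0 gtn_eqF ?mulr0.
Qed.

Lemma sign_sub (B : pzRingType) n i : (i <= n)%N ->
  (-1) ^+ n * (-1) ^+ i = (-1) ^+ (n - i) :> B.
Proof.
move=> le_in; rewrite -{1}(subnK le_in) exprD -mulrA -exprD addnn.
by rewrite -[X in _ * X]signr_odd odd_double mulr1.
Qed.

Lemma sign_antipode_sum (B : pzRingType) (h : nat -> B) n : euler_family h ->
  \sum_(i < n.+1) h i * ((-1) ^+ (n - i) * h (n - i)%N) = (n == 0%N)%:R.
Proof.
move=> hh; have /euler_familyE[_ e] := hh.
have := congr1 (fun f : nat -> B => (-1) ^+ n * f n) e.
rewrite /delta0 /cauchy mulr_sumr => e'.
transitivity ((-1) ^+ n * (n == 0%N)%:R : B); last first.
  by case: eqP => [->|_]; rewrite ?mulr1 ?mulr0.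
rewrite -e'; apply: eq_bigr => i _; rewrite /alternate.
by rewrite !mulrA sign_sub -1?ltnS // -(commr_sign (h i)).
Qed.

Lemma converse_sign (B : pzRingType) n : (-1 : B) ^+ n = (-1 : B^c) ^+ n.
Proof. by elim: n => // n IH; rewrite exprSr [RHS]exprS IH. Qed.

(** Provides the antipode: reversing the order of factors in the relations for [h] yields those for
    [alternate h] in the opposite ring. *)
Lemma sign_family (B : pzRingType) (h : nat -> B) : euler_family h ->
  euler_family (alternate h : nat -> B^c).
Proof.
move=> [h0 hh]; split=> [|n n0]; first by rewrite /alternate expr0 mul1r.
rewrite -[RHS](hh n n0) [RHS](reindex_inj rev_ord_inj) /=; apply: eq_bigr => i _.
rewrite subSS subKn -1?ltnS //.
transitivity (alternate h (n - i)%N * (alternate h i * ((-1 : B^c) ^+ i : B))).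
  by [].
rewrite -(converse_sign B i); congr (_ * _).
by rewrite /alternate -mulrA commr_sign mulrA -expr2 sqrr_sign mul1r.
Qed.

End FamilyConstructions.

(** * Hopf algebra axioms, checked on generators *)

Section FaceHopf.
Variable R : realType.
Local Notation D := (face_alg R).
Local Notation d := (face_gen R).

Variables (face_comul : {rmorphism D -> tensor D D})
  (face_counit : {rmorphism D -> int}) (face_antipode : {additive D -> D}).
Hypotheses
  (face_comul_gen : forall n, face_comul (d n) = \sum_(i < n.+1) d i ⊗ d (n - i)%N)
  (face_counit_gen : forall n, face_counit (d n) = (n == 0%N)%:R)
  (face_antipode_gen : forall n, face_antipode (d n) = (-1) ^+ n * d n)
  (face_antipodeM : forall x y,
     face_antipode (x * y) = face_antipode y * face_antipode x)
  (face_antipode1 : face_antipode 1 = 1).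

Lemma face_coassoc x : tassoc (tmap face_comul idfun (face_comul x)) =
  tmap idfun face_comul (face_comul x).
Proof.
have El a b : tmap face_comul idfun (a ⊗ b) = face_comul a ⊗ b by exact: tmapE.
have Er a b : tmap idfun face_comul (a ⊗ b) = a ⊗ face_comul b by exact: tmapE.
elim/face_alg_ind: x => [|x y ex ey|x y ex ey|n].
- by rewrite rmorph1 tens11 El Er rmorph1 tens11 tassocE.
- by rewrite !raddfB /= ex ey.
- by rewrite rmorphM !tmapM tassocM ex ey.
rewrite face_comul_gen (raddf_sum (tmap face_comul idfun)) /=.
rewrite (raddf_sum (@tassoc D D D)) /= (raddf_sum (tmap idfun face_comul)) /=.
transitivity (\sum_(m < n.+1) \sum_(i < m.+1) d i ⊗ (d (m - i)%N ⊗ d (n - m)%N)).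
  apply: eq_bigr => m _; rewrite El face_comul_gen tens_suml.
  by rewrite (raddf_sum (@tassoc D D D)) /=; apply: eq_bigr => i _; exact: tassocE.
rewrite (sum_assoc n (fun i j k => d i ⊗ (d j ⊗ d k))).
by apply: eq_bigr => i _; rewrite Er face_comul_gen tens_sumr.
Qed.

Lemma face_counit_l x : tunitl (tmap face_counit idfun (face_comul x)) = x.
Proof.
have El a b : tunitl (tmap face_counit idfun (a ⊗ b)) = b *~ face_counit a.
  by rewrite tmapE tunitlE.
elim/face_alg_ind: x => [|x y ex ey|x y ex ey|n].
- by rewrite rmorph1 tens11 El rmorph1.
- by rewrite !raddfB /= ex ey.
- by rewrite rmorphM tmapM tunitlM ex ey.
rewrite face_comul_gen (raddf_sum (tmap face_counit idfun)) /= (raddf_sum (@tunitl D)) /=.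
rewrite big_ord_recl /= big1 => [|i _]; rewrite El face_counit_gen.
  by rewrite subn0 addr0.
by rewrite mulr0z.
Qed.

Lemma face_counit_r x : tunitr (tmap idfun face_counit (face_comul x)) = x.
Proof.
have Er a b : tunitr (tmap idfun face_counit (a ⊗ b)) = a *~ face_counit b.
  by rewrite tmapE tunitrE.
elim/face_alg_ind: x => [|x y ex ey|x y ex ey|n].
- by rewrite rmorph1 tens11 Er rmorph1.
- by rewrite !raddfB /= ex ey.
- by rewrite rmorphM tmapM tunitrM ex ey.
rewrite face_comul_gen (raddf_sum (tmap idfun face_counit)) /= (raddf_sum (@tunitr D)) /=.
rewrite big_ord_recr /= big1 => [|i _]; rewrite Er face_counit_gen.
  by rewrite subnn add0r.
by rewrite subn_eq0 leqNgt ltn_ord mulr0z.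
Qed.

Let antipode_sum n : \sum_(i < n.+1) face_antipode (d i) * d (n - i)%N =
  (face_counit (d n))%:~R.
Proof.
rewrite face_counit_gen.
have /euler_familyE[_ e] := face_gen_family R.
have := congr1 (@^~ n) e; rewrite /delta0 /cauchy /= => {}e.
transitivity ((n == 0%N)%:R : D); last by case: eqP.
by rewrite -e; apply: eq_bigr => i _; rewrite face_antipode_gen.
Qed.

Lemma face_antipode_l x :
  tmult (tmap face_antipode idfun (face_comul x)) = (face_counit x)%:~R.
Proof.
have El a b : tmult (tmap face_antipode idfun (a ⊗ b)) = face_antipode a * b.
  by rewrite tmapE tmultE.
elim/face_alg_ind: x => [|x y ex ey|x y ex ey|n].
- by rewrite !rmorph1 tens11 El face_antipode1 mulr1.
- by rewrite !raddfB /= ex ey ?mulrzBr.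
(* For a product, reversal of factors nests the sum for [x] inside the one for [y]. The inner sum is
   an integer, hence central, and can be pulled out. *)
- have move_in s a b : tmult (tmap face_antipode idfun (s * (a ⊗ b))) =
      face_antipode a * tmult (tmap face_antipode idfun s) * b.
    elim/tensor_ind: s => [|a' b'|s s' es es'].
    + by rewrite mul0r !raddf0 mulr0 mul0r.
    + by rewrite tensM !El face_antipodeM !mulrA.
    + by rewrite mulrDl !raddfD /= es es' mulrDr mulrDl.
  rewrite rmorphM rmorphM intrM -ey.
  elim/tensor_ind: (face_comul y) => [|a b|t t' et et'].
  + by rewrite mulr0 !raddf0 mulr0.
  + by rewrite move_in ex El mulrzr mulrzl mulrzAl.
  + by rewrite mulrDr !raddfD /= et et' mulrDr.
rewrite face_comul_gen (raddf_sum (tmap face_antipode idfun)) /= (raddf_sum (@tmult D)) /=.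
by rewrite -antipode_sum; apply: eq_bigr => i _; rewrite El.
Qed.

Lemma face_antipode_r x :
  tmult (tmap idfun face_antipode (face_comul x)) = (face_counit x)%:~R.
Proof.
have Er a b : tmult (tmap idfun face_antipode (a ⊗ b)) = a * face_antipode b.
  by rewrite tmapE tmultE.
elim/face_alg_ind: x => [|x y ex ey|x y ex ey|n].
- by rewrite !rmorph1 tens11 Er face_antipode1 mulr1.
- by rewrite !raddfB /= ex ey ?mulrzBr.
- have move_in s a b : tmult (tmap idfun face_antipode ((a ⊗ b) * s)) =
      a * tmult (tmap idfun face_antipode s) * face_antipode b.
    elim/tensor_ind: s => [|a' b'|s s' es es'].
    + by rewrite mulr0 !raddf0 mulr0 mul0r.
    + by rewrite tensM !Er face_antipodeM !mulrA.
    + by rewrite mulrDr !raddfD /= es es' mulrDr mulrDl.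
  rewrite rmorphM rmorphM intrM -ex.
  elim/tensor_ind: (face_comul x) => [|a b|t t' et et'].
  + by rewrite mul0r !raddf0 mul0r.
  + by rewrite move_in ey Er !mulrzr mulrzAl.
  + by rewrite mulrDl !raddfD /= et et' mulrDl.
rewrite face_comul_gen (raddf_sum (tmap idfun face_antipode)) /= (raddf_sum (@tmult D)) /=.
rewrite face_counit_gen; transitivity ((n == 0%N)%:R : D); last by case: eqP.
rewrite -(sign_antipode_sum n (face_gen_family R)); apply: eq_bigr => i _.
by rewrite Er face_antipode_gen.
Qed.

Let face_hopf : hopf D :=
  Hopf face_coassoc face_counit_l face_counit_r face_antipode_l face_antipode_r.

Lemma face_hopf_of : exists hD : hopf D, [/\ leibniz_hopf hD d, sign_antipode hD d &
  forall n, counit hD (d n) = (n == 0%N)%:R].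
Proof.
exists face_hopf; split=> //; split=> //; first exact: face_gen0.
apply/seteqP; split=> // y _; have [x <-] := face_alg_ev y.
exact: ev_generated.
Qed.

End FaceHopf.

(** * Convolution of additive maps *)

Section ConvolutionInverse.
Variables (A B : pzRingType) (hA : hopf A).
Implicit Types u v w : {additive A -> B}.

Definition convol u v (x : A) : B := tmult (tmap u v (comul hA x)).

Lemma convol_is_additive u v : zmod_morphism (convol u v).
Proof. by move=> x y; rewrite /convol !raddfB. Qed.
HB.instance Definition _ u v :=
  GRing.isZmodMorphism.Build A B (convol u v) (convol_is_additive u v).

Lemma convolA u v w x : convol u (convol v w) x = convol (convol u v) w x.
Proof.
(* Both bracketings are this triple product applied to the iterated coproduct, and coassociativity
   identifies the two. *)
pose m3 t : B := tmult (tmap u (@tmult B \o tmap v w) t).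
have m3E a b c : m3 (a ⊗ (b ⊗ c)) = u a * (v b * w c).
  by rewrite /m3 tmapE tmultE /= tmapE tmultE.
transitivity (m3 (tmap idfun (comul hA) (comul hA x))).
  rewrite -[LHS]/(tmult (tmap u (convol v w) (comul hA x))).
  elim/tensor_ind: (comul hA x) => [|a b|s t es et].
  - by rewrite /m3 !raddf0.
  - by rewrite /m3 !tmapE !tmultE.
  - by rewrite /m3 !raddfD /= es et.
rewrite -[RHS]/(tmult (tmap (convol u v) w (comul hA x))) -coassoc.
elim/tensor_ind: (comul hA x) => [|a b|s t es et].
- by rewrite /m3 !raddf0.
- rewrite !tmapE tmultE /= /convol.
  elim/tensor_ind: (comul hA a) => [|c e|s t es et].
  + by rewrite tens0l /m3 !raddf0 mul0r.
  + by rewrite tassocE m3E tmapE tmultE mulrA.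
  + by rewrite tensDl /m3 !raddfD /= mulrDl -es -et.
- by rewrite /m3 !raddfD /= -es -et.
Qed.

Definition unit_counit (x : A) : B := (counit hA x)%:~R.
Lemma unit_counit_is_additive : zmod_morphism unit_counit.
Proof. by move=> x y; rewrite /unit_counit !rmorphB. Qed.
HB.instance Definition _ :=
  GRing.isZmodMorphism.Build A B unit_counit unit_counit_is_additive.

Lemma convol1l u x : convol unit_counit u x = u x.
Proof.
rewrite -[x in RHS](counit_l hA) /convol.
elim/tensor_ind: (comul hA x) => [|a b|s t es et].
- by rewrite !raddf0.
- by rewrite !tmapE tmultE tunitlE raddfMz /= /unit_counit mulrzl.
- by rewrite !raddfD /= es et.
Qed.

Lemma convol1r u x : convol u unit_counit x = u x.
Proof.
rewrite -[x in RHS](counit_r hA) /convol.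
elim/tensor_ind: (comul hA x) => [|a b|s t es et].
- by rewrite !raddf0.
- by rewrite !tmapE tmultE tunitrE raddfMz /= /unit_counit mulrzr.
- by rewrite !raddfD /= es et.
Qed.

Lemma eq_convol (u u' v v' : {additive A -> B}) x :
  u =1 u' -> v =1 v' -> convol u v x = convol u' v' x.
Proof.
move=> uu' vv'; congr (tmult _).
apply: (tensor_ext (F := tmap u v) (G := tmap u' v')) => a b /=.
by rewrite !tmapE uu' vv'.
Qed.

Lemma convol_inverse_unique u v w : (forall x, convol u v x = unit_counit x) ->
  (forall x, convol v w x = unit_counit x) -> u =1 w.
Proof.
move=> uv vw x; rewrite -(convol1r u) -(convol1l w).
transitivity (convol u (convol v w) x).
  by apply: eq_convol => // y; exact: esym (vw y).
by rewrite convolA; apply: eq_convol => // y; exact: uv.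
Qed.

End ConvolutionInverse.

(* Both sides are convolution inverses of [f]. *)
Lemma antipode_morphism (A B : pzRingType) (hA : hopf A) (hB : hopf B)
    (f : {rmorphism A -> B}) :
  (forall x, comul hB (f x) = tmap f f (comul hA x)) ->
  (forall x, counit hB (f x) = counit hA x) ->
  forall x, antipode hB (f x) = f (antipode hA x).
Proof.
move=> fcomul fcounit x.
apply: (@convol_inverse_unique _ _ hA (antipode hB \o f) f (f \o antipode hA)) => {}x.
  rewrite /unit_counit -fcounit -antipode_l fcomul /convol.
  elim/tensor_ind: (comul hA x) => [|a b|s t es et].
  - by rewrite !raddf0.
  - by rewrite !tmapE.
  - by rewrite !raddfD /= es et.
rewrite /unit_counit -(rmorph_int f) -antipode_r /convol.
elim/tensor_ind: (comul hA x) => [|a b|s t es et].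
- by rewrite !raddf0.
- by rewrite !tmapE !tmultE /= rmorphM.
- by rewrite !raddfD /= es et.
Qed.

Section LeibnizFamilies.
Variables (H : pzRingType) (hH : hopf H) (h : nat -> H).
Hypothesis leib : leibniz_hopf hH h.

(** The counit is forced. Apply it to the counit axiom at [h (n + 1)]: by induction only the two
    extreme terms survive, so twice the value equals the value. *)
Lemma leibniz_counit n : counit hH (h n) = (n == 0%N)%:R.
Proof.
have [h0 hc _] := leib; elim/ltn_ind: n => -[|n] IH.
  by rewrite h0 rmorph1.
have := congr1 (counit hH) (counit_l hH (h n.+1)).
rewrite hc (raddf_sum (tmap (counit hH) idfun)) (raddf_sum (@tunitl H)) raddf_sum.
rewrite big_ord_recl big_ord_recr big1 => [|i _].
  rewrite /= !tmapE !tunitlE !raddfMz /= /bump /= add1n subSS subnn subn0 h0 !rmorph1.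
  rewrite add0r mulr1z => /eqP; rewrite -subr_eq0 addrAC subrr add0r.
  by move/eqP; rewrite -mulrzl mulr1 intz.
rewrite /= /bump /= add1n tmapE tunitlE raddfMz /= (IH i.+1).
  by rewrite mulr0z.
by rewrite ltnS ltn_ord.
Qed.

Lemma leibniz_euler : sign_antipode hH h -> euler_family h.
Proof.
move=> sgn; have [h0 hc _] := leib; split=> // n n0.
have := antipode_r hH (h n); rewrite hc leibniz_counit gtn_eqF // mulr0z.
rewrite (raddf_sum (tmap idfun (antipode hH))) /= (raddf_sum (@tmult H)) /= => e.
have e' := congr1 (fun z => (-1) ^+ n * z) e.
rewrite mulr0 mulr_sumr in e'; rewrite -[RHS]e'; apply: eq_bigr => i _.
rewrite tmapE tmultE /= sgn [h i * _]mulrA commr_sign !mulrA.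
by rewrite sign_sub ?leq_subr // subKn // -ltnS.
Qed.

End LeibnizFamilies.

Theorem corollary15 (R : realType) :
  exists hD : hopf (face_alg R),
    [/\ leibniz_hopf hD (face_gen R),
        sign_antipode hD (face_gen R)
      & forall (H : pzRingType) (hH : hopf H) (h : nat -> H),
          leibniz_hopf hH h -> sign_antipode hH h ->
          exists f : {rmorphism face_alg R -> H},
            [/\ hopf_morphism hD hH f,
                forall i : nat, f (face_gen R i) = h i
              & forall g : {rmorphism face_alg R -> H},
                  hopf_morphism hD hH g ->
                  (forall i : nat, g (face_gen R i) = h i) ->
                  forall x, g x = f x]].
Proof.
have fam := face_gen_family R.
(* The lift is a morphism to the opposite ring; as a function to the ring itself it needs its
   additive structure anew. *)
pose S : face_alg R -> face_alg R := face_lift (sign_family fam).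
have SB : zmod_morphism S by exact: (raddfB (face_lift (sign_family fam))).
pose SM := GRing.isZmodMorphism.Build (face_alg R) (face_alg R) S SB.
pose Sa : {additive face_alg R -> face_alg R} := HB.pack S SM.
have [] := @face_hopf_of R (face_lift (tensor_family fam fam))
  (face_lift unit_family) Sa.
- exact: (face_lift_gen R (tensor_family fam fam)).
- exact: (face_lift_gen R unit_family).
- exact: (face_lift_gen R (sign_family fam)).
- exact: (rmorphM (face_lift (sign_family fam))).
- exact: (rmorph1 (face_lift (sign_family fam))).
move=> hD [leibD sgnD cD]; exists hD; split=> // H hH h leib sgn.
have hh := leibniz_euler leib sgn.
pose f : {rmorphism face_alg R -> H} := face_lift hh.
have fE i : f (face_gen R i) = h i by exact: (face_lift_gen R hh).
have fcomul x : comul hH (f x) = tmap f f (comul hD x).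
  elim/face_alg_ind: x => [|x y ex ey|x y ex ey|n].
  - by rewrite !rmorph1 tens11 tmapE /= !rmorph1.
  - by rewrite !raddfB /= ex ey.
  - by rewrite !rmorphM tmapM ex ey.
  have [_ cH _] := leib; have [_ cD' _] := leibD.
  rewrite fE cH cD' (raddf_sum (tmap f f)) /=; apply: eq_bigr => i _.
  by rewrite tmapE /= !fE.
have fcounit x : counit hH (f x) = counit hD x.
  elim/face_alg_ind: x => [|x y ex ey|x y ex ey|n].
  - by rewrite !rmorph1.
  - by rewrite !raddfB /= ex ey.
  - by rewrite !rmorphM ex ey.
  by rewrite fE (leibniz_counit leib) cD.
exists f; split=> //.
  by split=> //; exact: antipode_morphism.
move=> g _ gE x; elim/face_alg_ind: x => [|x y ex ey|x y ex ey|n].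
- by rewrite !rmorph1.
- by rewrite !raddfB /= ex ey.
- by rewrite !rmorphM ex ey.
- by rewrite fE gE.
Qed.
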